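(* Let $\phi\in\mathbb M(\mathcal A(\hat{\mathbf R}^d))$ and $F_\phi\in\mathbb M(\mathcal L^1(\mathbf R^d))$ the corresponding multiplier. The following are equivalent: (a) the Radon measure $\phi(t)\,dt$ on $\hat{\mathbf R}^d$ is transformable; (b) $F_\phi$ is locally bounded and its associated Radon measure $\iota F_\phi$ is translation bounded.
   Context: $G=\mathbf R^d$ with dual $\hat{\mathbf R}^d$, pairing $e^{ix\cdot t}$; $\hat f(t)=(2\pi)^{-d}\int e^{-ix\cdot t}f(x)dx$, $\check h(t)=(2\pi)^{-d}\int e^{ix\cdot t}h(x)dx$, Lebesgue measures $dx,dt$. $V=\{t:|t|<1/4\}$. For $E\subseteq\hat{\mathbf R}^d$, $\mathrm{span}(E)$ is the span of the characters $x\mapsto e^{ix\cdot s}$, $s\in E$, each $p=\sum\hat p(s)e^{ix\cdot s}$ uniquely, $\|p\|_\infty=\sup|p|$. For $\phi\in C_b(\hat{\mathbf R}^d)$: $\|\phi\|^{\bar V,s}=\sup\{|\sum_{s'\in\bar V+s}\hat p(s')\phi(s')|:p\in\mathrm{span}(\bar V+s),\|p\|_\infty\le1\}$, $\|\phi\|^{\bar V}=\sup_s\|\phi\|^{\bar V,s}$. On $M(\mathbf R^d)$ put $\|\mu\|_{\bar V}=\|\hat\mu\|^{\bar V}$; $\mathcal L^1(\mathbf R^d)$ is the closure of $L^1(\mathbf R^d)$ in the completion of $(M(\mathbf R^d),\|\cdot\|_{\bar V})$, with generalized Fourier transform $\hat f=\lim\widehat{f_n}$; $\mathcal A(\hat{\mathbf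 R}^d)$ is its image with norm $\|\cdot\|^{\bar V}$, $\mathbb M(\mathcal A(\hat{\mathbf R}^d))=\{\phi\in C_b:\phi\psi\in\mathcal A\ \forall\psi\in\mathcal A\}$, and $F_\phi$ is the multiplier of $\mathcal L^1(\mathbf R^d)$ with $\widehat{F_\phi*f}=\phi\hat f$. $f\in\mathcal L^1(\mathbf R^d)$ is locally integrable if there are $f_n\in L^1$ with $f_n\to f$ in $\|\cdot\|_{\bar V}$ and $\{hf_n\}$ Cauchy in $L^1$ for all $h\in C_c(\mathbf R^d)$; then $hf:=\lim hf_n$; $\mathcal L^1(\mathbf R^d)_{(0)}$ denotes such $f$. With $B_n=\{|x|\le1/n\}$, $e_0=c\,1_{B_4}^{*4}$ ($\|e_0\|_1=1$), $e_n(x)=n^de_0(nx)$: $F_\phi$ is locally bounded if $F_\phi*e_n\in\mathcal L^1(\mathbf R^d)_{(0)}$ for all $n$ and $\sup_n\|h(F_\phi*e_n)\|_1<\infty$ for every $h\in C_c(\mathbf R^d)$. A Radon measure $\nu$ on $\mathbf R^d$ is transformable if there is a Radon measure $\hat\nu$ on $\hat{\mathbf R}^d$ with $\int h*h^*d\nu=\int|\check h|^2d\hat\nu$ for all $h\in C_c(\mathbf R^d)$ ($h^*(x)=\overline{h(-x)}$), and analogously for Radon measures on $\hat{\mathbf R}^d$ with the roles of the groups exchanged; the transform is unique. For locally bounded $F_\phi$ there is a unique transformable Radon measure $\iota F_\phi$ on $\mathbf R^d$ with Fourier transform $\phi(t)dt$, called its associated Radon measure. A Radon measure $\nu$ is translation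 bounded if $\sup_x|\nu|(K+x)<\infty$ for every compact $K$. *)

(* Defs.v *)
From HB Require Import structures.
From mathcomp Require Import all_boot all_order all_algebra.
From mathcomp Require Import all_classical all_reals all_analysis.
From mathcomp Require Import complex.
Set Implicit Arguments. Unset Strict Implicit. Unset Printing Implicit Defensive.
Import Order.TTheory GRing.Theory Num.Theory numFieldNormedType.Exports.
Local Open Scope ring_scope.
Local Open Scope classical_set_scope.

(* Lebesgue integral on R^n (points are row vectors 'rV[R]_n) of       *)
(* non-negative functions, as the iterated one-dimensional Lebesgue    *)
(* integral (Tonelli); R^0 is a point.                                 *)
Fixpoint iint (R : realType) (n : nat) : ('rV[R]_n -> \bar R) -> \bar R :=
  match n return ('rV[R]_n -> \bar R) -> \bar R with
  | 0 => fun f => f 0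
  | n'.+1 => fun f =>
      (\int[@lebesgue_measure R]_(x in setT)
          iint (fun y : 'rV[R]_n' => f (row_mx (\row_(j < 1) x) y)))%E
  end.

Section Defs.
Variables (R : realType) (d : nat).

Local Notation Rd := 'rV[R]_d.
Local Notation C := R[i].

Definition cre (z : C) : R := complex.Re z.
Definition cim (z : C) : R := complex.Im z.
Definition cabs (z : C) : R := Num.sqrt (cre z ^+ 2 + cim z ^+ 2).
Definition rC (r : R) : C := Complex r 0.
Definition cconj (z : C) : C := Complex (cre z) (- cim z).
Definition expi (a : R) : C := Complex (cos a) (sin a).

Definition dotp (x t : Rd) : R := \sum_(i < d) x ord0 i * t ord0 i.
Definition enorm (x : Rd) : R := Num.sqrt (dotp x x).

Definition BorelRd := g_sigma_algebraType (@open Rd).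
Definition cmeasurable (f : Rd -> C) : Prop :=
  measurable_fun (setT : set BorelRd) (fun x : BorelRd => cre (f x)) /\
  measurable_fun (setT : set BorelRd) (fun x : BorelRd => cim (f x)).

Definition ppart (r : R) : \bar R := (Num.max r 0)%:E.
Definition npart (r : R) : \bar R := (Num.max (- r) 0)%:E.

Definition cint (f : Rd -> C) : C :=
  Complex (fine (iint (fun x => ppart (cre (f x)))) - fine (iint (fun x => npart (cre (f x)))))
          (fine (iint (fun x => ppart (cim (f x)))) - fine (iint (fun x => npart (cim (f x))))).

Definition L1 (f : Rd -> C) : Prop :=
  cmeasurable f /\ (iint (fun x => (cabs (f x))%:E) < +oo)%E.
Definition L1norm (f : Rd -> C) : R := fine (iint (fun x => (cabs (f x))%:E)).

Definition twopid : R := ((2 * pi)^-1) ^+ d.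
Definition hatF (f : Rd -> C) (t : Rd) : C :=
  rC twopid * cint (fun x => expi (- dotp x t) * f x).
Definition checkF (h : Rd -> C) (t : Rd) : C :=
  rC twopid * cint (fun x => expi (dotp x t) * h x).

Definition conv (f g : Rd -> C) (x : Rd) : C := cint (fun y => f y * g (x - y)).
Definition invol (h : Rd -> C) (x : Rd) : C := cconj (h (- x)).

Definition ccontinuous (f : Rd -> C) : Prop :=
  continuous (fun x => cre (f x)) /\ continuous (fun x => cim (f x)).
Definition Cc (h : Rd -> C) : Prop :=
  ccontinuous h /\ exists K : set Rd, compact K /\ forall x, ~ K x -> h x = 0.
Definition Cb (f : Rd -> C) : Prop :=
  ccontinuous f /\ exists M : R, forall x, cabs (f x) <= M.

(* The norm ||phi||^{\bar V}.  An element p of span(\bar V + s) is     *)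
(* given by a finite list of (frequency, coefficient) pairs, with all  *)
(* frequencies in \bar V + s = {t : |t - s| <= 1/4};                   *)
(* p(x) = sum_q q.2 e^{i x.q.1}, and sum_{s'} \hat p(s') phi(s') =     *)
(* sum_q q.2 phi(q.1).                                                 *)
Definition inVs (s : Rd) (p : seq (Rd * C)) : bool :=
  all (fun q => enorm (q.1 - s) <= 4^-1) p.
Definition evalp (p : seq (Rd * C)) (x : Rd) : C :=
  \sum_(q <- p) q.2 * expi (dotp x q.1).
Definition Vnorm_s (phi : Rd -> C) (s : Rd) : \bar R :=
  ereal_sup [set (cabs (\sum_(q <- p) q.2 * phi q.1))%:E |
             p in [set p | inVs s p /\ forall x, cabs (evalp p x) <= 1]].
Definition Vnorm (phi : Rd -> C) : \bar R :=
  ereal_sup [set Vnorm_s phi s | s in [set: Rd]].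

(* A(\hat R^d): generalized Fourier transforms of elements of script-L^1,
   i.e. the psi in C_b that are ||.||^{\bar V}-limits of \hat f_k, f_k in L^1 *)
Definition inA (psi : Rd -> C) : Prop :=
  Cb psi /\ exists f : nat -> Rd -> C, (forall k, L1 (f k)) /\
    (Vnorm (fun t => hatF (f k) t - psi t) @[k --> \oo] --> 0%E).

Definition MA (phi : Rd -> C) : Prop :=
  Cb phi /\ forall psi, inA psi -> inA (fun t => phi t * psi t).

Definition ballind (x : Rd) : C := if enorm x <= 4^-1 then 1 else 0.
Definition ind4 : Rd -> C := conv ballind (conv ballind (conv ballind ballind)).
Definition e0 (x : Rd) : C := rC (L1norm ind4)^-1 * ind4 x.
Definition en (n : nat) (x : Rd) : C := rC (n%:R ^+ d) * e0 (n%:R *: x).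

Definition L1cauchy (g : nat -> Rd -> C) : Prop :=
  (forall k, L1 (g k)) /\
  forall e : R, 0 < e -> exists N : nat, forall k m, (N <= k)%N -> (N <= m)%N ->
    L1norm (fun x => g k x - g m x) <= e.

(* F_phi locally bounded: for each n (n >= 1), F_phi * e_n is locally
   integrable, witnessed by f_{n,k} in L^1 with f_{n,k} -> F_phi * e_n in
   ||.||_{\bar V} (i.e. ||\hat f_{n,k} - phi \hat e_n||^{\bar V} -> 0) and
   (h f_{n,k})_k Cauchy in L^1 for every h in C_c; and
   sup_n ||h (F_phi * e_n)||_1 = sup_n lim_k ||h f_{n,k}||_1 < oo. *)
Definition LocBdd (phi : Rd -> C) : Prop :=
  exists F : nat -> nat -> Rd -> C,
    (forall n k, L1 (F n k)) /\
    (forall n, Vnorm (fun t => hatF (F n k) t - phi t * hatF (en n.+1) t)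
                 @[k --> \oo] --> 0%E) /\
    (forall h, Cc h -> forall n, L1cauchy (fun k x => h x * F n k x)) /\
    (forall h, Cc h -> exists M : R, forall n,
        limn (fun k => L1norm (fun x => h x * F n k x)) <= M).

(* Complex Radon measures on R^d: nu = nu1 - nu2 + i (nu3 - nu4) with  *)
(* the nu_j positive Borel measures finite on compact sets.            *)
Record cRadon := CRadon {
  rm1 : {measure set BorelRd -> \bar R};
  rm2 : {measure set BorelRd -> \bar R};
  rm3 : {measure set BorelRd -> \bar R};
  rm4 : {measure set BorelRd -> \bar R};
  rm_locfin : forall K : set Rd, compact K ->
    [/\ (rm1 K < +oo)%E, (rm2 K < +oo)%E, (rm3 K < +oo)%E & (rm4 K < +oo)%E] }.

Definition mint (mu : {measure set BorelRd -> \bar R}) (g : Rd -> C) : C :=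
  Complex
    (fine (\int[mu]_x ppart (cre (g x))) - fine (\int[mu]_x npart (cre (g x))))
    (fine (\int[mu]_x ppart (cim (g x))) - fine (\int[mu]_x npart (cim (g x)))).
Definition cmint (nu : cRadon) (g : Rd -> C) : C :=
  mint (rm1 nu) g - mint (rm2 nu) g + Complex 0 1 * (mint (rm3 nu) g - mint (rm4 nu) g).
Definition rintegrable (nu : cRadon) (g : Rd -> R) : Prop :=
  [/\ (rm1 nu).-integrable (setT : set BorelRd) (fun x => (g x)%:E),
      (rm2 nu).-integrable (setT : set BorelRd) (fun x => (g x)%:E),
      (rm3 nu).-integrable (setT : set BorelRd) (fun x => (g x)%:E) &
      (rm4 nu).-integrable (setT : set BorelRd) (fun x => (g x)%:E)].

Definition cmeas (nu : cRadon) (A : set Rd) : C :=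
  Complex (fine (rm1 nu A) - fine (rm2 nu A)) (fine (rm3 nu A) - fine (rm4 nu A)).
Definition variation (nu : cRadon) (A : set Rd) : \bar R :=
  ereal_sup [set (\sum_(B <- s) cabs (cmeas nu B))%:E | s in
    [set s : seq (set Rd) |
      (forall i, (i < size s)%N -> measurable (nth set0 s i : set BorelRd)) /\
      (forall i j, (i < j)%N -> (j < size s)%N -> nth set0 s i `&` nth set0 s j = set0) /\
      \big[setU/set0]_(B <- s) B = A]].

Definition transl_bounded (nu : cRadon) : Prop :=
  forall K : set Rd, compact K ->
    exists M : R, forall x : Rd, (variation nu [set (k + x)%R | k in K] <= M%:E)%E.

Definition dt_transformable (phi : Rd -> C) : Prop :=
  exists nu : cRadon, forall h : Rd -> C, Cc h ->
    rintegrable nu (fun x => cabs (checkF h x) ^+ 2) /\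
    cint (fun t => conv h (invol h) t * phi t) =
      cmint nu (fun x => rC (cabs (checkF h x) ^+ 2)).

Definition has_transform_dt (mu : cRadon) (phi : Rd -> C) : Prop :=
  forall h : Rd -> C, Cc h ->
    (iint (fun t => (cabs (checkF h t) ^+ 2 * cabs (phi t))%:E) < +oo)%E /\
    cmint mu (conv h (invol h)) = cint (fun t => rC (cabs (checkF h t) ^+ 2) * phi t).

End Defs.

(* Main.v *)
Require Import Defs.
From HB Require Import structures.
From mathcomp Require Import all_boot all_order all_algebra.
From mathcomp Require Import all_classical all_reals all_analysis.
From mathcomp Require Import measurable_realfun.
From mathcomp Require Import complex.
From mathcomp Require Import ring lra.
Set Implicit Arguments. Unset Strict Implicit. Unset Printing Implicit Defensive.
Import Defs.
Import Order.TTheory GRing.Theory Num.Theory numFieldNormedType.Exports.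
Local Open Scope ring_scope.
Local Open Scope classical_set_scope.

(** Both directions rest on one identity between [phi dt] and a Radon measure [nu],
    [int phi(t) FT G(t) dt = const * int G(-x) dnu(x)].
    If [phi dt] has transform [nu], applying the definition to the modulations of a
    test function [k] gives [FT((k * k^* ) phi)(y) = const * int |FT k(x+y)|^2 dnu(x)];
    integrating against [G(y)] and dilating [k] until [|FT k|^2] concentrates at [0]
    gives the identity.  The converse is the mirror image, with translations instead
    of modulations (reached by polarization).

    The interchanges need bounds uniform over translates.  A positive measure which
    integrates [|FT h|^2] for every [h] in [C_c] is translation bounded, by a gliding
    hump; conversely [|FT h|^2] is dominated by the convolution of the indicator of a
    cube with an integrable function, hence is integrated uniformly over translates
    by every translation bounded measure.

    Local boundedness of [F_phi] is witnessed by [chi(x/k) (e_n * mu)(x)] with [chi]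
    positive definite: on the Fourier side the cutoff averages [phi hat(e_n)] over
    small translations, and translation is continuous on [A]. *)

(** * Lebesgue measure behind the iterated integral *)

(** Transformability speaks of autocorrelations only, and [phi] is merely bounded, so against a
    general test function the two sides of the identity cannot be exchanged freely. In the forward
    direction it is therefore first proved with an extra factor [conv k (invol k) (a t)] on the side
    of [phi], whose compact support makes Fubini available; [a] then tends to 0 on both sides at
    once and the value of the factor at 0 cancels. Inversion is likewise used for autocorrelations
    alone: [|FT h|^2] is nonnegative, so bounded Abel means give integrability by Fatou. The
    inversion constant [c0] is never evaluated, because the measure sought is a reflected multiple
    of the given one and the multiple absorbs it. The four components of a [cRadon] may overlap.
    Transformability asks for integrability against each of them, so the gliding hump bounds them
    directly; translation boundedness concerns the variation, in which large components may cancel,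
    hence the Jordan decomposition. That [phi] is a multiplier puts [phi hat(e_n)] in [A], where
    small translations have small effect. *)

Definition pushforward_measure d1 d2 (X : measurableType d1) (Y : measurableType d2) (R : realType)
    (m : {measure set X -> \bar R}) (f : X -> Y) (mf : measurable_fun setT f) :
    {measure set Y -> \bar R} :=
  measure_function_pushforward__canonical__measure_function_Measure m mf.

Section to_sigma_finite.
Context d (X : measurableType d) (R : realType) (m : {measure set X -> \bar R}).
(** An alias of [m] that carries the proof of sigma-finiteness, so that Fubini and Tonelli apply to
    any locally finite measure. *)
Definition to_sigma_finite of sigma_finite setT m : set X -> \bar R := m.
Variable h : sigma_finite setT m.
HB.instance Definition _ := Measure.copy (to_sigma_finite h) m.
HB.instance Definition _ := @Measure_isSigmaFinite.Build _ _ _ (to_sigma_finite h) h.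
End to_sigma_finite.

(** * Borel sets of row vectors: coordinates, rational boxes, cubes *)

Section Borel.
Variables (R : realType) (n : nat).
Local Notation T := (BorelRd R n).

Lemma rV_normE (x : 'rV[R]_n) : `|x| = \big[Num.max/0]_ij `|x ij.1 ij.2|.
Proof. exact: mx_normrE. Qed.

Lemma coord_le_norm (x : 'rV[R]_n) i : `|x ord0 i| <= `|x|.
Proof. by rewrite rV_normE (le_bigmax _ (fun ij => `|x ij.1 ij.2|) (ord0, i)). Qed.

Lemma open_BorelRd (U : set 'rV[R]_n) : open U -> measurable (U : set T).
Proof. exact: sub_sigma_algebra. Qed.

Lemma closed_BorelRd (U : set 'rV[R]_n) : closed U -> measurable (U : set T).
Proof.
by move=> cU; rewrite -(setCK U); apply: measurableC; apply: open_BorelRd; exact: closed_openC.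
Qed.

Lemma continuous_BorelRd (f : 'rV[R]_n -> R) : continuous f ->
  measurable_fun (setT : set T) (f : T -> R).
Proof.
move=> cf; apply: (measurability _ (measurable_realfun.RGenOpens.measurableE R)) => //.
move=> _ [_ [a [b ->] <-]]; apply: open_BorelRd.
by rewrite setTI; apply: open_comp => //; exact: interval_open.
Qed.

Lemma measurable_coord d' (X : measurableType d') (f : X -> T) (i : 'I_n) :
  measurable_fun setT f -> measurable_fun setT (fun x => (f x : 'rV[R]_n) ord0 i).
Proof.
move=> mf; apply: (measurableT_comp (f := fun v : T => (v : 'rV[R]_n) ord0 i)) => //.
by apply: continuous_BorelRd; exact: coord_continuous.
Qed.

Definition ratball (q : 'rV[rat]_n * rat) : set 'rV[R]_n :=
  [set x | forall i, `|x ord0 i - ratr (q.1 ord0 i)| < ratr q.2].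

Lemma open_bigcup_ratball (U : set 'rV[R]_n) : open U ->
  U = \bigcup_(q in [set q | ratball q `<=` U]) ratball q.
Proof.
move=> oU; apply/seteqP; split => [x Ux|x [q /= qU qx]]; last exact: qU.
have /nbhs_ballP[e /= e0 eU] := open_nbhs_nbhs (conj oU Ux).
have e20 : 0 < e / 2 by rewrite divr_gt0.
(* A rational radius [r] below [e / 2]: a box of radius [r] that contains [x] stays within distance
   [2 r < e] of [x]. *)
have [r] := rat_in_itvoo e20; rewrite in_itv/= => /andP[r0 re].
have /choice[c cP] : forall i : 'I_n, exists q : rat, ratr q \in `](x ord0 i - ratr r), (x ord0 i + ratr r)[%R.
  move=> i; have /rat_in_itvoo[q qP] : x ord0 i - ratr r < x ord0 i + ratr r.
    by rewrite ltrD2l (lt_trans _ r0)// oppr_lt0.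
  by exists q.
exists (\row_i c i, r) => /= [y /= yq|i /=]; last first.
  by rewrite mxE; have := cP i; rewrite in_itv/= ltr_norml => /andP[]; lra.
apply: eU; rewrite mx_norm_ball /ball_/=.
have /le_lt_trans : `|x - y| <= 2 * ratr r; last by apply; lra.
rewrite rV_normE; apply/bigmax_leP; split => [|[k i] _]; first by rewrite mulr_ge0// ltW.
rewrite /= ord1 !mxE.
have := yq i; have := cP i; rewrite in_itv/= mxE !ltr_norml ler_norml => /andP[? ?] /andP[? ?].
by apply/andP; split; lra.
Qed.

(** An open set is a countable union of rational boxes, and the preimage of a box is a finite
    intersection of preimages of intervals under the coordinates. *)
Lemma measurable_rV d' (X : measurableType d') (f : X -> T) :
  (forall i, measurable_fun setT (fun x => (f x : 'rV[R]_n) ord0 i)) ->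
  measurable_fun setT f.
Proof.
move=> mf; apply: (@measurability _ _ X T setT f (@open 'rV[R]_n)) => // _ [U oU <-].
rewrite setTI (open_bigcup_ratball oU) preimage_bigcup bigcup_mkcond.
apply: countable_bigcupT_measurable; first exact: countableP.
move=> q; case: ifPn => // _.
rewrite (_ : _ @^-1` _ = \bigcap_(i in [set: 'I_n])
    ((fun x => (f x : 'rV[R]_n) ord0 i) @^-1` ball (ratr (q.1 ord0 i) : R) (ratr q.2))); last first.
  apply/seteqP; split => x /= qx i => [_|].
    by rewrite /ball/= distrC; exact: qx.
  by have := qx i I; rewrite /ball/= distrC.
apply: fin_bigcap_measurable; first exact: finite_finset.
move=> i _; rewrite -[X in measurable X]setTI; apply: mf => //.
by apply: open_measurable; exact: ball_open.
Qed.

(** The norm on row vectors is the sup norm, so these closed balls are products of intervals. *)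
Definition cube (x : 'rV[R]_n) (r : R) : set 'rV[R]_n := [set y | `|y - x| <= r].

Lemma cubeP x r y : 0 <= r -> cube x r y <-> forall i, `|y ord0 i - x ord0 i| <= r.
Proof.
move=> r0; rewrite /cube/= rV_normE; split.
  by move=> /bigmax_leP[_ h] i; have := h (ord0, i) erefl; rewrite !mxE.
by move=> h; apply/bigmax_leP; split => // -[k i] _; rewrite /= ord1 !mxE.
Qed.

Lemma compact_cube x r : compact (cube x r).
Proof.
apply: bounded_closed_compact.
  exists (r + `|x|); split; first exact: num_real.
  move=> M rM y /= yr; rewrite -(subrK x y); apply: le_trans (ler_normD _ _) _.
  by rewrite (le_trans _ (ltW rM))// lerD.
rewrite (_ : cube x r = (fun y : 'rV[R]_n => `|y - x| : R) @^-1` [set z | z <= r])//.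
apply: closed_comp; last exact: closed_le.
move=> y _; apply: (@cvg_norm _ _ _ (nbhs y) _ (fun y : 'rV[R]_n => y - x)).
by apply: cvgB; [exact: cvg_id|exact: cvg_cst].
Qed.

Lemma measurable_cube x r : measurable (cube x r : set T).
Proof. by apply: closed_BorelRd; apply: compact_closed; [exact: norm_hausdorff|exact: compact_cube]. Qed.

Lemma compact_sub_cube (K : set 'rV[R]_n) : compact K -> exists r, 0 < r /\ K `<=` cube 0 r.
Proof.
move=> /compact_bounded[M [_ KM]]; exists (`|M| + 1); split; first by rewrite ltr_wpDl.
move=> x Kx; rewrite /cube/= subr0; apply: (KM _ _ _ Kx).
by rewrite ltr_pwDr// ler_norm.
Qed.

Lemma compact_BorelRd (K : set 'rV[R]_n) : compact K -> measurable (K : set T).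
Proof. by move=> cK; apply: closed_BorelRd; apply: compact_closed => //; exact: norm_hausdorff. Qed.

End Borel.

Definition rcons_mx (R : realType) n (z : R * 'rV[R]_n) : 'rV[R]_n.+1 :=
  row_mx (\row_(j < 1) z.1) z.2.

Lemma rcons_mxl (R : realType) n (z : R * 'rV[R]_n) (k : 'I_1) :
  rcons_mx z ord0 (lshift n k) = z.1.
Proof. by have := row_mxEl (\row_(j < 1) z.1) z.2 ord0 k; rewrite mxE. Qed.

Lemma rcons_mxr (R : realType) n (z : R * 'rV[R]_n) (k : 'I_n) :
  rcons_mx z ord0 (rshift 1 k) = z.2 ord0 k.
Proof. exact: (row_mxEr (\row_(j < 1) z.1) z.2 ord0 k). Qed.

Lemma measurable_rcons_mx (R : realType) n :
  measurable_fun setT (@rcons_mx R n : R * BorelRd R n -> BorelRd R n.+1).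
Proof.
apply: measurable_rV => i.
have [k ik|k ik] := split_ordP (i : 'I_(1 + n)).
  rewrite (_ : (fun _ => _) = fst); first exact: measurable_fst.
  by apply/funext => z/=; rewrite ik rcons_mxl.
rewrite (_ : (fun _ => _) = (fun z : R * BorelRd R n => (z.2 : 'rV[R]_n) ord0 k)); last first.
  by apply/funext => z/=; rewrite ik rcons_mxr.
by apply: measurable_coord; exact: measurable_snd.
Qed.

Lemma measurable_rcons_mx1 (R : realType) n (x : R) :
  measurable_fun setT (fun y : BorelRd R n => rcons_mx (x, y) : BorelRd R n.+1).
Proof. by apply: (measurableT_comp (@measurable_rcons_mx R n)); exact: measurable_pair1. Qed.

(* The definitions only provide the functional [iint]; the measure is recovered by
   recursion on the dimension, as the image of a product measure. *)
Definition is_leb (R : realType) n (lam : {sigma_finite_measure set (BorelRd R n) -> \bar R}) :=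
  [/\ forall f : BorelRd R n -> \bar R, measurable_fun (setT : set (BorelRd R n)) f -> (forall x, 0 <= f x)%E ->
       (\int[lam]_x f x)%E = iint f,
   forall r, (lam (cube 0 r) < +oo)%E &
   forall r, 0 < r -> (0 < lam (cube 0 r))%E].

Lemma cube_exhausts (R : realType) n : \bigcup_k cube (0 : 'rV[R]_n) k%:R = setT.
Proof.
apply/seteqP; split => // x _; exists (Num.truncn `|x|).+1 => //=.
by rewrite /cube/= subr0 ltW// truncnS_gt.
Qed.

Lemma locfin_sigma_finite (R : realType) n (lam : {measure set (BorelRd R n) -> \bar R}) :
  (forall r, (lam (cube 0 r) < +oo)%E) -> sigma_finite setT lam.
Proof.
move=> h; exists (fun k => cube 0 k%:R); first by rewrite cube_exhausts.
by move=> k; split => //; exact: measurable_cube.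
Qed.

Lemma cube_rcons (R : realType) n (r : R) (z : R * 'rV[R]_n) : 0 <= r ->
  cube 0 r (rcons_mx z) <-> `|z.1| <= r /\ cube 0 r z.2.
Proof.
move=> r0; rewrite !cubeP//; split => [h|[h1 h2] i].
  split; first by have := h (lshift n (ord0 : 'I_1)); rewrite rcons_mxl mxE subr0.
  by move=> i; have := h (rshift 1 i); rewrite rcons_mxr !mxE.
have [k ik|k ik] := split_ordP (i : 'I_(1 + n)); rewrite ik ?rcons_mxl ?rcons_mxr mxE.
  by rewrite subr0.
by have := h2 k; rewrite mxE.
Qed.

Lemma ex_leb (R : realType) n : exists lam, @is_leb R n lam.
Proof.
elim: n => [|n [lam [lamE lamf lamp]]].
  exists (dirac (0 : BorelRd R 0)); split.
  - by move=> f mf f0; rewrite integral_dirac// diracT mul1e.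
  - by move=> r; rewrite /= /dirac ltry.
  - by move=> r r0; rewrite /= /dirac indicE mem_set ?lte01//= /cube/= subrr normr0 ltW.
pose P := pushforward_measure (@lebesgue_measure R \x lam)%E (@measurable_rcons_mx R n).
(* The preimage of a cube is an interval times a cube; this product formula yields both the
   finiteness and the positivity asked of cubes. *)
have PC (r : R) : 0 <= r -> P (cube 0 r) = ((2 * r)%:E * lam (cube 0 r))%E.
  move=> r0; rewrite /P/= /pushforward.
  rewrite (_ : _ @^-1` _ = `[- r, r]%classic `*` cube 0 r); last first.
    by apply/seteqP; split => z /=; rewrite cube_rcons// in_itv/= ler_norml.
  rewrite product_measure1E//; last exact: measurable_cube.
  congr (_ * _)%E; transitivity (lebesgue_measure `[- r, r]%classic) => //.
  rewrite lebesgue_measure_itv/= lte_fin; case: ltP => h; rewrite -?EFinD; congr _%:E; first by rewrite opprK; ring.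
  have -> : r = 0 by lra.
  by rewrite mulr0.
have PE f : measurable_fun setT f -> (forall x, 0 <= f x)%E -> (\int[P]_x f x)%E = iint f.
  move=> mf f0; rewrite ge0_integral_pushforward//; last exact: measurable_rcons_mx.
  rewrite preimage_setT fubini_tonelli1//; last 2 first.
  - by apply: measurableT_comp => //; exact: measurable_rcons_mx.
  - by move=> z /=.
  apply: eq_integral => x _; rewrite /fubini_F/= lamE//.
  by apply: (measurableT_comp (f := f)) => //; exact: measurable_rcons_mx1.
have Pf (r : R) : (P (cube 0 r) < +oo)%E.
  have [r0|r0] := leP 0 r; first by rewrite PC// lte_mul_pinfty// lee_fin mulr_ge0.
  have -> : cube (0 : 'rV[R]_n.+1) r = set0.
    by apply/seteqP; split => // x; rewrite /cube/= subr0 => /le_lt_trans/(_ r0); rewrite normr_lt0.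
  by rewrite /P/= /pushforward preimage_set0 measure0.
exists (to_sigma_finite (locfin_sigma_finite Pf)); split => //= r r0; rewrite [X in (0 < X)%E](PC _ (ltW r0)).
by rewrite mule_gt0// ?lamp// lte_fin mulr_gt0.
Qed.

Definition leb (R : realType) n := projT1 (cid (ex_leb R n)).

Section leb_basic.
Variables (R : realType) (n : nat).
Local Notation T := (BorelRd R n).
Local Notation mu := (@leb R n).

Lemma leb_iint (f : T -> \bar R) : measurable_fun (setT : set T) f -> (forall x, 0 <= f x)%E ->
  (\int[mu]_x f x)%E = iint f.
Proof. by rewrite /leb; case: cid => /= lam [lamE _ _]; exact: lamE. Qed.

Lemma leb_cube r : (mu (cube 0 r) < +oo)%E.
Proof. by rewrite /leb; case: cid => /= lam []. Qed.

Lemma leb_cube_gt0 r : 0 < r -> (0 < mu (cube 0 r))%E.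
Proof. by rewrite /leb; case: cid => /= lam [] // _ _; exact. Qed.
End leb_basic.

Lemma iint_ge0 (R : realType) n (f : 'rV[R]_n -> \bar R) : (forall x, 0 <= f x)%E -> (0 <= iint f)%E.
Proof. by elim: n f => [|n IH] f f0 //=; apply: integral_ge0 => x _; exact: IH. Qed.

Lemma measurable_iint_rcons (R : realType) n (f : BorelRd R n.+1 -> \bar R) :
  measurable_fun (setT : set (BorelRd R n.+1)) f -> (forall x, 0 <= f x)%E ->
  measurable_fun (setT : set R) (fun x => iint (fun y : 'rV[R]_n => f (rcons_mx (x, y)))).
Proof.
move=> mf f0; rewrite (_ : (fun _ => _) = fubini_F (@leb R n) (fun z => f (rcons_mx z))).
  apply: measurable_fun_fubini_tonelli_F => //.
  by apply: (measurableT_comp (f := f)) => //; exact: measurable_rcons_mx.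
apply/funext => x; rewrite /fubini_F leb_iint//.
by apply: (measurableT_comp (f := f)) => //; exact: measurable_rcons_mx1.
Qed.

(** By uniqueness of Lebesgue measure it suffices to compare half-open intervals. A negative [a]
    moves the closed end to the other side, which does not change the length. *)
Lemma lebesgue_affine (R : realType) (a b : R) (f : R -> \bar R) : a != 0 ->
  measurable_fun setT f -> (forall x, 0 <= f x)%E ->
  (\int[@lebesgue_measure R]_x f x = `|a|%:E * \int[@lebesgue_measure R]_x f (a * x + b)%R)%E.
Proof.
move=> a0 mf f0; pose g : R -> measurableTypeR R := fun x => a * x + b.
have mg : measurable_fun setT g.
  by apply: measurable_funD => //; apply: measurable_funM.
pose m := pushforward_measure (@lebesgue_measure R) mg.
have na0 : 0 < `|a| by rewrite normr_gt0.
pose m' := mscale (NngNum (ltW na0)) m.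
have mE (A : set (measurableTypeR R)) : measurable A -> lebesgue_measure A = m' A.
  apply: lebesgue_measure_unique => //= _ [[x y]] _ <-.
  rewrite /m' /mscale/= /pushforward /g.
  have /orP[an|ap] : (a < 0) || (0 < a) by rewrite -neq_lt.
  - rewrite (_ : _ @^-1` _ = `[(y - b) / a, (x - b) / a[%classic); last first.
      apply/seteqP; split => z/=; rewrite !in_itv/= ler_ndivrMr// ltr_ndivlMr// => /andP[? ?];
      by apply/andP; split; lra.
    rewrite !lebesgue_measure_itv/= !lte_fin ltr_ndivlMr// divfK// ltrD2r.
    case: ifPn => _; last by rewrite mule0.
    rewrite -!EFinD -EFinM ltr0_norm//; congr EFin; field; exact: a0.
  - rewrite (_ : _ @^-1` _ = `](x - b) / a, (y - b) / a]%classic); last first.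
      apply/seteqP; split => z/=; rewrite !in_itv/= ltr_pdivrMr// ler_pdivlMr// => /andP[? ?];
      by apply/andP; split; lra.
    rewrite !lebesgue_measure_itv/= !lte_fin ltr_pdivlMr// divfK// ltrD2r.
    case: ifPn => _; last by rewrite mule0.
    rewrite -!EFinD -EFinM gtr0_norm//; congr EFin; field; exact: a0.
rewrite (eq_measure_integral m') => [|A mA _]; last exact: mE.
by rewrite ge0_integral_mscale//= ge0_integral_pushforward.
Qed.

Lemma measurable_affine (R : realType) n (a : R) (v : 'rV[R]_n) :
  measurable_fun setT (fun x : BorelRd R n => a *: (x : 'rV[R]_n) + v : BorelRd R n).
Proof.
apply: measurable_rV => i; rewrite (_ : (fun _ => _) = fun x : BorelRd R n => a * (x : 'rV[R]_n) ord0 i + v ord0 i).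
  by apply: measurable_funD => //; apply: measurable_funM => //; exact: measurable_coord.
by apply/funext => x; rewrite !mxE.
Qed.

Lemma iint_affine (R : realType) n (a : R) (v : 'rV[R]_n) (f : BorelRd R n -> \bar R) : a != 0 ->
  measurable_fun (setT : set (BorelRd R n)) f -> (forall x, 0 <= f x)%E ->
  (iint f = (`|a| ^+ n)%:E * iint (fun x => f (a *: x + v)%R))%E.
Proof.
move=> a0; elim: n v f => [|n IH] v f mf f0.
  by rewrite expr0 mul1e/=; congr f; apply/rowP => -[].
have [v1 [v2 vE]] : exists v1 v2, v = rcons_mx (v1, v2).
  exists ((v : 'rV_(1 + n)) ord0 (lshift n (ord0 : 'I_1))), (rsubmx (v : 'rV_(1 + n))).
  apply/rowP => i; have [k ->|k ->] := split_ordP (i : 'I_(1 + n)); rewrite ?rcons_mxl ?rcons_mxr ?mxE//=.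
  by rewrite ord1.
have affE x y : a *: rcons_mx (x, y) + v = rcons_mx (a * x + v1, a *: y + v2).
  rewrite vE; apply/rowP => i.
  have [k ->|k ->] := split_ordP (i : 'I_(1 + n)); by rewrite !(rcons_mxl, rcons_mxr, mxE).
rewrite /=.
rewrite (lebesgue_affine v1 a0)//; last 2 first.
- exact: measurable_iint_rcons.
- by move=> x; apply: iint_ge0.
rewrite exprS EFinM -muleA; congr (_ * _)%E.
rewrite -ge0_integralZl//; last first.
- by move=> x _; apply: iint_ge0.
- apply: (measurable_iint_rcons (f := fun x => f (a *: x + v))) => //.
  by apply: (measurableT_comp (f := f)) => //; exact: measurable_affine.
apply: eq_integral => x _; rewrite -/(rcons_mx (_, _)).
rewrite (IH v2)//; last first.
  by apply: (measurableT_comp (f := f)) => //; exact: measurable_rcons_mx1.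
congr (_ * iint _)%E; apply/funext => y.
by rewrite -[RHS]/(f (a *: rcons_mx (x, y) + v)) affE.
Qed.

Section affine.
Variables (R : realType) (n : nat).
Local Notation T := (BorelRd R n).
Local Notation mu := (@leb R n).

Lemma leb_affine (a : R) (v : 'rV[R]_n) (f : T -> \bar R) : a != 0 ->
  measurable_fun (setT : set T) f -> (forall x, 0 <= f x)%E ->
  (\int[mu]_x f x = (`|a| ^+ n)%:E * \int[mu]_x f (a *: (x : 'rV[R]_n) + v)%R)%E.
Proof.
move=> a0 mf f0; rewrite !leb_iint//; first exact: iint_affine.
by apply: (measurableT_comp (f := f)) => //; exact: measurable_affine.
Qed.

End affine.

(** * Complex-valued integrals *)

Section cplx.
Variable R : realType.
Local Notation C := R[i].
Implicit Types z w : C.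

Lemma cabsE z : `|z| = (cabs z)%:C%C.
Proof. by case: z. Qed.

Lemma rCE (r : R) : rC r = r%:C%C. Proof. by []. Qed.

Lemma cabs_ge0 z : 0 <= cabs z. Proof. exact: sqrtr_ge0. Qed.

Lemma cabsM z w : cabs (z * w) = cabs z * cabs w.
Proof. by have := normrM z w; rewrite !cabsE -rmorphM/= => /complexI. Qed.

Lemma cabsD z w : cabs (z + w) <= cabs z + cabs w.
Proof. by have := ler_normD z w; rewrite !cabsE -rmorphD/= lecR. Qed.

Lemma cabsN z : cabs (- z) = cabs z.
Proof. by have := normrN z; rewrite !cabsE => /complexI. Qed.

Lemma cabsB z w : cabs (z - w) = cabs (w - z).
Proof. by rewrite -cabsN opprB. Qed.

Lemma cabs0 : cabs (0 : C) = 0.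
Proof. by have := normr0 C; rewrite cabsE => /complexI. Qed.

Lemma cabs1 : cabs (1 : C) = 1.
Proof. by have := normr1 C; rewrite cabsE => /complexI. Qed.

Lemma cabs_sum I (s : seq I) (P : pred I) (F : I -> C) :
  cabs (\sum_(i <- s | P i) F i) <= \sum_(i <- s | P i) cabs (F i).
Proof.
elim/big_ind2 : _ => [|x1 x2 y1 y2 h1 h2|//]; first by rewrite cabs0.
by apply: le_trans (cabsD _ _) _; exact: lerD.
Qed.

Lemma cabs_rC (r : R) : cabs (rC r) = `|r|.
Proof. by rewrite /cabs/= expr0n addr0 sqrtr_sqr. Qed.

Lemma cabs_conj z : cabs (cconj z) = cabs z.
Proof. by rewrite /cabs/= sqrrN. Qed.

Lemma cabs_expi (a : R) : cabs (expi a) = 1.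
Proof. by rewrite /cabs/= cos2Dsin2 sqrtr1. Qed.

Lemma ler_cre_cabs z : `|cre z| <= cabs z.
Proof. by rewrite /cabs -sqrtr_sqr ler_wsqrtr// lerDl sqr_ge0. Qed.

Lemma ler_cim_cabs z : `|cim z| <= cabs z.
Proof. by rewrite /cabs -sqrtr_sqr ler_wsqrtr// lerDr sqr_ge0. Qed.

Lemma cabs_le z : cabs z <= `|cre z| + `|cim z|.
Proof.
case: z => a b; have -> : Complex a b = rC a + Complex 0 b by rewrite /rC; simpc.
apply: le_trans (cabsD _ _) _; rewrite cabs_rC/= {1}/cabs/= expr0n add0r sqrtr_sqr.
by rewrite add0r addr0.
Qed.

Lemma creD z w : cre (z + w) = cre z + cre w. Proof. by case: z; case: w. Qed.
Lemma cimD z w : cim (z + w) = cim z + cim w. Proof. by case: z; case: w. Qed.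
Lemma creN z : cre (- z) = - cre z. Proof. by case: z. Qed.
Lemma cimN z : cim (- z) = - cim z. Proof. by case: z. Qed.
Lemma creB z w : cre (z - w) = cre z - cre w. Proof. by case: z; case: w. Qed.
Lemma cimB z w : cim (z - w) = cim z - cim w. Proof. by case: z; case: w. Qed.
Lemma creM z w : cre (z * w) = cre z * cre w - cim z * cim w. Proof. by case: z; case: w. Qed.
Lemma cimM z w : cim (z * w) = cre z * cim w + cim z * cre w.
Proof. by case: z => a b; case: w => c d /=; rewrite /cim/=. Qed.
Lemma cplx_eq z w : cre z = cre w -> cim z = cim w -> z = w.
Proof. by case: z => a b; case: w => c d /= -> ->. Qed.

Lemma expiD (a b : R) : expi (a + b) = expi a * expi b.
Proof. by apply: cplx_eq; rewrite ?creM ?cimM /cre /cim/= ?cosD ?sinD//; ring. Qed.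

Lemma expi0 : expi (0 : R) = 1.
Proof. by rewrite /expi cos0 sin0. Qed.

Lemma conj_expi (a : R) : cconj (expi a) = expi (- a).
Proof. by rewrite /cconj /expi/= cosN sinN. Qed.

Lemma cconjM z w : cconj (z * w) = cconj z * cconj w.
Proof. by apply: cplx_eq; rewrite /= ?(creM, cimM)/=; ring. Qed.
Lemma cconjD z w : cconj (z + w) = cconj z + cconj w.
Proof. by apply: cplx_eq; rewrite /= ?(creD, cimD)/=; ring. Qed.

Lemma mul_cconj z : z * cconj z = rC (cabs z ^+ 2).
Proof.
rewrite /cabs sqr_sqrtr ?addr_ge0 ?sqr_ge0//.
by apply: cplx_eq; rewrite ?creM ?cimM /cre /cim/=; ring.
Qed.

Lemma rCM (a b : R) : rC (a * b) = rC a * rC b.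
Proof. by rewrite !rCE rmorphM. Qed.
Lemma rC1 : rC (1 : R) = 1. Proof. by []. Qed.
Lemma rC0 : rC (0 : R) = 0. Proof. by []. Qed.
Lemma rCX (a : R) n : rC (a ^+ n) = rC a ^+ n.
Proof. by rewrite !rCE rmorphXn. Qed.
Lemma rC_eq0 (a : R) : (rC a == 0) = (a == 0).
Proof. by rewrite -[0]/(rC 0) !rCE (inj_eq (@complexI _)). Qed.
Lemma rC_inj (a b : R) : rC a = rC b -> a = b. Proof. by case. Qed.

Lemma cvg_dist0 (u v : nat -> R) (l : R) : (forall n, `|u n - l| <= v n) ->
  v @ \oo --> (0 : R) -> u @ \oo --> l.
Proof.
move=> uv v0; apply/subr_cvg0; apply/norm_cvg0P.
apply: (@squeeze_cvgr _ _ _ _ (fun=> 0) v) => //; last exact: cvg_cst.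
by apply: nearW => n; rewrite normr_ge0/= uv.
Qed.

(** Only the topology of the reals is involved; [ccvgP] passes to real and imaginary parts. *)
Definition ccvg (u : nat -> C) (l : C) := (fun n => cabs (u n - l)) @ \oo --> (0 : R).

Lemma ccvgP u l : ccvg u l <-> (fun n => cre (u n)) @ \oo --> cre l /\ (fun n => cim (u n)) @ \oo --> cim l.
Proof.
split => [ul|[h1 h2]].
  by split; apply: cvg_dist0 ul => n; rewrite -?creB -?cimB ?ler_cre_cabs ?ler_cim_cabs.
apply: (@squeeze_cvgr _ _ _ _ (fun=> 0) (fun n => `|cre (u n) - cre l| + `|cim (u n) - cim l|)).
- by apply: nearW => n; rewrite cabs_ge0/= -creB -cimB cabs_le.
- exact: cvg_cst.
- rewrite -[X in _ --> X](addr0 (0 : R)); apply: cvgD.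
    by apply/norm_cvg0P; rewrite -[X in _ --> X](subrr (cre l)); apply: cvgB => //; exact: cvg_cst.
  by apply/norm_cvg0P; rewrite -[X in _ --> X](subrr (cim l)); apply: cvgB => //; exact: cvg_cst.
Qed.

Lemma ccvg_unique u l l' : ccvg u l -> ccvg u l' -> l = l'.
Proof.
move=> /ccvgP[h1 h2] /ccvgP[h3 h4]; apply: cplx_eq.
  exact: (cvg_unique _ h1 h3).
exact: (cvg_unique _ h2 h4).
Qed.

Lemma ccvg_cst l : ccvg (fun=> l) l.
Proof. by apply/ccvgP; split; exact: cvg_cst. Qed.

Lemma ccvgD u v l m : ccvg u l -> ccvg v m -> ccvg (fun n => u n + v n) (l + m).
Proof.
move=> /ccvgP[h1 h2] /ccvgP[h3 h4]; apply/ccvgP; rewrite creD cimD.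
by split; under eq_cvg do rewrite ?creD ?cimD; apply: cvgD.
Qed.

Lemma ccvgM u v l m : ccvg u l -> ccvg v m -> ccvg (fun n => u n * v n) (l * m).
Proof.
move=> /ccvgP[h1 h2] /ccvgP[h3 h4]; apply/ccvgP; rewrite creM cimM.
by split; under eq_cvg do rewrite ?creM ?cimM; [apply: cvgB|apply: cvgD]; apply: cvgM.
Qed.

Lemma ccvg_conj u l : ccvg u l -> ccvg (fun n => cconj (u n)) (cconj l).
Proof.
move=> /ccvgP[h1 h2]; apply/ccvgP; split => //=.
exact: cvgN.
Qed.

Lemma ccvg_cabs u l : ccvg u l -> (fun n => cabs (u n)) @ \oo --> cabs l.
Proof.
move=> ul; apply: cvg_dist0 ul => n; rewrite ler_norml; apply/andP; split.
  by have := cabsD (l - u n) (u n); rewrite subrK cabsB; lra.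
by have := cabsD (u n - l) l; rewrite subrK; lra.
Qed.

Lemma ccvg_ext u v l : u =1 v -> ccvg u l -> ccvg v l.
Proof. by move=> uv; rewrite (_ : v = u)//; apply/funext => n; rewrite uv. Qed.

End cplx.

Section cmeas.
Context (R : realType) d (T : measurableType d).
Local Notation C := R[i].
Implicit Types f g : T -> C.

Definition cmeas f := measurable_fun (setT : set T) (fun x => cre (f x)) /\
  measurable_fun (setT : set T) (fun x => cim (f x)).

Lemma cmeas_cst (c : C) : cmeas (fun=> c). Proof. by split; exact: measurable_cst. Qed.

Lemma cmeas_rC (f : T -> R) : measurable_fun setT f -> cmeas (fun x => rC (f x)).
Proof. by move=> mf; split => //=; exact: measurable_cst. Qed.

Lemma cmeasD f g : cmeas f -> cmeas g -> cmeas (fun x => f x + g x).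
Proof.
move=> [f1 f2] [g1 g2]; split.
  by under eq_fun do rewrite creD; exact: measurable_funD.
by under eq_fun do rewrite cimD; exact: measurable_funD.
Qed.

Lemma cmeasN f : cmeas f -> cmeas (fun x => - f x).
Proof.
move=> [f1 f2]; split.
  by under eq_fun do rewrite creN; exact: measurable_funN.
by under eq_fun do rewrite cimN; exact: measurable_funN.
Qed.

Lemma cmeasB f g : cmeas f -> cmeas g -> cmeas (fun x => f x - g x).
Proof. by move=> mf mg; apply: cmeasD => //; exact: cmeasN. Qed.

Lemma cmeasM f g : cmeas f -> cmeas g -> cmeas (fun x => f x * g x).
Proof.
move=> [f1 f2] [g1 g2]; split.
  by under eq_fun do rewrite creM; apply: measurable_funB; exact: measurable_funM.
by under eq_fun do rewrite cimM; apply: measurable_funD; exact: measurable_funM.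
Qed.

Lemma cmeas_conj f : cmeas f -> cmeas (fun x => cconj (f x)).
Proof. by move=> [f1 f2]; split => //=; exact: measurable_funN. Qed.

Lemma cmeas_expi (f : T -> R) : measurable_fun setT f -> cmeas (fun x => expi (f x)).
Proof.
move=> mf; split => /=.
  by apply: (measurableT_comp (f := cos)) => //; apply: continuous_measurable_fun; exact: continuous_cos.
by apply: (measurableT_comp (f := sin)) => //; apply: continuous_measurable_fun; exact: continuous_sin.
Qed.

Lemma measurable_cabs f : cmeas f -> measurable_fun setT (fun x => cabs (f x)).
Proof.
move=> [f1 f2]; rewrite /cabs.
apply: (measurableT_comp (f := fun r : R => Num.sqrt r) (g := fun x => cre (f x) ^+ 2 + cim (f x) ^+ 2)).
  by apply: continuous_measurable_fun; exact: sqrt_continuous.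
by apply: measurable_funD; apply: measurable_funX.
Qed.

Lemma measurable_cabsE f : cmeas f -> measurable_fun setT (fun x => (cabs (f x))%:E).
Proof. by move=> mf; apply/measurable_EFinP; exact: measurable_cabs. Qed.

Lemma cmeas_sum I (s : seq I) (F : I -> T -> C) : (forall i, cmeas (F i)) ->
  cmeas (fun x => \sum_(i <- s) F i x).
Proof.
move=> mF; elim: s => [|i s IH].
  by under eq_fun do rewrite big_nil; exact: cmeas_cst.
by under eq_fun do rewrite big_cons; exact: cmeasD.
Qed.

End cmeas.

Lemma cmeas_comp (R : realType) d d' (T : measurableType d) (T' : measurableType d') (g : T' -> T) (f : T -> R[i]) :
  cmeas f -> measurable_fun setT g -> cmeas (fun x => f (g x)).
Proof.
move=> [f1 f2] mg; split.
  exact: (measurableT_comp (f := fun x => cre (f x))).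
exact: (measurableT_comp (f := fun x => cim (f x))).
Qed.

Section CI.
Context (R : realType) d (T : measurableType d) (m : {measure set T -> \bar R}).
Local Notation C := R[i].
Implicit Types f g : T -> C.

Definition cintegrable f := cmeas f /\ (\int[m]_x (cabs (f x))%:E < +oo)%E.

(** One complex integral for all measures; on integrable functions [cint] and [mint] reduce to it by
    [cintE] and [mintE]. *)
Definition CI f : C := Complex (\int[m]_x cre (f x)) (\int[m]_x cim (f x)).

Lemma cre_CI f : cre (CI f) = \int[m]_x cre (f x). Proof. by []. Qed.
Lemma cim_CI f : cim (CI f) = \int[m]_x cim (f x). Proof. by []. Qed.

Lemma cintegrable_cabs f : cintegrable f -> m.-integrable setT (fun x => (cabs (f x))%:E).
Proof.
move=> [mf fi]; apply/integrableP; split; first exact: measurable_cabsE.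
by under eq_integral do rewrite abse_EFin ger0_norm ?cabs_ge0//.
Qed.

Lemma cintegrable_le f (g : T -> R) : cmeas f -> m.-integrable setT (fun x => (g x)%:E) ->
  (forall x, cabs (f x) <= g x) -> cintegrable f.
Proof.
move=> mf gi fg; split => //; move/integrableP : (gi) => [mg]; apply: le_lt_trans.
apply: ge0_le_integral => //.
- by move=> x _; rewrite lee_fin cabs_ge0.
- exact: measurable_cabsE.
- exact: measurableT_comp.
- by move=> x _; rewrite abse_EFin lee_fin (le_trans (fg x))// ler_norm.
Qed.

Lemma cintegrableP f : cintegrable f <->
  m.-integrable setT (fun x => (cre (f x))%:E) /\ m.-integrable setT (fun x => (cim (f x))%:E).
Proof.
split => [fi|[h1 h2]].
  have fa := cintegrable_cabs fi; case: fi => -[f1 f2] _.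
  split; apply: le_integrable fa => //; try exact/measurable_EFinP; move=> x _ /=;
    by rewrite lee_fin [leRHS]ger0_norm ?cabs_ge0// ?ler_cre_cabs ?ler_cim_cabs.
have mf : cmeas f.
  by split; apply/measurable_EFinP; [move/integrableP : h1 => []|move/integrableP : h2 => []].
apply: (cintegrable_le (g := fun x => `|cre (f x)| + `|cim (f x)|)) => // [|x]; last exact: cabs_le.
under eq_fun do rewrite EFinD.
by apply: integrableD => //; apply: integrable_norm.
Qed.

Lemma eq_CI f g : f =1 g -> CI f = CI g.
Proof. by move=> fg; rewrite (_ : f = g)//; exact/funext. Qed.

Lemma cintegrable0 : cintegrable (fun=> 0).
Proof. by split; [exact: cmeas_cst|rewrite cabs0 integral0]. Qed.

Lemma cintegrableD f g : cintegrable f -> cintegrable g -> cintegrable (fun x => f x + g x).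
Proof.
move=> fi gi; have fa := cintegrable_cabs fi; have ga := cintegrable_cabs gi.
apply: (cintegrable_le (g := fun x => cabs (f x) + cabs (g x))).
- by apply: cmeasD; [case: fi|case: gi].
- by under eq_fun do rewrite EFinD; exact: integrableD.
- by move=> x; exact: cabsD.
Qed.

Lemma cintegrableM_bdd f g (M : R) : cintegrable f -> cmeas g -> (forall x, cabs (g x) <= M) ->
  cintegrable (fun x => f x * g x).
Proof.
move=> fi mg gM; have fa := cintegrable_cabs fi.
apply: (cintegrable_le (g := fun x => M * cabs (f x))).
- by apply: cmeasM => //; case: fi.
- by under eq_fun do rewrite EFinM; exact: integrableZl.
- by move=> x; rewrite cabsM mulrC ler_wpM2r ?cabs_ge0.
Qed.

Lemma cintegrableZ (c : C) f : cintegrable f -> cintegrable (fun x => c * f x).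
Proof.
move=> fi; under eq_fun do rewrite mulrC.
by apply: (cintegrableM_bdd (M := cabs c)) => //; exact: cmeas_cst.
Qed.

Lemma cintegrableN f : cintegrable f -> cintegrable (fun x => - f x).
Proof. by move=> /(cintegrableZ (-1)); under eq_fun do rewrite mulN1r. Qed.

Lemma cintegrableB f g : cintegrable f -> cintegrable g -> cintegrable (fun x => f x - g x).
Proof. by move=> fi gi; apply: cintegrableD => //; exact: cintegrableN. Qed.

Lemma cintegrable_conj f : cintegrable f -> cintegrable (fun x => cconj (f x)).
Proof.
move=> [mf fi]; split; first exact: cmeas_conj.
by under eq_integral do rewrite cabs_conj.
Qed.

Lemma cintegrable_rC (f : T -> R) : m.-integrable setT (fun x => (f x)%:E) ->
  cintegrable (fun x => rC (f x)).
Proof.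
move=> fi; apply: (cintegrable_le (g := fun x => `|f x|)).
- by apply: cmeas_rC; apply/measurable_EFinP; case/integrableP : fi.
- exact: integrable_norm.
- by move=> x; rewrite cabs_rC.
Qed.

Lemma CI_rC (f : T -> R) : CI (fun x => rC (f x)) = rC (\int[m]_x f x).
Proof. by rewrite /CI /rC /=; congr Complex; rewrite /Rintegral integral0. Qed.

Lemma CID f g : cintegrable f -> cintegrable g -> CI (fun x => f x + g x) = CI f + CI g.
Proof.
move=> /cintegrableP[f1 f2] /cintegrableP[g1 g2]; rewrite /CI; simpc; congr Complex.
  by under eq_Rintegral do rewrite creD; rewrite RintegralD.
by under eq_Rintegral do rewrite cimD; rewrite RintegralD.
Qed.

Lemma CIZ (c : C) f : cintegrable f -> CI (fun x => c * f x) = c * CI f.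
Proof.
move=> /cintegrableP[f1 f2]; apply: cplx_eq; rewrite ?creM ?cimM /cre /cim/= -/cre -/cim.
  rewrite -!RintegralZl// -RintegralB//; last 2 first.
  - by under [X in integrable _ _ X]eq_fun do rewrite /= EFinM; exact: integrableZl.
  - by under [X in integrable _ _ X]eq_fun do rewrite /= EFinM; exact: integrableZl.
  by apply: eq_Rintegral => x _; rewrite creM.
rewrite -!RintegralZl// -RintegralD//; last 2 first.
- by under [X in integrable _ _ X]eq_fun do rewrite /= EFinM; exact: integrableZl.
- by under [X in integrable _ _ X]eq_fun do rewrite /= EFinM; exact: integrableZl.
by apply: eq_Rintegral => x _; rewrite cimM.
Qed.

Lemma CIN f : cintegrable f -> CI (fun x => - f x) = - CI f.
Proof. by move=> fi; rewrite -mulN1r -CIZ//; apply: eq_CI => x; rewrite mulN1r. Qed.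

Lemma CIB f g : cintegrable f -> cintegrable g -> CI (fun x => f x - g x) = CI f - CI g.
Proof. by move=> fi gi; rewrite CID ?CIN//; exact: cintegrableN. Qed.

Lemma CI_conj f : cintegrable f -> CI (fun x => cconj (f x)) = cconj (CI f).
Proof.
move=> /cintegrableP[f1 f2]; rewrite /CI /cconj/=; congr Complex.
rewrite -mulN1r -RintegralZl//; apply: eq_Rintegral => x _; rewrite mulN1r//.
Qed.

Lemma CI_sum I (s : seq I) (F : I -> T -> C) : (forall i, cintegrable (F i)) ->
  cintegrable (fun x => \sum_(i <- s) F i x) /\
  CI (fun x => \sum_(i <- s) F i x) = \sum_(i <- s) CI (F i).
Proof.
move=> Fi; elim: s => [|i s [IH1 IH2]].
  under eq_fun do rewrite big_nil; split; first exact: cintegrable0.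
  by rewrite big_nil -rC0 CI_rC/= Rintegral_cst// mul0r.
under eq_fun do rewrite big_cons; split; first exact: cintegrableD.
by rewrite CID// big_cons IH2.
Qed.

Lemma cabs_CI f : cintegrable f -> cabs (CI f) <= \int[m]_x cabs (f x).
Proof.
move=> fi; have fa := cintegrable_cabs fi.
(* Multiplying [f] by the conjugate of its integral [w] makes the integral real: [|w|^2] is the
   integral of [Re (conj w f)], at most [|w|] times that of [|f|]. *)
set w := CI f; have [w0|w0] := eqVneq (cabs w) 0.
  by rewrite w0; apply: Rintegral_ge0 => x _; exact: cabs_ge0.
have wp : 0 < cabs w by rewrite lt_def w0 cabs_ge0.
rewrite -(ler_pM2l wp) -RintegralZl// -expr2.
have -> : cabs w ^+ 2 = \int[m]_x cre (cconj w * f x).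
  have : rC (cabs w ^+ 2) = CI (fun x => cconj w * f x) by rewrite CIZ// -/w mulrC mul_cconj.
  by rewrite /CI/rC => -[].
apply: le_Rintegral => //.
- by have /cintegrableP[] := cintegrableZ (cconj w) fi.
- by under [X in integrable _ _ X]eq_fun do rewrite /= EFinM; exact: integrableZl.
- by move=> x _; rewrite (le_trans (ler_norm _))// (le_trans (ler_cre_cabs _))// cabsM cabs_conj.
Qed.

Lemma cabs_CI_le f (g : T -> R) : cmeas f -> m.-integrable setT (fun x => (g x)%:E) ->
  (forall x, cabs (f x) <= g x) -> cabs (CI f) <= \int[m]_x g x.
Proof.
move=> mf gi fg; have fi := cintegrable_le mf gi fg.
by apply: le_trans (cabs_CI fi) _; apply: le_Rintegral => //; exact: cintegrable_cabs.
Qed.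

Lemma Rintegral_dct (F : nat -> T -> R) (f g : T -> R) :
  (forall n, measurable_fun setT (F n)) ->
  (forall x, F ^~ x @ \oo --> f x) ->
  m.-integrable setT (fun x => (g x)%:E) ->
  (forall n x, `|F n x| <= g x) ->
  (fun n => \int[m]_x F n x) @ \oo --> \int[m]_x f x.
Proof.
move=> mF Ff gi Fg.
have mf : measurable_fun setT f by apply: (measurable_fun_cvg (h := F)) => // x _; exact: Ff.
have [|||||fi _ h] := @dominated_convergence _ _ _ m setT measurableT (fun n x => (F n x)%:E) (fun x => (f x)%:E)
  (fun x => (g x)%:E).
- by move=> n; exact/measurable_EFinP.
- exact/measurable_EFinP.
- by apply: aeW => x _; apply: cvg_EFin; [exact: nearW|exact: Ff].
- exact: gi.
- by apply: aeW => x n _; rewrite lee_fin.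
apply: (fine_cvg (f := fun n => (\int[m]_x (F n x)%:E)%E)).
by rewrite /Rintegral fineK//; exact: integrable_fin_num.
Qed.

Lemma CI_dct (F : nat -> T -> C) (f : T -> C) (g : T -> R) :
  (forall n, cmeas (F n)) -> (forall x, ccvg (F ^~ x) (f x)) ->
  m.-integrable setT (fun x => (g x)%:E) ->
  (forall n x, cabs (F n x) <= g x) ->
  ccvg (fun n => CI (F n)) (CI f).
Proof.
move=> mF Ff gi Fg; apply/ccvgP; split; rewrite /CI/=.
  apply: Rintegral_dct gi _ => [n|x|n x]; first by have [] := mF n.
    by have /ccvgP[] := Ff x.
  by rewrite (le_trans (ler_cre_cabs _)).
apply: Rintegral_dct gi _ => [n|x|n x]; first by have [] := mF n.
  by have /ccvgP[] := Ff x.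
by rewrite (le_trans (ler_cim_cabs _)).
Qed.

End CI.

(** * Fubini and affine changes of variables *)

(** Inner integrals in Fubini are finite only almost everywhere; replacing the infinite values by 0
    changes nothing under the outer integral. *)
Lemma integrable_fine (R : realType) d (T : measurableType d) (m : {measure set T -> \bar R}) (F : T -> \bar R) :
  m.-integrable setT F -> m.-integrable setT (fun x => (fine (F x))%:E) /\
  (\int[m]_x (fine (F x))%:E = \int[m]_x F x)%E.
Proof.
move=> Fi; have mF := measurable_int _ Fi.
have mfF : measurable_fun setT (fun x => (fine (F x))%:E).
  by apply/measurable_EFinP; apply: (measurableT_comp (f := fine)).
have ae : ae_eq m setT F (fun x => (fine (F x))%:E).
  by move: (integrable_ae measurableT Fi); apply: filterS => x /= h _; rewrite fineK//; exact: h.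
split; last by apply/esym; exact: ae_eq_integral.
apply/integrableP; split => //; move/integrableP : (Fi) => [_]; apply: le_lt_trans.
apply: ge0_le_integral => //; try exact: measurableT_comp.
by move=> x _; case: (F x) => //=; rewrite ?lexx// normr0 leey.
Qed.

Section Fubini.
Context (R : realType) d1 d2 (T1 : measurableType d1) (T2 : measurableType d2).
Variables (m1 : {sigma_finite_measure set T1 -> \bar R}) (m2 : {sigma_finite_measure set T2 -> \bar R}).
Local Notation C := R[i].

Lemma Rintegral_fubini (f : T1 -> T2 -> R) :
  measurable_fun setT (fun z : T1 * T2 => f z.1 z.2) ->
  (\int[m1]_x \int[m2]_y `|f x y|%:E < +oo)%E ->
  [/\ m1.-integrable setT (fun x => (\int[m2]_y f x y)%:E),
      m2.-integrable setT (fun y => (\int[m1]_x f x y)%:E) &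
  \int[m1]_x \int[m2]_y f x y = \int[m2]_y \int[m1]_x f x y].
Proof.
move=> mf foo.
have fi : (m1 \x m2)%E.-integrable setT (fun z => (f z.1 z.2)%:E).
  by apply/integrable12ltyP => //; exact/measurable_EFinP.
have [h1 h2] := integrable_fine (integrable_fubini_F fi).
have fi' : (m2 \x m1)%E.-integrable setT (fun z => (f z.2 z.1)%:E).
  have mf' : measurable_fun setT (fun z : T2 * T1 => (f z.2 z.1)%:E).
    apply/measurable_EFinP; apply: (measurableT_comp (f := fun z : T1 * T2 => f z.1 z.2) (g := fun z : T2 * T1 => (z.2, z.1))) => //.
    by apply: measurable_fun_pair; [exact: measurable_snd|exact: measurable_fst].
  apply/integrable12ltyP => //; move: foo; congr (_ < _)%E.
  apply: (fubini_tonelli (fun z => `|(f z.1 z.2)%:E|%E)) => //.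
  by apply: measurableT_comp => //; exact/measurable_EFinP.
have [h3 h4] := integrable_fine (integrable_fubini_F fi').
split => //; rewrite [LHS]/Rintegral [RHS]/Rintegral; congr fine.
apply: etrans h2 _; apply/esym; apply: etrans h4 _; apply/esym.
exact: (Fubini fi).
Qed.

Lemma CI_fubini (f : T1 -> T2 -> C) :
  cmeas (fun z : T1 * T2 => f z.1 z.2) ->
  (\int[m1]_x \int[m2]_y (cabs (f x y))%:E < +oo)%E ->
  [/\ cintegrable m1 (fun x => CI m2 (f x)),
      cintegrable m2 (fun y => CI m1 (f^~ y)) &
      CI m1 (fun x => CI m2 (f x)) = CI m2 (fun y => CI m1 (f^~ y))].
Proof.
move=> mf foo; have [mf1 mf2] := mf.
have le (g : T1 -> T2 -> R) : measurable_fun setT (fun z : T1 * T2 => g z.1 z.2) ->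
    (forall x y, `|g x y| <= cabs (f x y)) ->
    (\int[m1]_x \int[m2]_y `|g x y|%:E < +oo)%E.
  move=> mg gf; apply: le_lt_trans foo.
  have mg' : measurable_fun setT (fun z : T1 * T2 => `|g z.1 z.2|%:E).
    by apply/measurable_EFinP; apply: measurableT_comp.
  have mf' : measurable_fun setT (fun z : T1 * T2 => (cabs (f z.1 z.2))%:E).
    exact: measurable_cabsE.
  apply: ge0_le_integral => //.
  - by move=> x _; apply: integral_ge0 => y _; rewrite lee_fin.
  - exact: (measurable_fun_fubini_tonelli_F (fun z => `|g z.1 z.2|%:E)).
  - apply: (measurable_fun_fubini_tonelli_F (fun z => (cabs (f z.1 z.2))%:E)) => //.
    by move=> z; rewrite lee_fin cabs_ge0.
  - move=> x _; apply: ge0_le_integral => //.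
    + exact: (measurableT_comp mg' (measurable_pair1 x)).
    + exact: (measurableT_comp mf' (measurable_pair1 x)).
    + by move=> y _; rewrite lee_fin.
have [a1 a2 a3] := Rintegral_fubini mf1 (le _ mf1 (fun x y => ler_cre_cabs _)).
have [b1 b2 b3] := Rintegral_fubini mf2 (le _ mf2 (fun x y => ler_cim_cabs _)).
split; [by apply/cintegrableP; split..|].
by rewrite /CI/=; congr Complex.
Qed.

Lemma tonelli (f : T1 -> T2 -> R) :
  measurable_fun setT (fun z : T1 * T2 => f z.1 z.2) -> (forall x y, 0 <= f x y) ->
  (\int[m1]_x \int[m2]_y (f x y)%:E = \int[m2]_y \int[m1]_x (f x y)%:E)%E.
Proof.
move=> mf f0; apply: (fubini_tonelli (fun z => (f z.1 z.2)%:E)); first exact/measurable_EFinP.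
by move=> z; rewrite lee_fin.
Qed.

Lemma measurable_CI2 (f : T1 -> T2 -> C) :
  cmeas (fun z : T1 * T2 => f z.1 z.2) -> (forall x, cintegrable m2 (f x)) ->
  cmeas (fun x => CI m2 (f x)).
Proof.
move=> [f1 f2] fi.
have mR (g : T1 -> T2 -> R) : measurable_fun setT (fun z : T1 * T2 => g z.1 z.2) ->
    measurable_fun setT (fun x => \int[m2]_y g x y).
  move=> mg; apply: (measurableT_comp (f := fine)) => //.
  have mg' : measurable_fun setT (fun z : T1 * T2 => (g z.1 z.2)%:E) by exact/measurable_EFinP.
  (* Tonelli gives measurability for the positive and the negative part separately. *)
  rewrite (_ : (fun _ => _) = (fun x => \int[m2]_y ((fun z => (g z.1 z.2)%:E)^\+ (x, y)) -
     \int[m2]_y ((fun z => (g z.1 z.2)%:E)^\- (x, y)))%E); last first.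
    apply/funext => x; rewrite [LHS]integralE.
    by congr (_ - _)%E; apply: eq_integral => y _; rewrite ?funeposE ?funenegE.
  by apply: emeasurable_funB; apply: measurable_fun_fubini_tonelli_F => //;
    [exact: measurable_funepos|exact: measurable_funeneg].
by split; exact: mR.
Qed.
End Fubini.

Section leb.
Variables (R : realType) (n : nat).
Local Notation T := (BorelRd R n).
Local Notation mu := (@leb R n).
Local Notation C := R[i].

Lemma ge0_fine_iint (f : T -> R) : measurable_fun (setT : set T) f -> (forall x, 0 <= f x) ->
  iint (fun x : 'rV[R]_n => (f x)%:E) = (\int[mu]_x (f x)%:E)%E.
Proof. by move=> mf f0; rewrite leb_iint//; exact/measurable_EFinP. Qed.

Lemma L1P (f : 'rV[R]_n -> C) : L1 f <-> cintegrable mu (f : T -> C).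
Proof.
split => -[mf fi]; split => //; move: fi; rewrite ge0_fine_iint//;
  by [exact: measurable_cabs|move=> x; exact: cabs_ge0].
Qed.

Lemma L1normE (f : 'rV[R]_n -> C) : cmeas (f : T -> C) -> L1norm f = \int[mu]_x cabs (f x).
Proof.
move=> mf; rewrite /L1norm ge0_fine_iint//; first exact: (measurable_cabs mf).
by move=> x; exact: cabs_ge0.
Qed.

Lemma parts_integral d' (X : measurableType d') (m : {measure set X -> \bar R}) (f : X -> R) :
  m.-integrable setT (fun x => (f x)%:E) ->
  fine (\int[m]_x ppart (f x)) - fine (\int[m]_x npart (f x)) = \int[m]_x f x.
Proof.
move=> fi.
have p1 : (\int[m]_x ppart (f x) = \int[m]_x (fun x => (f x)%:E)^\+ x)%E.
  by apply: eq_integral => x _; rewrite funeposE /ppart EFin_max.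
have p2 : (\int[m]_x npart (f x) = \int[m]_x (fun x => (f x)%:E)^\- x)%E.
  by apply: eq_integral => x _; rewrite funenegE /npart EFin_max.
rewrite p1 p2 -fineB; last 2 first.
- exact: integrable_pos_fin_num.
- exact: integrable_neg_fin_num.
by rewrite /Rintegral [in RHS]integralE.
Qed.

Lemma cintE (f : 'rV[R]_n -> C) : cintegrable mu (f : T -> C) -> cint f = CI mu (f : T -> C).
Proof.
move=> fi; have [mf1 mf2] := fi.1.
have mp (g : T -> R) : measurable_fun (setT : set T) g ->
   iint (fun x : 'rV[R]_n => ppart (g x)) = (\int[mu]_x ppart (g x))%E /\
   iint (fun x : 'rV[R]_n => npart (g x)) = (\int[mu]_x npart (g x))%E.
  move=> mg; split; apply: ge0_fine_iint.
  - by apply: measurable_maxr => //; exact: measurable_cst.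
  - by move=> x; rewrite le_max lexx orbT.
  - by apply: measurable_maxr; [exact: measurable_funN|exact: measurable_cst].
  - by move=> x; rewrite le_max lexx orbT.
have /cintegrableP[i1 i2] := fi.
rewrite /cint !(mp _ mf1).1 !(mp _ mf1).2 !(mp _ mf2).1 !(mp _ mf2).2.
by rewrite !parts_integral.
Qed.

Lemma mintE (lam : {measure set T -> \bar R}) (g : T -> C) : cintegrable lam g -> mint lam g = CI lam g.
Proof. by move=> /cintegrableP[i1 i2]; rewrite /mint !parts_integral. Qed.

Lemma integrable_affine (a : R) (v : 'rV[R]_n) (f : T -> R) : a != 0 ->
  mu.-integrable setT (fun x => (f x)%:E) ->
  mu.-integrable setT (fun x : T => (f (a *: (x : 'rV[R]_n) + v))%:E) /\
  \int[mu]_x f x = `|a| ^+ n * \int[mu]_x f (a *: (x : 'rV[R]_n) + v).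
Proof.
move=> a0 fi; have /integrableP[mf foo] := fi.
have an0 : 0 < `|a| ^+ n by rewrite exprn_gt0// normr_gt0.
have fai : mu.-integrable setT (fun x : T => (f (a *: (x : 'rV[R]_n) + v))%:E).
  apply/integrableP; split.
    by apply: (measurableT_comp (f := fun x => (f x)%:E)) => //; exact: measurable_affine.
  move: foo; rewrite (leb_affine v a0)//; last exact: measurableT_comp.
  suff h I : ((`|a| ^+ n)%:E * I < +oo -> I < +oo)%E by exact: h.
  by case: I => [r| |//]; rewrite ?ltry// mulry gtr0_sg// mul1e.
split => //; rewrite /Rintegral integralE [in RHS]integralE.
rewrite (leb_affine v a0 (measurable_funepos mf))//.
rewrite (leb_affine v a0 (measurable_funeneg mf))//.
have pA := integrable_pos_fin_num measurableT fai; have pB := integrable_neg_fin_num measurableT fai.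
have -> : (\int[mu]_x (fun x => (f x)%:E)^\+ (a *: (x : 'rV[R]_n) + v)%R =
   \int[mu]_x (fun x : T => (f (a *: (x : 'rV[R]_n) + v))%:E)^\+ x)%E.
  by apply: eq_integral => x _; rewrite !funeposE.
have -> : (\int[mu]_x (fun x => (f x)%:E)^\- (a *: (x : 'rV[R]_n) + v)%R =
   \int[mu]_x (fun x : T => (f (a *: (x : 'rV[R]_n) + v))%:E)^\- x)%E.
  by apply: eq_integral => x _; rewrite !funenegE.
by rewrite -(fineK pA) -(fineK pB) -!EFinM -!EFinB/= mulrBr.
Qed.

Lemma CI_affine (a : R) (v : 'rV[R]_n) (f : T -> C) : a != 0 -> cintegrable mu f ->
  cintegrable mu (fun x : T => f (a *: (x : 'rV[R]_n) + v)) /\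
  CI mu f = rC (`|a| ^+ n) * CI mu (fun x : T => f (a *: (x : 'rV[R]_n) + v)).
Proof.
move=> a0 /cintegrableP[f1 f2].
have [g1 e1] := integrable_affine v a0 f1; have [g2 e2] := integrable_affine v a0 f2.
split; first exact/cintegrableP.
by apply: cplx_eq; rewrite ?creM ?cimM /cre /cim/= -/cre -/cim mul0r ?subr0 ?addr0.
Qed.

Lemma CI_translate (v : 'rV[R]_n) (f : T -> C) : cintegrable mu f ->
  cintegrable mu (fun x : T => f ((x : 'rV[R]_n) + v)) /\
  CI mu (fun x : T => f ((x : 'rV[R]_n) + v)) = CI mu f.
Proof.
move=> fi; have [h1 h2] := CI_affine v (oner_neq0 R) fi.
have E : (fun x : T => f (1 *: (x : 'rV[R]_n) + v)) = (fun x : T => f ((x : 'rV[R]_n) + v)).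
  by apply/funext => x; rewrite scale1r.
by rewrite E in h1 h2; split => //; rewrite h2 normr1 expr1n rC1 mul1r.
Qed.

Lemma CI_reflect (v : 'rV[R]_n) (f : T -> C) : cintegrable mu f ->
  cintegrable mu (fun x : T => f (v - (x : 'rV[R]_n))) /\
  CI mu (fun x : T => f (v - (x : 'rV[R]_n))) = CI mu f.
Proof.
move=> fi; have [|h1 h2] := CI_affine (a := -1) v _ fi; first by rewrite oppr_eq0 oner_neq0.
have E : (fun x : T => f (-1 *: (x : 'rV[R]_n) + v)) = (fun x : T => f (v - (x : 'rV[R]_n))).
  by apply/funext => x; rewrite scaleN1r addrC.
by rewrite E in h1 h2; split => //; rewrite h2 normrN normr1 expr1n rC1 mul1r.
Qed.

Lemma ge0_translate (v : 'rV[R]_n) (f : T -> \bar R) : measurable_fun setT f -> (forall x, 0 <= f x)%E ->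
  (\int[mu]_x f ((x : 'rV[R]_n) + v)%R = \int[mu]_x f x)%E.
Proof.
move=> mf f0; rewrite [RHS](leb_affine v (oner_neq0 R))// normr1 expr1n mul1e.
by apply: eq_integral => x _; rewrite scale1r.
Qed.

Lemma measurable_addrv d' (X : measurableType d') (f g : X -> T) : measurable_fun setT f -> measurable_fun setT g ->
  measurable_fun setT (fun x => (f x : 'rV[R]_n) + g x : T).
Proof.
move=> mf mg; apply: measurable_rV => i.
rewrite (_ : (fun _ => _) = fun x => (f x : 'rV[R]_n) ord0 i + (g x : 'rV[R]_n) ord0 i).
  by apply: measurable_funD; exact: measurable_coord.
by apply/funext => x; rewrite mxE.
Qed.

Lemma measurable_oppv d' (X : measurableType d') (f : X -> T) : measurable_fun setT f ->
  measurable_fun setT (fun x => - (f x : 'rV[R]_n) : T).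
Proof.
move=> mf; apply: measurable_rV => i.
rewrite (_ : (fun _ => _) = fun x => - (f x : 'rV[R]_n) ord0 i).
  by apply: measurable_funN; exact: measurable_coord.
by apply/funext => x; rewrite mxE.
Qed.

Lemma measurable_subrv d' (X : measurableType d') (f g : X -> T) : measurable_fun setT f -> measurable_fun setT g ->
  measurable_fun setT (fun x => (f x : 'rV[R]_n) - g x : T).
Proof. by move=> mf mg; apply: measurable_addrv => //; exact: measurable_oppv. Qed.

Lemma measurable_scalev d' (X : measurableType d') (c : R) (f : X -> T) : measurable_fun setT f ->
  measurable_fun setT (fun x => c *: (f x : 'rV[R]_n) : T).
Proof.
move=> mf; apply: measurable_rV => i.
rewrite (_ : (fun _ => _) = fun x => c * (f x : 'rV[R]_n) ord0 i).
  by apply: measurable_funM => //; exact: measurable_coord.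
by apply/funext => x; rewrite mxE.
Qed.

Lemma measurable_dotp d' (X : measurableType d') (f g : X -> T) : measurable_fun setT f -> measurable_fun setT g ->
  measurable_fun setT (fun x => dotp (f x) (g x)).
Proof.
move=> mf mg; rewrite /dotp; apply: measurable_sum => i.
by apply: measurable_funM; exact: measurable_coord.
Qed.

Lemma measurable_normv d' (X : measurableType d') (f : X -> T) : measurable_fun setT f ->
  measurable_fun setT (fun x => `|(f x : 'rV[R]_n)|).
Proof.
move=> mf; apply: (measurableT_comp (f := fun x : T => `|(x : 'rV[R]_n)|)) => //.
by apply: continuous_BorelRd; exact: norm_continuous.
Qed.

End leb.

Section dotp.
Variables (R : realType) (n : nat).
Implicit Types x y t : 'rV[R]_n.

Lemma dotpDl x y t : dotp (x + y) t = dotp x t + dotp y t.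
Proof. by rewrite /dotp -big_split/=; apply: eq_bigr => i _; rewrite mxE mulrDl. Qed.
Lemma dotpDr x y t : dotp t (x + y) = dotp t x + dotp t y.
Proof. by rewrite /dotp -big_split/=; apply: eq_bigr => i _; rewrite mxE mulrDr. Qed.
Lemma dotpZl (c : R) x t : dotp (c *: x) t = c * dotp x t.
Proof. by rewrite /dotp mulr_sumr; apply: eq_bigr => i _; rewrite mxE mulrA. Qed.
Lemma dotpZr (c : R) x t : dotp x (c *: t) = c * dotp x t.
Proof. by rewrite /dotp mulr_sumr; apply: eq_bigr => i _; rewrite mxE mulrCA. Qed.
Lemma dotpNl x t : dotp (- x) t = - dotp x t.
Proof. by rewrite -scaleN1r dotpZl mulN1r. Qed.
Lemma dotpNr x t : dotp x (- t) = - dotp x t.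
Proof. by rewrite -scaleN1r dotpZr mulN1r. Qed.
Lemma dotpBl x y t : dotp (x - y) t = dotp x t - dotp y t.
Proof. by rewrite dotpDl dotpNl. Qed.
Lemma dotpBr x y t : dotp t (x - y) = dotp t x - dotp t y.
Proof. by rewrite dotpDr dotpNr. Qed.
Lemma dotp0r t : dotp t 0 = 0.
Proof. by rewrite /dotp big1// => i _; rewrite mxE mulr0. Qed.
Lemma dotpC x t : dotp x t = dotp t x.
Proof. by rewrite /dotp; apply: eq_bigr => i _; rewrite mulrC. Qed.

Lemma dotp_le x t : `|dotp x t| <= n%:R * `|x| * `|t|.
Proof.
rewrite /dotp (le_trans (ler_norm_sum _ _ _))//.
have -> : n%:R * `|x| * `|t| = \sum_(i < n) `|x| * `|t| by rewrite sumr_const card_ord -[RHS]mulr_natl mulrA.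
by apply: ler_sum => i _; rewrite normrM ler_pM ?coord_le_norm.
Qed.
End dotp.

#[global] Opaque CI.

(** * Bounded functions of bounded support *)

Section seqcont.
Variables (R : realType) (n : nat).
Local Notation Rn := 'rV[R]_n.
Local Notation C := R[i].

(** Continuity in sequential form, so that dominated convergence proves continuity of integrals
    depending on a parameter. *)
Lemma seq_continuous (f : Rn -> R) :
  (forall (u : nat -> Rn) x, u @ \oo --> x -> (fun k => f (u k)) @ \oo --> f x) -> continuous f.
Proof.
move=> h x; apply/(@cvgrPdist_lt _ _ _ (nbhs x) (nbhs_filter x) f (f x)) => e e0; apply: contrapT => nx.
have /choice[u uP] : forall k : nat, exists y, ball x k.+1%:R^-1 y /\ ~ (`|f x - f y| < e).
  move=> k; apply: contrapT => nk; apply: nx.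
  apply: (filterS (P := ball x k.+1%:R^-1)) => [y xy|]; last by apply: nbhsx_ballx; rewrite invr_gt0.
  by apply: contrapT => ny; apply: nk; exists y.
have ux : u @ \oo --> x.
  apply/cvgrPdist_lt => d d0; near=> k.
  have := (uP k).1; rewrite mx_norm_ball => /lt_trans; apply.
  by near: k; exact: near_infty_natSinv_lt (PosNum d0).
have /cvgrPdist_lt/(_ _ e0)[k _ kP] := h u x ux.
exact: (uP k).2 (kP k (leqnn k)).
Unshelve. all: by end_near. Qed.

Lemma seq_ccontinuous (f : Rn -> C) :
  (forall (u : nat -> Rn) x, u @ \oo --> x -> ccvg (fun k => f (u k)) (f x)) -> ccontinuous f.
Proof. by move=> h; split; apply: seq_continuous => u x /h/ccvgP[]. Qed.

Lemma ccontinuous_seq (f : Rn -> C) : ccontinuous f ->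
  forall (u : nat -> Rn) x, u @ \oo --> x -> ccvg (fun k => f (u k)) (f x).
Proof.
move=> [f1 f2] u x ux; apply/ccvgP; split; [move: (f1 x)|move: (f2 x)]; exact: cvg_comp.
Qed.

Lemma ccontinuous_cmeas (f : Rn -> C) : ccontinuous f -> cmeas (f : BorelRd R n -> C).
Proof. by move=> [f1 f2]; split; exact: continuous_BorelRd. Qed.

Lemma ccontinuous_cabs (f : Rn -> C) : ccontinuous f -> continuous (fun x => cabs (f x)).
Proof. by move=> cf; apply: seq_continuous => u x ux; apply: ccvg_cabs; exact: ccontinuous_seq. Qed.

Lemma cvg_expi (u : nat -> R) a : u @ \oo --> a -> ccvg (fun k => expi (u k)) (expi a).
Proof.
move=> ua; apply/ccvgP; split => /=.
  exact: (cvg_comp _ _ ua (@continuous_cos R a)).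
exact: (cvg_comp _ _ ua (@continuous_sin R a)).
Qed.

Lemma cvg_dotp (u : nat -> Rn) (x t : Rn) : u @ \oo --> x -> (fun k => dotp (u k) t) @ \oo --> dotp x t.
Proof.
move=> ux; apply: (cvg_dist0 (v := fun k => n%:R * `|u k - x| * `|t|)) => [k|].
  by rewrite -dotpBl dotp_le.
have -> : 0 = n%:R * 0 * `|t| :> R by rewrite mulr0 mul0r.
apply: cvgM; last exact: cvg_cst.
apply: cvgM; first exact: cvg_cst.
by apply/norm_cvg0P; apply/subr_cvg0.
Qed.

Lemma Cc_cube (h : Rn -> C) : ccontinuous h -> (exists r, forall x, r < `|x| -> h x = 0) -> Cc h.
Proof.
move=> ch [r hr]; split => //; exists (cube 0 r); split; first exact: compact_cube.
by move=> x; rewrite /cube/= subr0 => /negP; rewrite -ltNge => /hr.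
Qed.

Lemma CcP (h : Rn -> C) : Cc h -> ccontinuous h /\ exists r, 0 < r /\ forall x, r < `|x| -> h x = 0.
Proof.
move=> [ch [K [cK hK]]]; split => //; have [r [r0 Kr]] := compact_sub_cube cK.
exists r; split => // x rx; apply: hK => Kx; have := Kr _ Kx.
by rewrite /cube/= subr0 leNgt rx.
Qed.

Lemma Cc_bounded (h : Rn -> C) : Cc h -> exists M, 0 < M /\ forall x, cabs (h x) <= M.
Proof.
move=> /CcP[ch [r [r0 hr]]].
have : compact ((fun x => cabs (h x)) @` cube 0 r).
  apply: continuous_compact; last exact: compact_cube.
  by apply: continuous_subspaceT; exact: ccontinuous_cabs.
move=> /compact_bounded[M [_ hM]]; exists (`|M| + 1); split; first by rewrite ltr_wpDl.
move=> x; have [xr|rx] := leP `|x| r; last by rewrite hr// cabs0 addr_ge0.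
apply: le_trans (ler_norm _) _; apply: (hM (`|M| + 1)); first by rewrite ltr_pwDr// ler_norm.
by exists x => //; rewrite /cube/= subr0.
Qed.
End seqcont.

Lemma integrable_indic_lty (R : realType) d (T : measurableType d) (m : {measure set T -> \bar R}) (A : set T) :
  measurable A -> (m A < +oo)%E -> m.-integrable setT (fun x => (\1_A x)%:E).
Proof.
move=> mA Aoo; apply/integrableP; split; first by apply/measurable_EFinP; exact: measurable_indic.
under eq_integral do rewrite abse_EFin ger0_norm//.
by rewrite integral_indic// setIT.
Qed.

Section nice.
Variables (R : realType) (n : nat).
Local Notation Rn := 'rV[R]_n.
Local Notation T := (BorelRd R n).
Local Notation C := R[i].
Local Notation mu := (@leb R n).

Definition locfin (lam : {measure set T -> \bar R}) := forall r, (lam (cube 0 r) < +oo)%E.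

(** Larger than [Cc]: it contains indicators of balls and hence the [en], while convolutions and
    integrals against locally finite measures still converge. *)
Definition nice (f : T -> C) := [/\ cmeas f, exists M, 0 < M /\ forall x, cabs (f x) <= M
  & exists r, 0 < r /\ forall x : Rn, r < `|x| -> f x = 0].

Lemma Cc_nice (h : Rn -> C) : Cc h -> nice h.
Proof.
move=> ch; split; [by apply: ccontinuous_cmeas; case: ch|exact: Cc_bounded|].
by have /CcP[_] := ch.
Qed.

Lemma integrable_cube (lam : {measure set T -> \bar R}) (M r : R) : locfin lam ->
  lam.-integrable setT (fun x : T => (M * \1_(cube 0 r) (x : Rn))%:E).
Proof.
move=> ll; under eq_fun do rewrite EFinM; apply: integrableZl => //.
by apply: integrable_indic_lty; [exact: measurable_cube|exact: ll].
Qed.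

Lemma nice_cintegrable (lam : {measure set T -> \bar R}) f : locfin lam -> nice f -> cintegrable lam f.
Proof.
move=> ll [mf [M [M0 fM]] [r [r0 fr]]].
apply: (cintegrable_le mf (integrable_cube M r ll)) => x; rewrite indicE.
have [/set_mem xr|] := boolP (_ \in _); first by rewrite mulr1.
by move=> /negP xr; rewrite fr ?cabs0 ?mulr0// ltNge; apply/negP => h; apply: xr; rewrite inE /cube/= subr0.
Qed.

Lemma leb_locfin : locfin mu. Proof. exact: leb_cube. Qed.

Lemma nice_leb f : nice f -> cintegrable mu f.
Proof. by apply: nice_cintegrable; exact: leb_locfin. Qed.

Lemma niceM_bdd f g (M : R) : nice f -> cmeas g -> (forall x, cabs (g x) <= M) -> nice (fun x => f x * g x).
Proof.
move=> [mf [Mf [Mf0 fM]] [r [r0 fr]]] mg gM; split; first exact: cmeasM.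
  exists (Mf * (`|M| + 1)); split; first by rewrite mulr_gt0// ltr_wpDl.
  by move=> x; rewrite cabsM ler_pM ?cabs_ge0// (le_trans (gM _))// ler_wpDr// ler_norm.
by exists r; split => // x /fr ->; rewrite mul0r.
Qed.

Lemma nice_conj f : nice f -> nice (fun x => cconj (f x)).
Proof.
move=> [mf [Mf [Mf0 fM]] [r [r0 fr]]]; split; first exact: cmeas_conj.
  by exists Mf; split => // x; rewrite cabs_conj.
by exists r; split => // x /fr ->; rewrite /cconj/= oppr0.
Qed.

Lemma nice_affine f (a : R) (v : Rn) : a != 0 -> nice f -> nice (fun x : T => f (a *: (x : Rn) + v)).
Proof.
move=> a0 [mf [Mf [Mf0 fM]] [r [r0 fr]]]; split.
- by apply: (cmeas_comp mf); exact: measurable_affine.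
- by exists Mf; split.
- exists ((r + `|v|) / `|a|); split; first by rewrite divr_gt0 ?normr_gt0// ltr_wpDr.
  move=> x; rewrite ltr_pdivrMr ?normr_gt0// => h; apply: fr.
  have := ler_normB (a *: x + v) v; rewrite addrK normrZ mulrC; lra.
Qed.

Lemma nice_reflect f (v : Rn) : nice f -> nice (fun x : T => f (v - (x : Rn))).
Proof.
move=> nf; rewrite (_ : (fun _ => _) = fun x : T => f (-1 *: (x : Rn) + v)).
  by apply: nice_affine => //; rewrite oppr_eq0 oner_neq0.
by apply/funext => x; rewrite scaleN1r addrC.
Qed.

Lemma nice_translate f (v : Rn) : nice f -> nice (fun x : T => f ((x : Rn) + v)).
Proof.
move=> nf; rewrite (_ : (fun _ => _) = fun x : T => f (1 *: (x : Rn) + v)).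
  by apply: nice_affine => //; rewrite oner_neq0.
by apply/funext => x; rewrite scale1r.
Qed.

Lemma nice_invol f : nice f -> nice (invol f).
Proof.
move=> nf; have := nice_conj (nice_reflect 0 nf); congr nice; apply/funext => x.
by rewrite /invol sub0r.
Qed.

Lemma cmeas_conv_kernel (f g : T -> C) : cmeas f -> cmeas g ->
  cmeas (fun z : T * T => f z.2 * g ((z.1 : Rn) - (z.2 : Rn))).
Proof.
move=> mf mg; apply: cmeasM; first by apply: (cmeas_comp mf); exact: measurable_snd.
by apply: (cmeas_comp mg); apply: measurable_subrv; [exact: measurable_fst|exact: measurable_snd].
Qed.

Lemma conv_cint (f g : T -> C) x : nice f -> nice g -> cintegrable mu (fun y : T => f y * g ((x : Rn) - (y : Rn))).
Proof.
move=> nf ng; have [mg [M [M0 gM]] _] := nice_reflect x ng.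
apply: (cintegrableM_bdd (M := M)) => //; exact: nice_leb.
Qed.

Lemma convE (f g : T -> C) x : nice f -> nice g -> conv f g x = CI mu (fun y : T => f y * g ((x : Rn) - (y : Rn))).
Proof. by move=> nf ng; rewrite /conv cintE//; exact: conv_cint. Qed.

Lemma conv_comm (f g : T -> C) x : nice f -> nice g -> conv f g x = conv g f x.
Proof.
move=> nf ng; rewrite !convE// -(CI_reflect x (conv_cint x nf ng)).2.
by apply: eq_CI => y; rewrite subKr mulrC.
Qed.

Lemma nice_conv (f g : T -> C) : nice f -> nice g -> nice (conv f g).
Proof.
move=> nf ng; have [mf [Mf [Mf0 fM]] [rf [rf0 fr]]] := nf; have [mg [Mg [Mg0 gM]] [rg [rg0 gr]]] := ng.
have E : (conv f g : T -> C) = fun x : T => CI mu (fun y : T => f y * g ((x : Rn) - (y : Rn))).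
  by apply/funext => x; rewrite convE.
split.
- rewrite E; apply: (measurable_CI2 (f := fun x y : T => f y * g ((x : Rn) - (y : Rn)))).
    exact: cmeas_conv_kernel.
  by move=> x; exact: conv_cint.
- exists (`|\int[mu]_x cabs (f x) * Mg| + 1); split; first by rewrite ltr_wpDl.
  move=> x; rewrite convE//; apply: (@le_trans _ _ (\int[mu]_x (cabs (f x) * Mg))).
    apply: cabs_CI_le.
    + by have [] := conv_cint x nf ng.
    + under eq_fun do rewrite EFinM; apply: integrableZr => //.
      by apply: cintegrable_cabs; exact: nice_leb.
    + by move=> y; rewrite cabsM ler_wpM2l ?cabs_ge0.
  rewrite RintegralZr//; last by apply: cintegrable_cabs; exact: nice_leb.
  by rewrite (le_trans (ler_norm _))// lerDl.
- exists (rf + rg); split; first by rewrite addr_gt0.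
  move=> x xr; rewrite convE// (_ : (fun _ => _) = fun=> rC 0).
    by rewrite CI_rC Rintegral_cst// mul0r.
  apply/funext => y; have [yr|ry] := leP `|(y : Rn)| rf; last by rewrite fr// mul0r.
  rewrite gr ?mulr0//; have := ler_normD (x - (y : Rn)) y; rewrite subrK; lra.
Qed.

Lemma conv_Cc (f g : Rn -> C) : Cc f -> nice g -> Cc (conv f g).
Proof.
move=> cf ng; have nf := Cc_nice cf; have [mg [Mg [Mg0 gM]] _] := ng.
have [M [M0 fM]] := Cc_bounded cf.
apply: Cc_cube; last by have [_ _ [r [_ rP]]] := nice_conv nf ng; exists r.
apply: seq_ccontinuous => u x ux.
(* Commuting the factors lets the parameter fall on the continuous one. *)
have E z : conv f g z = CI mu (fun y : T => g y * f ((z : Rn) - (y : Rn))) by rewrite conv_comm// convE.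
rewrite E; apply: (ccvg_ext (fun k => esym (E (u k)))).
apply: (CI_dct (F := fun k (y : T) => g y * f (u k - (y : Rn))) (g := fun y => cabs (g y) * M)).
- by move=> k; have [] := conv_cint (u k) ng nf.
- move=> y; apply: ccvgM; first exact: ccvg_cst.
  apply: ccontinuous_seq; first by case: cf.
  by apply: cvgB => //; exact: cvg_cst.
- under eq_fun do rewrite EFinM; apply: integrableZr => //.
  by apply: cintegrable_cabs; exact: nice_leb.
- by move=> k y; rewrite cabsM ler_wpM2l ?cabs_ge0.
Qed.

Lemma Cc_mul (h g : Rn -> C) : Cc h -> ccontinuous g -> Cc (fun x => h x * g x).
Proof.
move=> ch cg; have [ch1 [r [r0 hr]]] := CcP ch; apply: Cc_cube.
  by apply: seq_ccontinuous => u x ux; apply: ccvgM; exact: ccontinuous_seq.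
by exists r => x xr; rewrite hr// mul0r.
Qed.

Lemma Cc_affine (h : Rn -> C) (a : R) (v : Rn) : a != 0 -> Cc h -> Cc (fun x => h (a *: x + v)).
Proof.
move=> a0 ch; have [ch1 _] := CcP ch; apply: Cc_cube.
  apply: seq_ccontinuous => u x ux; apply: ccontinuous_seq => //.
  by apply: cvgD; [apply: cvgZr|exact: cvg_cst].
by have [_ _ [r [_ rP]]] := nice_affine v a0 (Cc_nice ch); exists r.
Qed.

Lemma ccontinuous_expi (y : Rn) (s : R) : ccontinuous (fun t : Rn => expi (s * dotp t y)).
Proof.
apply: seq_ccontinuous => u x ux; apply: cvg_expi; apply: cvgM; first exact: cvg_cst.
exact: cvg_dotp.
Qed.
End nice.

(** * Fourier transform and approximate identities *)

Section FT.
Variables (R : realType) (n : nat).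
Local Notation Rn := 'rV[R]_n.
Local Notation T := (BorelRd R n).
Local Notation C := R[i].
Local Notation mu := (@leb R n).
Implicit Types (f g h : T -> C).

Lemma iterated_lty d1 d2 (X : measurableType d1) (Y : measurableType d2)
    (m1 : {sigma_finite_measure set X -> \bar R}) (m2 : {sigma_finite_measure set Y -> \bar R})
    (F : X -> Y -> C) (A : X -> R) : cmeas (fun z : X * Y => F z.1 z.2) ->
  (forall x, \int[m2]_y (cabs (F x y))%:E <= (A x)%:E)%E -> m1.-integrable setT (fun x => (A x)%:E) ->
  (\int[m1]_x \int[m2]_y (cabs (F x y))%:E < +oo)%E.
Proof.
move=> mF FA /integrableP[mA Aoo]; apply: le_lt_trans Aoo.
have mF' : measurable_fun setT (fun z : X * Y => (cabs (F z.1 z.2))%:E) by exact: measurable_cabsE.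
apply: ge0_le_integral => //.
- by move=> x _; apply: integral_ge0 => y _; rewrite lee_fin cabs_ge0.
- apply: (measurable_fun_fubini_tonelli_F (fun z => (cabs (F z.1 z.2))%:E)) => // z.
  by rewrite lee_fin cabs_ge0.
- exact: measurableT_comp.
- by move=> x _; apply: le_trans (FA x) _; rewrite abse_EFin lee_fin ler_norm.
Qed.

Lemma cintegrable_EFin d1 (X : measurableType d1) (m : {measure set X -> \bar R}) (F : X -> C) :
  cintegrable m F -> (\int[m]_x (cabs (F x))%:E)%E = (\int[m]_x cabs (F x))%:E.
Proof. by move=> Fi; rewrite /Rintegral fineK//; apply: integrable_fin_num => //; exact: cintegrable_cabs. Qed.

(** The un-normalised transform with the sign of [checkF]: [checkF h t] is [twopid] times [FT h t],
    and [hatF h t] is [twopid] times [FT h (- t)]. *)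
Definition FT h (t : Rn) : C := CI mu (fun x : T => expi (dotp (x : Rn) t) * h x).

Lemma cmeas_expi_dotp (t : Rn) : cmeas (fun x : T => expi (dotp (x : Rn) t)).
Proof. by apply: cmeas_expi; apply: measurable_dotp => //; exact: measurable_cst. Qed.

Lemma FT_cint h t : cintegrable mu h -> cintegrable mu (fun x : T => expi (dotp (x : Rn) t) * h x).
Proof.
move=> hi; under eq_fun do rewrite mulrC.
by apply: (cintegrableM_bdd (M := 1)) => // [|x]; [exact: cmeas_expi_dotp|rewrite cabs_expi].
Qed.

Lemma checkF_FT h t : cintegrable mu h -> checkF h t = rC (twopid R n) * FT h t.
Proof. by move=> hi; rewrite /checkF cintE//; exact: FT_cint. Qed.

Lemma hatF_FT h t : cintegrable mu h -> hatF h t = rC (twopid R n) * FT h (- t).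
Proof.
move=> hi; rewrite /hatF (_ : (fun x => _) = fun x : T => expi (dotp (x : Rn) (- t)) * h x).
  by rewrite cintE//; exact: FT_cint.
by apply/funext => x; rewrite dotpNr.
Qed.

Lemma twopid_gt0 : 0 < twopid R n.
Proof. by rewrite /twopid exprn_gt0// invr_gt0 mulr_gt0// pi_gt0. Qed.

Lemma FT_le h t : cintegrable mu h -> cabs (FT h t) <= \int[mu]_x cabs (h x).
Proof.
move=> hi; apply: cabs_CI_le; [by have [] := FT_cint t hi|exact: cintegrable_cabs|].
by move=> x; rewrite cabsM cabs_expi mul1r.
Qed.

Lemma FT_continuous h : cintegrable mu h -> ccontinuous (FT h).
Proof.
move=> hi; apply: seq_ccontinuous => u t ut.
apply: (CI_dct (F := fun k (x : T) => expi (dotp (x : Rn) (u k)) * h x) (g := fun x => cabs (h x))).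
- by move=> k; have [] := FT_cint (u k) hi.
- move=> x; apply: ccvgM; last exact: ccvg_cst.
  apply: cvg_expi; rewrite dotpC; under eq_cvg do rewrite dotpC.
  exact: cvg_dotp.
- exact: cintegrable_cabs.
- by move=> k x; rewrite cabsM cabs_expi mul1r.
Qed.

Lemma FT_cmeas h : cintegrable mu h -> cmeas (FT h : T -> C).
Proof. by move=> hi; apply: ccontinuous_cmeas; exact: FT_continuous. Qed.

Lemma cintegrable_translate_EFin g (v : Rn) : cintegrable mu g ->
  (\int[mu]_x (cabs (g ((x : Rn) - v)))%:E)%E = (\int[mu]_x cabs (g x))%:E.
Proof.
move=> gi; rewrite -cintegrable_EFin// -[RHS](ge0_translate (- v) (f := fun x => (cabs (g x))%:E))//.
  by apply: measurable_cabsE; case: gi.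
by move=> x; rewrite lee_fin cabs_ge0.
Qed.

Lemma FT_conv f g t : nice f -> nice g -> FT (conv f g) t = FT f t * FT g t.
Proof.
move=> nf ng; have fi := nice_leb nf; have gi := nice_leb ng.
pose F := fun (y x : T) => expi (dotp (x : Rn) t) * (f y * g ((x : Rn) - (y : Rn))).
have mF : cmeas (fun z : T * T => F z.1 z.2).
  apply: cmeasM; first by apply: (cmeas_comp (cmeas_expi_dotp t)); exact: measurable_snd.
  apply: cmeasM; first by apply: (cmeas_comp (f := f)); [case: fi|exact: measurable_fst].
  apply: (cmeas_comp (f := g)); first by case: gi.
  by apply: measurable_subrv; [exact: measurable_snd|exact: measurable_fst].
have [|_ _ FF] := @CI_fubini _ _ _ _ _ mu mu F mF.
  apply: (iterated_lty (A := fun y => cabs (f y) * \int[mu]_x cabs (g x))) => //.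
    move=> y; rewrite /F; under eq_integral do rewrite cabsM cabs_expi mul1r cabsM EFinM.
    rewrite ge0_integralZl//; last 3 first.
    - apply: measurable_cabsE; apply: (cmeas_comp (f := g)); first by case: gi.
      by apply: measurable_subrv => //; exact: measurable_cst.
    - by move=> x _; rewrite lee_fin cabs_ge0.
    - by rewrite lee_fin cabs_ge0.
    by rewrite cintegrable_translate_EFin.
  under eq_fun do rewrite EFinM; apply: integrableZr => //; exact: cintegrable_cabs.
transitivity (CI mu (fun x => CI mu (F^~ x))).
  rewrite /FT; apply: eq_CI => x; rewrite (convE x nf ng) /F.
  by rewrite (CIZ _ (conv_cint x nf ng)).
rewrite -FF; transitivity (CI mu (fun y : T => FT g t * (expi (dotp (y : Rn) t) * f y))); last first.
  by rewrite (CIZ _ (FT_cint t fi)) mulrC.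
apply: eq_CI => y; rewrite /F /FT.
have E : (fun x : T => expi (dotp (x : Rn) t) * (f y * g ((x : Rn) - (y : Rn)))) =
   (fun x : T => (expi (dotp (y : Rn) t) * f y) * (expi (dotp ((x : Rn) - (y : Rn)) t) * g ((x : Rn) - (y : Rn)))).
  apply/funext => x; have -> : expi (dotp (x : Rn) t) = expi (dotp ((x : Rn) - (y : Rn)) t) * expi (dotp (y : Rn) t).
    by rewrite -expiD dotpBl subrK.
  by ring.
have [h1 h2] := CI_translate (- (y : Rn)) (FT_cint t gi).
by rewrite E (CIZ _ h1) h2 mulrC.
Qed.

Lemma FT_invol h t : nice h -> FT (invol h) t = cconj (FT h t).
Proof.
move=> nh; have hi := nice_leb nh.
rewrite /FT -CI_conj; last exact: FT_cint.
have := (CI_reflect 0 (cintegrable_conj (FT_cint t hi))).2 => <-.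
apply: eq_CI => x; rewrite sub0r cconjM conj_expi dotpNl opprK.
by rewrite /invol.
Qed.

Lemma FT_conv_invol h t : nice h -> FT (conv h (invol h)) t = rC (cabs (FT h t) ^+ 2).
Proof. by move=> nh; rewrite FT_conv ?FT_invol// ?mul_cconj//; exact: nice_invol. Qed.

Lemma FT_modul h (y t : Rn) : FT (fun x : T => expi (dotp (x : Rn) y) * h x) t = FT h (t + y).
Proof. by apply: eq_CI => x; rewrite mulrA -expiD dotpDr. Qed.

Lemma FT_translate h (v t : Rn) : cintegrable mu h ->
  FT (fun x : T => h ((x : Rn) + v)) t = expi (- dotp v t) * FT h t.
Proof.
move=> hi; have [h1 h2] := CI_translate v (FT_cint t hi).
rewrite /FT -h2 -CIZ//; apply: eq_CI => x.
by rewrite mulrA -expiD dotpDl; congr (expi _ * _); ring.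
Qed.

Lemma FT_dilate h (a : R) (t : Rn) : 0 < a -> cintegrable mu h ->
  FT (fun x : T => h (a *: (x : Rn))) t = rC (a ^- n) * FT h (a^-1 *: t).
Proof.
move=> a0 hi; have an0 : a != 0 by rewrite gt_eqF.
have [h1 h2] := CI_affine 0 an0 (FT_cint (a^-1 *: t) hi).
rewrite [in RHS]/FT h2 gtr0_norm// mulrA -rCM mulVf ?expf_neq0// rC1 mul1r /FT.
apply: eq_CI => x.
by rewrite addr0 dotpZl dotpZr mulrA mulfV// mul1r.
Qed.

(** Dominated convergence; continuity of [J] at 0 enters only along the sequences [u / (k + 1)]. *)
Lemma approx_identity (Phi : T -> C) (J : T -> C) (M : R) : cintegrable mu Phi ->
  cmeas J -> (forall x, cabs (J x) <= M) ->
  (forall u : Rn, ccvg (fun k => J (k.+1%:R^-1 *: u)) (J 0)) ->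
  ccvg (fun k => CI mu (fun u : T => Phi u * J (k.+1%:R^-1 *: (u : Rn)))) (CI mu Phi * J 0).
Proof.
move=> Pi mJ JM J0; have -> : CI mu Phi * J 0 = CI mu (fun u => Phi u * J 0).
  by rewrite mulrC -CIZ//; apply: eq_CI => x; rewrite mulrC.
apply: (CI_dct (F := fun k (u : T) => Phi u * J (k.+1%:R^-1 *: (u : Rn))) (g := fun u => cabs (Phi u) * M)).
- move=> k; apply: cmeasM; first by case: Pi.
  by apply: (cmeas_comp mJ); apply: measurable_scalev.
- by move=> u; apply: ccvgM; [exact: ccvg_cst|exact: J0].
- by under eq_fun do rewrite EFinM; apply: integrableZr => //; exact: cintegrable_cabs.
- by move=> k u; rewrite cabsM ler_wpM2l ?cabs_ge0.
Qed.

Lemma cvg_scale0 (u : Rn) : (fun k : nat => k.+1%:R^-1 *: u) @ \oo --> (0 : Rn).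
Proof.
apply/norm_cvg0P; apply: (cvg_dist0 (v := fun k => k.+1%:R^-1 * `|u|)) => [k|].
  by rewrite subr0 normr_id normrZ ger0_norm// invr_ge0.
rewrite -[X in _ --> X](mul0r `|u|); apply: cvgM; last exact: cvg_cst.
exact: (@cvg_harmonic R).
Qed.
End FT.

(** * Poisson kernel *)

Section kernel1.
Variable R : realType.
Local Notation mu := (@lebesgue_measure R).

Lemma even_ge0_integral (f : R -> R) (l : R) : (forall x, 0 <= f x) -> continuous f -> f =1 f \o -%R ->
  (\int[mu]_(x in `[0%R, +oo[) (f x)%:E = l%:E)%E -> (\int[mu]_x (f x)%:E = (2 * l)%:E)%E.
Proof.
move=> f0 cf fe fl; rewrite ge0_symfun_integralT// EFinM; congr (_ * _)%E.
by rewrite -fl set_itvcy.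
Qed.

(** The summand 1 makes the integrand nonnegative, as the fundamental theorem on a half-line
    requires here; [Rintegral_exp_cos] subtracts it again. *)
Lemma poisson_halfline (t : R) :
  (\int[mu]_(x in `[0%R, +oo[) (expR (- x) * (1 + cos (x * t)))%:E = (1 + (1 + t ^+ 2)^-1)%:E)%E.
Proof.
have t1 : 1 + t ^+ 2 != 0 by rewrite gt_eqF// ltr_wpDr// sqr_ge0.
(* An antiderivative of the integrand that vanishes at infinity; [- F 0] is the value claimed. *)
pose F x := - expR (- x) + (1 + t ^+ 2)^-1 * (expR (- x) * (t * sin (x * t) - cos (x * t))).
have dxt (x : R) : is_derive x 1 (fun x : R => x * t) t.
  by apply: is_derive_eq; rewrite scaler0 add0r /GRing.scale/= mulr1.
have dc (x : R) : is_derive x 1 (fun x : R => cos (x * t)) (- sin (x * t) * t).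
  exact: (@is_derive1_comp _ cos (fun x => x * t)).
have ds (x : R) : is_derive x 1 (fun x : R => sin (x * t)) (cos (x * t) * t).
  exact: (@is_derive1_comp _ sin (fun x => x * t)).
have de (x : R) : is_derive x 1 (fun x : R => expR (- x)) (expR (- x) * -1).
  exact: (@is_derive1_comp _ expR -%R).
have dF (x : R) : is_derive x 1 F (expR (- x) * (1 + cos (x * t))).
  by rewrite /F; apply: is_derive_eq; rewrite /GRing.scale/=; field; exact: t1.
have cder (f : R -> R) (df : R -> R) : (forall x : R, is_derive x 1 f (df x)) -> continuous f.
  move=> fd x; apply: differentiable_continuous; apply/derivable1_diffP.
  by have := fd x => -[].
have cf : continuous (fun x => expR (- x) * (1 + cos (x * t))).
  by move=> x; apply: cvgM; [exact: (cder _ _ de)|apply: cvgD; [exact: cvg_cst|exact: (cder _ _ dc)]].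
rewrite (@ge0_continuous_FTC2y _ _ F 0 0).
- rewrite /F oppr0 expR0 mul0r sin0 cos0 sub0e; congr EFin; field; exact: t1.
- by move=> x _; rewrite mulr_ge0 ?expR_ge0//; have := cos_geN1 (x * t); lra.
- exact: continuous_subspaceT.
- have c0 : (1 + (1 + t ^+ 2)^-1 * (`|t| + 1)) * expR (- x) @[x --> +oo] --> (0 : R).
    have -> : 0 = (1 + (1 + t ^+ 2)^-1 * (`|t| + 1)) * 0 :> R by rewrite mulr0.
    by apply: cvgM; [exact: cvg_cst|exact: cvgr_expR].
  apply/norm_cvg0P; apply: (squeeze_cvgr _ (cvg_cst 0) c0).
  apply: nearW => x; rewrite normr_ge0/= /F.
  apply: le_trans (ler_normD _ _) _; rewrite normrN mulrDl mul1r !normrM.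
  rewrite [`|expR _|]ger0_norm ?expR_ge0// [`|(1 + _)^-1|]ger0_norm; last by rewrite invr_ge0 addr_ge0// sqr_ge0.
  rewrite lerD2l -mulrA ler_wpM2l ?invr_ge0 ?addr_ge0 ?sqr_ge0// mulrC ler_wpM2r ?expR_ge0//.
  apply: le_trans (ler_normB _ _) _; rewrite lerD// ?normrM ?ler_piMr ?ler_norml ?sin_geN1 ?sin_le1 ?cos_geN1 ?cos_le1//.
- by move=> x _; have := dF x => -[].
- by apply: cvg_at_right_filter; exact: (cder _ _ dF).
- by move=> x _; rewrite derive1E; have := dF x => -[_ ->].
Qed.

Lemma continuous_expRNnorm : continuous (fun x : R => expR (- `|x|)).
Proof.
move=> x; apply: (continuous_comp (f := fun x : R => - `|x|) (g := expR)); last exact: continuous_expR.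
by apply: cvgN; exact: norm_continuous.
Qed.

Lemma poisson_line (t : R) :
  (\int[mu]_x (expR (- `|x|) * (1 + cos (x * t)))%:E = (2 * (1 + (1 + t ^+ 2)^-1))%:E)%E.
Proof.
apply: even_ge0_integral.
- by move=> x; rewrite mulr_ge0 ?expR_ge0//; have := cos_geN1 (x * t); lra.
- move=> x; apply: cvgM; first exact: continuous_expRNnorm.
  apply: cvgD; first exact: cvg_cst.
  apply: (continuous_comp (f := fun x : R => x * t) (g := cos)); last exact: continuous_cos.
  by apply: cvgM; [exact: cvg_id|exact: cvg_cst].
- by move=> x /=; rewrite normrN mulNr cosN.
- rewrite -poisson_halfline; apply: eq_integral => x; rewrite inE/= in_itv/= andbT => x0.
  by rewrite ger0_norm.
Qed.

Lemma exp_line : (\int[mu]_x (expR (- `|x|))%:E = 2%:E)%E.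
Proof.
have h := poisson_line 0.
have E : (\int[mu]_x (expR (- `|x|) * (1 + cos (x * 0)))%:E = \int[mu]_x (2%:E * (expR (- `|x|))%:E))%E.
  by apply: eq_integral => x _; rewrite mulr0 cos0 -EFinM mulrC.
move: h; rewrite E ge0_integralZl//; last first.
  by apply/measurable_EFinP; apply: continuous_measurable_fun; exact: continuous_expRNnorm.
rewrite expr0n addr0 invr1; case: (X in (_ * X)%E) => [r| |].
- by rewrite -EFinM => -[h]; congr EFin; lra.
- by rewrite mulry gtr0_sg// mul1e.
- by rewrite mulrNy gtr0_sg// mul1e.
Qed.

Definition poisson1 (t : R) := 2 * (1 + t ^+ 2)^-1.

Local Notation RT := (measurableTypeR R).

Lemma integrable_exp_line : mu.-integrable setT (fun x : RT => (expR (- `|x : R|))%:E).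
Proof.
apply/integrableP; split.
  by apply/measurable_EFinP; apply: continuous_measurable_fun; exact: continuous_expRNnorm.
under eq_integral do rewrite abse_EFin ger0_norm ?expR_ge0//.
by rewrite exp_line ltry.
Qed.

Lemma Rintegral_exp_line : \int[mu]_x expR (- `|x|) = 2.
Proof. by rewrite /Rintegral exp_line. Qed.

Lemma integrable_le_exp (f : RT -> R) : measurable_fun setT f -> (forall x : R, `|f x| <= expR (- `|x|)) ->
  mu.-integrable setT (fun x => (f x)%:E).
Proof.
move=> mf fe; apply: (le_integrable measurableT (g := fun x : RT => (expR (- `|x : R|))%:E)) integrable_exp_line.
  exact/measurable_EFinP.
by move=> x _; rewrite !abse_EFin lee_fin [leRHS]ger0_norm ?expR_ge0.
Qed.

Lemma Rintegral_exp_cos (t : R) : mu.-integrable setT (fun x : RT => (expR (- `|x : R|) * cos ((x : R) * t))%:E) /\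
  \int[mu]_x (expR (- `|x|) * cos (x * t)) = poisson1 t.
Proof.
have cc : continuous (fun x : R => expR (- `|x|) * cos (x * t)).
  move=> x; apply: cvgM; first exact: continuous_expRNnorm.
  apply: (continuous_comp (f := fun x : R => x * t) (g := cos)); last exact: continuous_cos.
  by apply: cvgM; [exact: cvg_id|exact: cvg_cst].
have ci : mu.-integrable setT (fun x : RT => (expR (- `|x : R|) * cos ((x : R) * t))%:E).
  apply: integrable_le_exp; first exact: continuous_measurable_fun.
  by move=> x; rewrite normrM ger0_norm ?expR_ge0// ler_piMr ?expR_ge0// ler_norml cos_geN1 cos_le1.
split => //.
have : \int[mu]_x (expR (- `|x|) * (1 + cos (x * t))) = 2 * (1 + (1 + t ^+ 2)^-1).
  by rewrite /Rintegral poisson_line.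
under eq_Rintegral do rewrite mulrDr mulr1.
rewrite RintegralD//; last exact: integrable_exp_line.
by rewrite Rintegral_exp_line /poisson1; lra.
Qed.

(** The substitution [x -> - x] shows that the integral is its own negative. It is carried out on
    [1 + sin], because [lebesgue_affine] is stated for nonnegative functions. *)
Lemma Rintegral_exp_sin (t : R) : mu.-integrable setT (fun x : RT => (expR (- `|x : R|) * sin ((x : R) * t))%:E) /\
  \int[mu]_x (expR (- `|x|) * sin (x * t)) = 0.
Proof.
have cs (s : R) : continuous (fun x : R => expR (- `|x|) * sin (x * s)).
  move=> x; apply: cvgM; first exact: continuous_expRNnorm.
  apply: (continuous_comp (f := fun x : R => x * s) (g := sin)); last exact: continuous_sin.
  by apply: cvgM; [exact: cvg_id|exact: cvg_cst].
have si (s : R) : mu.-integrable setT (fun x : RT => (expR (- `|x : R|) * sin ((x : R) * s))%:E).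
  apply: integrable_le_exp; first exact: continuous_measurable_fun.
  by move=> x; rewrite normrM ger0_norm ?expR_ge0// ler_piMr ?expR_ge0// ler_norml sin_geN1 sin_le1.
split => //.
have h (s : R) : (\int[mu]_x (expR (- `|x|) * (1 + sin (x * s)))%:E)%E =
   (2 + \int[mu]_x (expR (- `|x|) * sin (x * s)))%:E.
  rewrite -Rintegral_exp_line -(RintegralD measurableT integrable_exp_line (si s)).
  rewrite /Rintegral fineK; first by apply: eq_integral => x _; rewrite mulrDr mulr1.
  apply: integrable_fin_num => //; under eq_fun do rewrite EFinD.
  by apply: integrableD => //; exact: integrable_exp_line.
have : (\int[mu]_x (expR (- `|x|) * (1 + sin (x * t)))%:E = \int[mu]_x (expR (- `|x|) * (1 + sin (x * - t)))%:E)%E.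
  rewrite (lebesgue_affine (a := -1) 0 (f := fun x => (expR (- `|x|) * (1 + sin (x * t)))%:E)).
  - rewrite normrN normr1 mul1e; apply: eq_integral => x _.
    by rewrite addr0 mulN1r normrN mulNr mulrN.
  - by rewrite oppr_eq0 oner_neq0.
  - apply/measurable_EFinP; under eq_fun do rewrite mulrDr mulr1.
    by apply: measurable_funD; apply: continuous_measurable_fun => //; exact: continuous_expRNnorm.
  - by move=> x; rewrite lee_fin mulr_ge0 ?expR_ge0//; have := sin_geN1 (x * t); lra.
rewrite !h => -[].
have -> : \int[mu]_x (expR (- `|x|) * sin (x * - t)) = - \int[mu]_x (expR (- `|x|) * sin (x * t)).
  by rewrite -[RHS]mulN1r -(RintegralZl _ measurableT (si t)); apply: eq_Rintegral => x _; rewrite mulrN sinN; ring.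
by clear; set I := \int[mu]_x _; lra.
Qed.

Lemma poisson1_gt0 t : 0 < poisson1 t.
Proof. by rewrite mulr_gt0// invr_gt0 ltr_wpDr// sqr_ge0. Qed.

Lemma continuous_poisson1 : continuous poisson1.
Proof. by move=> t; apply: cvgM; [exact: cvg_cst|exact: continuous_oneDsqrV]. Qed.

Lemma poisson1_integral : (\int[mu]_t (poisson1 t)%:E = (2 * pi)%:E)%E.
Proof.
apply: even_ge0_integral.
- by move=> t; rewrite ltW// poisson1_gt0.
- exact: continuous_poisson1.
- by move=> t; rewrite /poisson1/= sqrrN.
- under eq_integral do rewrite EFinM.
  rewrite ge0_integralZl//.
  + by rewrite [X in (_ * X)%E](@integral0y_oneDsqr R) -EFinM; congr EFin; field.
  + by apply/measurable_EFinP; apply: measurable_funTS; apply: continuous_measurable_fun; exact: continuous_oneDsqrV.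
  + by move=> x _; rewrite lee_fin invr_ge0 addr_ge0// sqr_ge0.
Qed.

Lemma integrable_poisson1 : mu.-integrable setT (fun t : RT => (poisson1 t)%:E).
Proof.
apply/integrableP; split.
  by apply/measurable_EFinP; apply: continuous_measurable_fun; exact: continuous_poisson1.
under eq_integral do rewrite abse_EFin ger0_norm ?(ltW (poisson1_gt0 _))//.
by rewrite poisson1_integral ltry.
Qed.
End kernel1.

(** * Product kernels in dimension n *)

Section kernel.
Variable R : realType.
Local Notation C := R[i].
Local Notation RT := (measurableTypeR R).
Local Notation mu1 := (@lebesgue_measure R).

Definition hd n (v : 'rV[R]_n.+1) : R := v ord0 (lshift n (ord0 : 'I_1)).
Definition tl n (v : 'rV[R]_n.+1) : 'rV[R]_n := \row_i v ord0 (rshift 1 i).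

Lemma hd_rcons n z : hd (@rcons_mx R n z) = z.1. Proof. by rewrite /hd rcons_mxl. Qed.
Lemma tl_rcons n z : tl (@rcons_mx R n z) = z.2.
Proof. by apply/rowP => i; rewrite mxE rcons_mxr. Qed.

Lemma measurable_hd n : measurable_fun setT (@hd n : BorelRd R n.+1 -> R).
Proof. by apply: (measurable_coord (f := fun v : BorelRd R n.+1 => v)). Qed.

Lemma measurable_tl n : measurable_fun setT (@tl n : BorelRd R n.+1 -> BorelRd R n).
Proof.
apply: measurable_rV => i; rewrite /tl; under eq_fun do rewrite mxE.
by apply: (measurable_coord (f := fun v : BorelRd R n.+1 => v)).
Qed.

Lemma dotp_rcons n (v w : 'rV[R]_n.+1) : dotp v w = hd v * hd w + dotp (tl v) (tl w).
Proof.
rewrite /dotp (@big_split_ord _ _ _ 1 n xpredT (fun i => v ord0 i * w ord0 i))/= big_ord1.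
by congr (_ + _); apply: eq_bigr => i _; rewrite !mxE.
Qed.

(** [leb] is chosen separately in each dimension, so its product structure is recovered by testing
    [iint] on indicators. *)
Lemma leb_recE n (A : set (BorelRd R n.+1)) : measurable A ->
  leb R n.+1 A = pushforward_measure (mu1 \x leb R n)%E (@measurable_rcons_mx R n) A.
Proof.
move=> mA; rewrite -(setIT A) -!integral_indic//.
have mi : measurable_fun setT (fun x => (\1_A x)%:E : \bar R).
  by apply/measurable_EFinP; exact: measurable_indic.
rewrite leb_iint//.
rewrite ge0_integral_pushforward//; last exact: measurable_rcons_mx.
rewrite preimage_setT fubini_tonelli1; last 2 first.
- by apply: (measurableT_comp (f := fun x => (\1_A x)%:E)) => //; exact: measurable_rcons_mx.
- by move=> z /=; rewrite lee_fin.
apply: eq_integral => x _; rewrite /fubini_F/= leb_iint//.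
by apply: (measurableT_comp (f := fun x => (\1_A x)%:E)) => //; exact: measurable_rcons_mx1.
Qed.

Lemma leb_prodR n (f : RT -> R) (g : BorelRd R n -> R) :
  mu1.-integrable setT (fun x => (f x)%:E) -> (leb R n).-integrable setT (fun x => (g x)%:E) ->
  (leb R n.+1).-integrable setT (fun v => (f (hd v) * g (tl v))%:E) /\
  \int[leb R n.+1]_v (f (hd v) * g (tl v)) = \int[mu1]_x f x * \int[leb R n]_y g y.
Proof.
move=> fi gi; have /integrableP[mf foo] := fi; have /integrableP[mg goo] := gi.
have mfg : measurable_fun setT (fun v : BorelRd R n.+1 => (f (hd v) * g (tl v))%:E).
  apply/measurable_EFinP; apply: measurable_funM.
    apply: (measurableT_comp (f := f)); first exact/measurable_EFinP.
    exact: measurable_hd.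
  apply: (measurableT_comp (f := g)); first exact/measurable_EFinP.
  exact: measurable_tl.
have mfg2 : measurable_fun setT (fun z : RT * BorelRd R n => f z.1 * g z.2).
  apply: measurable_funM.
    by apply: (measurableT_comp (f := f)); [exact/measurable_EFinP|exact: measurable_fst].
  by apply: (measurableT_comp (f := g)); [exact/measurable_EFinP|exact: measurable_snd].
have gf : (\int[leb R n]_y `|g y|%:E = (\int[leb R n]_y `|g y|)%:E)%E.
  rewrite /Rintegral fineK//; apply: integrable_fin_num => //.
  exact: (integrable_norm gi).
have inner x : (\int[leb R n]_y `|f x * g y|%:E = (`|f x| * \int[leb R n]_y `|g y|)%:E)%E.
  under eq_integral do rewrite normrM EFinM.
  rewrite ge0_integralZl//; first by rewrite gf.
  by apply/measurable_EFinP; apply: measurableT_comp => //; exact/measurable_EFinP.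
have foo2 : (\int[mu1]_x \int[leb R n]_y `|f x * g y|%:E < +oo)%E.
  under eq_integral do rewrite inner EFinM.
  have := integrable_norm fi => /(integrableZr measurableT (\int[leb R n]_y `|g y|))/integrableP[_].
  apply: le_lt_trans; apply: ge0_le_integral => //.
  - by move=> x _; rewrite mule_ge0// lee_fin; apply: Rintegral_ge0.
  - apply/measurable_EFinP; apply: measurable_funM; last exact: measurable_cst.
    by apply: measurableT_comp => //; exact/measurable_EFinP.
  - apply/measurable_EFinP; apply: measurableT_comp => //; apply: measurable_funM; last exact: measurable_cst.
    by apply: measurableT_comp => //; exact/measurable_EFinP.
  - by move=> x _; rewrite -EFinM lee_fin ler_norm.
have fgi : (mu1 \x leb R n)%E.-integrable setT (fun z => (f z.1 * g z.2)%:E).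
  by apply/integrable12ltyP => //; exact/measurable_EFinP.
have fgi2 : (mu1 \x leb R n)%E.-integrable (@rcons_mx R n @^-1` setT)
    ((fun v : BorelRd R n.+1 => (f (hd v) * g (tl v))%:E) \o @rcons_mx R n).
  rewrite preimage_setT (_ : _ \o _ = fun z => (f z.1 * g z.2)%:E)//.
  by apply/funext => z /=; rewrite hd_rcons tl_rcons.
split.
  apply/integrableP; split => //.
  rewrite (eq_measure_integral (pushforward_measure (mu1 \x leb R n)%E (@measurable_rcons_mx R n))); last first.
    by move=> A mA _; exact: leb_recE.
  rewrite ge0_integral_pushforward//; last by apply: measurableT_comp mfg.
  have /integrableP[_] := fgi2; rewrite preimage_setT.
    by congr (_ < _)%E.
  exact: measurable_rcons_mx.
rewrite /Rintegral (eq_measure_integral (pushforward_measure (mu1 \x leb R n)%E (@measurable_rcons_mx R n))); last first.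
  by move=> A mA _; exact: leb_recE.
have IP : (\int[pushforward_measure (mu1 \x leb R n) (measurable_rcons_mx (n:=n))]_x (f (hd x) * g (tl x))%:E =
    \int[mu1 \x leb R n]_(x in (@rcons_mx R n) @^-1` setT) ((fun v : BorelRd R n.+1 => (f (hd v) * g (tl v))%:E) \o @rcons_mx R n) x)%E.
  by apply: integral_pushforward => //; exact: measurable_rcons_mx.
rewrite IP preimage_setT.
rewrite -/(Rintegral _ _ _) -/(Rintegral _ _ _).
transitivity (fine (\int[mu1]_x (f x * \int[leb R n]_y g y)%:E)); last first.
  by rewrite -/(Rintegral _ _ _) RintegralZr.
congr fine; transitivity (\int[(mu1 \x leb R n)%E]_z (f z.1 * g z.2)%:E)%E.
  by apply: eq_integral => z _ /=; rewrite hd_rcons tl_rcons.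
rewrite -integral12_prod_meas1//; apply: eq_integral => x _; rewrite /fubini_F/=.
under eq_integral do rewrite EFinM.
rewrite integralZl// EFinM /Rintegral fineK//; exact: integrable_fin_num.
Qed.

(* Abel summation kernels: in dimension one [E x = exp (- |x|)], with the Poisson
   kernel as its transform [Phi]; the point is that [Phi] is nonnegative and integrable. *)
Definition kernel_pair n (E Phi : BorelRd R n -> R) :=
  [/\ forall x, 0 <= E x, forall x, E x <= 1, (leb R n).-integrable setT (fun x => (E x)%:E) &
     forall u : 'rV[R]_n, (fun k : nat => E (k.+1%:R^-1 *: u)) @ \oo --> (1 : R)] /\
  [/\ forall x, 0 <= Phi x, (leb R n).-integrable setT (fun x => (Phi x)%:E), 0 < \int[leb R n]_x Phi x &
     forall t, FT (fun x => rC (E x)) t = rC (Phi t)].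

(** Products of one-dimensional pairs, starting from the constant 1 in dimension 0. Splitting the
    character of head and tail into real and imaginary parts leaves four products of integrals;
    those with a sine or with the imaginary part of the tail vanish. *)
Lemma ex_kernel_pair n : exists E Phi, @kernel_pair n E Phi.
Proof.
elim: n => [|n [E [Phi [[E0 E1 Ei El] [Phi0 Phii Phip EPhi]]]]].
  have c0 (c : R) : (leb R 0).-integrable setT (fun=> c%:E).
    apply/integrableP; split; first exact: measurable_cst.
    by rewrite leb_iint//= ltry.
  have i0 (f : BorelRd R 0 -> R) : measurable_fun setT f -> (forall x, 0 <= f x) -> \int[leb R 0]_x f x = f 0.
    by move=> mf f0; rewrite /Rintegral leb_iint//; exact/measurable_EFinP.
  exists (fun=> 1), (fun=> 1); split; split => //.
  - by move=> u; exact: cvg_cst.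
  - by rewrite i0.
  - move=> t; rewrite /FT rC1 (_ : (fun x => _) = fun=> rC 1); first by rewrite CI_rC i0.
    by apply/funext => x; rewrite /dotp big_ord0 expi0 mulr1.
exists (fun v => expR (- `|hd v|) * E (tl v)), (fun v => poisson1 (hd v) * Phi (tl v)); split; split.
- by move=> v; rewrite mulr_ge0 ?expR_ge0.
- by move=> v; rewrite mulr_ile1 ?expR_ge0// -expR0 ler_expR oppr_le0.
- by have [] := leb_prodR (@integrable_exp_line R) Ei.
- move=> u; rewrite -[X in _ --> X](mulr1 (1 : R)); apply: cvgM; last first.
    rewrite (_ : (fun k : nat => _) = fun k : nat => E (k.+1%:R^-1 *: tl u)); first exact: El.
    by apply/funext => k; congr E; apply/rowP => i; rewrite !mxE.
  have h : (fun k : nat => - `|hd (k.+1%:R^-1 *: u)|) @ \oo --> (0 : R).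
    rewrite -oppr0; apply: cvgN; apply/norm_cvg0P.
    rewrite (_ : (fun k : nat => _) = fun k : nat => k.+1%:R^-1 * hd u); last by apply/funext => k; rewrite /hd mxE.
    rewrite -(mul0r (hd u)).
    by apply: cvgM; [exact: (@cvg_harmonic R)|exact: cvg_cst].
  by rewrite -[X in _ --> X](@expR0 R); exact: (cvg_comp _ _ h (@continuous_expR R 0)).
- by move=> v; rewrite mulr_ge0// ltW// poisson1_gt0.
- by have [] := leb_prodR (@integrable_poisson1 R) Phii.
- have [_ ->] := leb_prodR (@integrable_poisson1 R) Phii.
  by rewrite mulr_gt0// /Rintegral poisson1_integral//= mulr_gt0// pi_gt0.
- move=> t.
  have [c1 c2] := Rintegral_exp_cos (hd t); have [s1 s2] := Rintegral_exp_sin (hd t).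
  have bi : cintegrable (leb R n) (fun x : BorelRd R n => expi (dotp (x : 'rV[R]_n) (tl t)) * rC (E x)).
    by apply: FT_cint; exact: cintegrable_rC.
  have eE := EPhi (tl t).
  have bE1 : \int[leb R n]_y cre (expi (dotp (y : 'rV[R]_n) (tl t)) * rC (E y)) = Phi (tl t).
    by rewrite -cre_CI -/(FT _ _) eE.
  have bE2 : \int[leb R n]_y cim (expi (dotp (y : 'rV[R]_n) (tl t)) * rC (E y)) = 0.
    by rewrite -cim_CI -/(FT _ _) eE.
  (* The four products: cosine or sine in the head, real or imaginary part in the tail. *)
  have /cintegrableP[e1 e2] := bi.
  have [p1 q1] := leb_prodR c1 e1; have [p2 q2] := leb_prodR s1 e2.
  have [p3 q3] := leb_prodR c1 e2; have [p4 q4] := leb_prodR s1 e1.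
  apply: cplx_eq; rewrite /FT ?cre_CI ?cim_CI.
    rewrite (@eq_Rintegral _ _ _ _ _ (fun v : BorelRd R n.+1 => expR (- `|hd v|) * cos (hd v * hd t) * cre (expi (dotp (tl v) (tl t)) * rC (E (tl v)))
      - expR (- `|hd v|) * sin (hd v * hd t) * cim (expi (dotp (tl v) (tl t)) * rC (E (tl v))))); last first.
      by move=> v _; rewrite dotp_rcons expiD !(creM, cimM) /cre /cim/=; ring.
    by rewrite RintegralB// q1 q2 c2 s2 bE1 mul0r subr0.
  rewrite (@eq_Rintegral _ _ _ _ _ (fun v : BorelRd R n.+1 => expR (- `|hd v|) * cos (hd v * hd t) * cim (expi (dotp (tl v) (tl t)) * rC (E (tl v)))
      + expR (- `|hd v|) * sin (hd v * hd t) * cre (expi (dotp (tl v) (tl t)) * rC (E (tl v))))); last first.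
    by move=> v _; rewrite dotp_rcons expiD !(creM, cimM) /cre /cim/=; ring.
  by rewrite RintegralD// q3 q4 c2 s2 bE2 mul0r mulr0 addr0.
Qed.
End kernel.

(** * Inversion for autocorrelations *)

Section inversion.
Variables (R : realType) (n : nat).
Local Notation Rn := 'rV[R]_n.
Local Notation T := (BorelRd R n).
Local Notation C := R[i].
Local Notation mu := (@leb R n).

Lemma fatou_le d (X : measurableType d) (m : {measure set X -> \bar R}) (f : nat -> X -> R) (g : X -> R) (B : \bar R) :
  (forall k, measurable_fun setT (f k)) -> (forall k x, 0 <= f k x) ->
  (forall x, f ^~ x @ \oo --> g x) -> (forall k, \int[m]_x (f k x)%:E <= B)%E ->
  (\int[m]_x (g x)%:E <= B)%E.
Proof.
move=> mf f0 fg fB.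
have gE x : limn_einf (fun k => (f k x)%:E) = (g x)%:E.
  have h : (fun k => (f k x)%:E) @ \oo --> (g x)%:E by apply: cvg_EFin; [exact: nearW|exact: fg].
  exact: (cvg_limn_einf_sup h).1.
under eq_integral do rewrite -gE.
have : (\int[m]_x limn_einf (fun k => (f k x)%:E) <= limn_einf (fun k => \int[m]_x (f k x)%:E))%E.
  apply: (@fatou _ _ _ m setT measurableT (fun k x => (f k x)%:E)); first by move=> k; exact/measurable_EFinP.
  by move=> k x _; rewrite lee_fin.
move=> /le_trans; apply; rewrite limn_einf_lim; apply: lime_le; first exact: is_cvg_einfs.
apply: nearW => k; apply: le_trans (fB k).
by apply: ereal_inf_lbound; exists k => /=.
Qed.

Lemma ge0_integralZl_EFin d (X : measurableType d) (m : {measure set X -> \bar R}) (c : R) (f : X -> R) :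
  measurable_fun setT f -> (forall x, 0 <= f x) -> 0 <= c ->
  (\int[m]_x (c * f x)%:E = c%:E * \int[m]_x (f x)%:E)%E.
Proof.
move=> mf f0 c0; under eq_integral do rewrite EFinM.
by apply: ge0_integralZl => //; [exact/measurable_EFinP|move=> x _; rewrite lee_fin].
Qed.

Lemma mul_inv_swap (K : comPzRingType) (a b c q : K) : a * b = 1 -> a * (q * (b * c)) = c * q.
Proof. by move=> ab; rewrite mulrCA (mulrA a) ab mul1r mulrC. Qed.

(** Inversion with the damping factor [E (x / (k + 1))]. Since [|FT h|^2] is the transform of the
    autocorrelation, Fubini turns the damping into the dilated kernel [Phi], and the substitution
    [z = e u + t] removes the dilation from [Phi]. *)
Lemma abel_mean (E Phi : T -> R) (h : Rn -> C) (t : Rn) (k : nat) : kernel_pair E Phi -> Cc h ->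
  CI mu (fun x : T => rC (E (k.+1%:R^-1 *: (x : Rn))) * (expi (- dotp (x : Rn) t) * rC (cabs (FT h x) ^+ 2))) =
  CI mu (fun u : T => rC (Phi u) * conv h (invol h) (k.+1%:R^-1 *: (u : Rn) + t)).
Proof.
move=> [[E0 E1 Ei El] [Phi0 Phii Phip EPhi]] ch; set e : R := k.+1%:R^-1.
have e0 : e != 0 by rewrite invr_eq0.
have ep : 0 < e by rewrite invr_gt0.
clearbody e.
set Q : T -> C := conv h (invol h).
have nh := Cc_nice ch; have nQ : nice Q by apply: nice_conv => //; exact: nice_invol.
have Qi := nice_leb nQ.
have rEi : cintegrable mu (fun x : T => rC (E x)) by exact: cintegrable_rC.
have [Eei _] := CI_affine 0 e0 rEi.
have rPi : cintegrable mu (fun x : T => rC (Phi x)) by exact: cintegrable_rC.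
pose F := fun x z : T => rC (E (e *: (x : Rn))) * (expi (dotp (x : Rn) ((z : Rn) - t)) * Q z).
have mE : measurable_fun setT (fun x : T => E (e *: (x : Rn))).
  apply: (measurableT_comp (f := E)); first by apply/measurable_EFinP; case/integrableP : Ei.
  by apply: measurable_scalev; exact: measurable_id.
have mF : cmeas (fun z : T * T => F z.1 z.2).
  apply: cmeasM.
    by apply: (cmeas_comp (f := fun x : T => rC (E (e *: (x : Rn))))); [exact: cmeas_rC|exact: measurable_fst].
  apply: cmeasM.
    apply: cmeas_expi; apply: measurable_dotp; first exact: measurable_fst.
    by apply: measurable_subrv; [exact: measurable_snd|exact: measurable_cst].
  by apply: (cmeas_comp (f := Q)); [case: Qi|exact: measurable_snd].
have Eabs : mu.-integrable setT (fun x : T => (E (e *: (x : Rn)))%:E).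
  have := cintegrable_cabs Eei; congr (_.-integrable _ _); apply/funext => x.
  by rewrite addr0 cabs_rC ger0_norm.
have [|_ _ FF] := @CI_fubini _ _ _ _ _ mu mu F mF.
  apply: (@iterated_lty _ _ _ _ _ mu mu F (fun x : T => E (e *: (x : Rn)) * \int[mu]_z cabs (Q z)) mF).
    move=> x; rewrite /F; under eq_integral do rewrite cabsM cabsM cabs_expi mul1r cabs_rC ger0_norm//.
    rewrite ge0_integralZl_EFin//; first by rewrite cintegrable_EFin.
      by apply: measurable_cabs; case: Qi.
    by move=> z; exact: cabs_ge0.
  by under eq_fun do rewrite EFinM; exact: integrableZr.
transitivity (CI mu (fun x : T => CI mu (F x))).
  apply: eq_CI => x; rewrite -(FT_conv_invol x nh) -/Q /FT /F.
  rewrite -(CIZ _ (FT_cint _ Qi)) -(CIZ _ (cintegrableZ _ (FT_cint _ Qi))).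
  by apply: eq_CI => z; rewrite [in RHS]addrC dotpDr dotpNr expiD (dotpC z) -!mulrA.
rewrite FF.
have inner z : CI mu (F^~ z) = Q z * rC (e ^- n * Phi (e^-1 *: ((z : Rn) - t))).
  have -> : CI mu (F^~ z) = CI mu (fun x : T => Q z * (expi (dotp (x : Rn) ((z : Rn) - t)) * rC (E (e *: (x : Rn))))).
    by apply: eq_CI => x; rewrite /F; ring.
  have Eei' : cintegrable mu (fun x : T => rC (E (e *: (x : Rn)))) by exact: cintegrable_rC.
  rewrite (CIZ _ (FT_cint _ Eei')); congr (_ * _).
  by rewrite -/(FT _ _) (FT_dilate _ ep rEi) EPhi rCM.
have Qbi : cintegrable mu (fun z : T => Q z * rC (e ^- n * Phi (e^-1 *: ((z : Rn) - t)))).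
  have [_ [M [_ QM]] _] := nQ.
  have e'0 : e^-1 != 0 by rewrite invr_eq0.
  have [h1 _] := CI_affine (- (e^-1 *: t)) e'0 rPi.
  have h2 := cintegrableZ (rC (e ^- n)) h1.
  have mQ := Qi.1; have := cintegrableM_bdd h2 mQ QM; congr cintegrable.
  by apply/funext => z; rewrite mulrC -rCM scalerBr.
have -> : CI mu (fun z : T => CI mu (F^~ z)) = CI mu (fun z : T => Q z * rC (e ^- n * Phi (e^-1 *: ((z : Rn) - t)))).
  exact: eq_CI.
have [h1 ->] := CI_affine t e0 Qbi.
rewrite -(CIZ _ h1); apply: eq_CI => u.
have en0 : rC (e ^+ n) * rC (e ^- n) = 1 :> C by rewrite -rCM mulfV ?rC1 ?expf_neq0.
have eu : e^-1 *: (e *: (u : Rn) + t - t) = u by rewrite addrK scalerA (mulVf e0) scale1r.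
by rewrite eu (gtr0_norm ep) rCM; exact: mul_inv_swap.
Qed.

(** The Abel means at [t = 0] are bounded and nonnegative, so Fatou makes [|FT h|^2] integrable; it
    then dominates the means at every [t]. The constant is the mass of [Phi]. *)
Lemma inversion : exists c0 : R, 0 < c0 /\ forall h : Rn -> C, Cc h ->
  mu.-integrable setT (fun x : T => (cabs (FT h x) ^+ 2)%:E) /\
  forall t, CI mu (fun x : T => expi (- dotp (x : Rn) t) * rC (cabs (FT h x) ^+ 2)) =
    rC c0 * conv h (invol h) t.
Proof.
have [E [Phi EP]] := @ex_kernel_pair R n.
have := EP => -[[E0 E1 Ei El] [Phi0 Phii Phip EPhi]].
exists (\int[mu]_x Phi x); split => // h ch.
have nh := Cc_nice ch; have nQ : nice (conv h (invol h)) by apply: nice_conv => //; exact: nice_invol.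
have CQ : Cc (conv h (invol h)) by apply: conv_Cc => //; exact: nice_invol.
have [mQ [M [M0 QM]] _] := nQ.
have rPi : cintegrable mu (fun x : T => rC (Phi x)) by exact: cintegrable_rC.
have lim t : ccvg (fun k => CI mu (fun x : T => rC (E (k.+1%:R^-1 *: (x : Rn))) * (expi (- dotp (x : Rn) t) * rC (cabs (FT h x) ^+ 2))))
    (rC (\int[mu]_x Phi x) * conv h (invol h) t).
  apply: (ccvg_ext (fun k => esym (abel_mean t k EP ch))).
  have := approx_identity (Phi := fun x => rC (Phi x)) (J := fun x : T => conv h (invol h) ((x : Rn) + t)) (M := M) rPi.
  rewrite CI_rC add0r; apply.
  - by have [] := nice_translate t nQ.
  - by move=> x; exact: QM.
  - move=> u; apply: ccontinuous_seq; first by case: CQ.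
    rewrite -[X in _ --> X](add0r t); apply: cvgD; last exact: cvg_cst.
    exact: cvg_scale0.
have mE k : measurable_fun setT (fun x : T => E (k.+1%:R^-1 *: (x : Rn))).
  apply: (measurableT_comp (f := E)); first by apply/measurable_EFinP; case/integrableP : Ei.
  by apply: measurable_scalev; exact: measurable_id.
have hi := nice_leb nh.
have mF2 : measurable_fun setT (fun x : T => cabs (FT h x) ^+ 2).
  by apply: measurable_funX; apply: measurable_cabs; exact: FT_cmeas.
have [Mh FM] : exists M : R, forall x, cabs (FT h x) ^+ 2 <= M.
  exists ((\int[mu]_x cabs (h x)) ^+ 2) => x; rewrite ler_pXn2r ?nnegrE ?cabs_ge0 ?FT_le//.
  by apply: Rintegral_ge0 => y _; exact: cabs_ge0.
(* At [t = 0] the character is 1 and the right side of [abel_mean] is at most the supremum of the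
   autocorrelation times the mass of [Phi], uniformly in [k]. *)
have bnd k : (\int[mu]_x (E (k.+1%:R^-1 *: (x : Rn)) * cabs (FT h x) ^+ 2)%:E <= (M * \int[mu]_x Phi x)%:E)%E.
  have e0 : (k.+1%:R^-1 : R) != 0 by rewrite invr_eq0.
  have rEi : cintegrable mu (fun x : T => rC (E x)) by exact: cintegrable_rC.
  have [Eei _] := CI_affine 0 e0 rEi.
  have := cintegrableM_bdd (M := Mh) Eei (cmeas_rC mF2) => /(_ _)/cintegrableP[] => [x|].
    by rewrite cabs_rC ger0_norm ?sqr_ge0.
  move=> I1 _.
  have I1' : mu.-integrable setT (fun x : T => (E (k.+1%:R^-1 *: (x : Rn)) * cabs (FT h x) ^+ 2)%:E).
    move: I1; congr (_.-integrable _ _); apply/funext => x.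
    by rewrite addr0 -rCM.
  have am := abel_mean 0 k EP ch.
  rewrite (_ : CI mu _ = rC (\int[mu]_x (E (k.+1%:R^-1 *: (x : Rn)) * cabs (FT h x) ^+ 2))) in am; last first.
    by rewrite -CI_rC; apply: eq_CI => x; rewrite dotp0r oppr0 expi0 mul1r rCM.
  have -> : (\int[mu]_x (E (k.+1%:R^-1 *: (x : Rn)) * cabs (FT h x) ^+ 2)%:E =
     (\int[mu]_x (E (k.+1%:R^-1 *: (x : Rn)) * cabs (FT h x) ^+ 2))%:E)%E.
    by rewrite /Rintegral fineK//; exact: integrable_fin_num.
  rewrite lee_fin; apply: le_trans (ler_norm _) _; rewrite -cabs_rC am.
  rewrite -RintegralZl//; apply: cabs_CI_le.
  - apply: cmeasM; first by case: rPi.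
    by apply: (cmeas_comp mQ); exact: measurable_affine.
  - by under eq_fun do rewrite EFinM; exact: integrableZl.
  - by move=> x; rewrite cabsM cabs_rC ger0_norm// mulrC ler_wpM2r.
have F2i : mu.-integrable setT (fun x : T => (cabs (FT h x) ^+ 2)%:E).
  apply/integrableP; split; first exact/measurable_EFinP.
  under eq_integral do rewrite abse_EFin ger0_norm ?sqr_ge0//.
  apply: (@le_lt_trans _ _ (M * \int[mu]_x Phi x)%:E); last exact: ltry.
  apply: (fatou_le (f := fun k (x : T) => E (k.+1%:R^-1 *: (x : Rn)) * cabs (FT h x) ^+ 2)) bnd.
  - by move=> k; apply: measurable_funM.
  - by move=> k x; rewrite mulr_ge0// sqr_ge0.
  - move=> x; rewrite -[X in _ --> X](mul1r (cabs (FT h x) ^+ 2)).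
    by apply: cvgM; [exact: El|exact: cvg_cst].
split => // t; apply: (@ccvg_unique _ _ _ _ _ (lim t)).
apply: (CI_dct (F := fun k (x : T) => rC (E (k.+1%:R^-1 *: (x : Rn))) * (expi (- dotp (x : Rn) t) * rC (cabs (FT h x) ^+ 2)))
  (g := fun x => cabs (FT h x) ^+ 2)) => //.
- move=> k; apply: cmeasM; first exact: cmeas_rC.
  apply: cmeasM; last exact: cmeas_rC.
  by apply: cmeas_expi; apply: measurable_funN; apply: measurable_dotp => //; exact: measurable_cst.
- move=> x; rewrite -[X in ccvg _ X]mul1r; apply: ccvgM; last exact: ccvg_cst.
  by apply/ccvgP; split => /=; [exact: El|exact: cvg_cst].
- move=> k x; rewrite !cabsM cabs_expi mul1r !cabs_rC !ger0_norm ?sqr_ge0//.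
  by rewrite ler_piMl ?sqr_ge0.
Qed.
End inversion.

(** * Uniform bounds over translates *)

Lemma integrableZl_EFin (R : realType) d (X : measurableType d) (m : {measure set X -> \bar R}) (c : R) (f : X -> R) :
  m.-integrable setT (fun x => (f x)%:E) -> m.-integrable setT (fun x => (c * f x)%:E).
Proof. by move=> fi; under eq_fun do rewrite EFinM; exact: integrableZl. Qed.

Lemma RintegralZl_T (R : realType) d (X : measurableType d) (m : {measure set X -> \bar R}) (c : R) (f : X -> R) :
  m.-integrable setT (fun x => (f x)%:E) -> \int[m]_x (c * f x) = c * \int[m]_x f x.
Proof. exact: RintegralZl. Qed.

Lemma Rintegral_mulCZ (R : realType) d (X : measurableType d) (m : {measure set X -> \bar R}) (c : R) (b f : X -> R) :
  m.-integrable setT (fun x => (b x * f x)%:E) ->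
  m.-integrable setT (fun x => (b x * (c * f x))%:E) /\
  \int[m]_x (b x * (c * f x)) = c * \int[m]_x (b x * f x).
Proof.
move=> fi; have E x : b x * (c * f x) = c * (b x * f x) by rewrite mulrCA.
split; first by under eq_fun do rewrite E; exact: integrableZl_EFin.
by rewrite -RintegralZl_T//; exact: eq_Rintegral.
Qed.

Lemma conj_over_sq (R : realType) (z : R[i]) : cabs z ^+ 2 != 0 -> cconj z * rC (cabs z ^+ 2)^-1 * z = 1.
Proof. by move=> z0; rewrite mulrAC (mulrC (cconj z)) mul_cconj -rCM mulfV// rC1. Qed.

Lemma mulr_regroup (K : comPzRingType) (a l e b : K) : a * l * (e * b) = b * (a * e * l).
Proof. by rewrite mulrACA mulrA mulrC. Qed.

Lemma cos_ge_half (R : realType) : exists delta : R, 0 < delta /\ forall a : R, `|a| <= delta -> 2^-1 <= cos a.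
Proof.
have h : \forall a \near (0 : R), 2^-1 < cos a.
  have h := @continuous_cos R 0; apply: (cvgr_gt _ h); rewrite cos0; lra.
have [e e0 he] : exists2 e : R, 0 < e & forall a, `|a| < e -> 2^-1 < cos a.
  move: h => /nbhs_ballP[e /= e0 he]; exists e => // a ae; apply: he.
  by rewrite -ball_normE /= sub0r normrN.
exists (e / 2); split; first by rewrite divr_gt0.
by move=> a ae; apply/ltW/he; apply: le_lt_trans ae _; rewrite ltr_pdivrMr//; lra.
Qed.

Section transform_bounds.
Variables (R : realType) (n : nat).
Local Notation Rn := 'rV[R]_n.
Local Notation T := (BorelRd R n).
Local Notation C := R[i].
Local Notation mu := (@leb R n).

(** When [n rho r <= delta], all phases [x.t] occurring on the support of [k] have cosine at least
    1/2, so the integral defining the transform keeps half of the mass. *)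
Lemma FT_lower : exists delta : R, 0 < delta /\
  forall (r rho : R) (k : T -> R), n%:R * rho * r <= delta -> 0 <= rho ->
    mu.-integrable setT (fun x => (k x)%:E) -> (forall x, 0 <= k x) ->
    (forall x : Rn, rho < `|x| -> k x = 0) ->
    forall t : Rn, `|t| <= r -> \int[mu]_x k x <= 2 * cabs (FT (fun x => rC (k x)) t).
Proof.
have [delta [d0 dP]] := @cos_ge_half R; exists delta; split => // r rho k nr rho0 ki k0 kz t tr.
have rki : cintegrable mu (fun x : T => rC (k x)) by exact: cintegrable_rC.
have := ler_cre_cabs (FT (fun x => rC (k x)) t).
have := FT_cint t rki => /cintegrableP[+ _].
rewrite /FT cre_CI => cki.
have cE : (fun x : T => cre (expi (dotp (x : Rn) t) * rC (k x))) = (fun x : T => cos (dotp (x : Rn) t) * k x).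
  by apply/funext => x; rewrite creM /= mulr0 subr0.
have cki' : mu.-integrable setT (fun x : T => (cos (dotp (x : Rn) t) * k x)%:E).
  by move: cki; congr (_.-integrable _ _); apply/funext => x; rewrite creM /= mulr0 subr0.
rewrite cE.
suff : 2^-1 * \int[mu]_x k x <= \int[mu]_x (cos (dotp (x : Rn) t) * k x).
  move: (cabs _) (\int[mu]_x k x) (\int[mu]_x (cos (dotp (x : Rn) t) * k x)) => a b c h1.
  by have := ler_norm c; lra.
rewrite -RintegralZl//; apply: le_Rintegral => //; first exact: integrableZl_EFin.
move=> x _; have [xr|xr] := leP `|x : Rn| rho; last by rewrite kz// !mulr0.
apply: ler_wpM2r => //; apply: dP; apply: le_trans (dotp_le _ _) _; apply: le_trans nr.
by apply: ler_pM => //; rewrite ler_wpM2l.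
Qed.

Lemma weighted_cauchy_schwarz (b : T -> R) (g : T -> C) (M : R) :
  mu.-integrable setT (fun x => (b x)%:E) -> (forall x, 0 <= b x) ->
  cmeas g -> (forall x, cabs (g x) <= M) ->
  mu.-integrable setT (fun x => (b x * cabs (g x) ^+ 2)%:E) /\
  cabs (CI mu (fun x => rC (b x) * g x)) ^+ 2 <= (\int[mu]_x b x) * \int[mu]_x (b x * cabs (g x) ^+ 2).
Proof.
move=> bi b0 mg gM.
have rbi : cintegrable mu (fun x : T => rC (b x)) by exact: cintegrable_rC.
have M0 : 0 <= M by apply: le_trans (gM 0); exact: cabs_ge0.
have i1 : mu.-integrable setT (fun x => (b x * cabs (g x))%:E).
  have := cintegrable_cabs (cintegrableM_bdd rbi mg gM); congr (_.-integrable _ _).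
  by apply/funext => x; rewrite cabsM cabs_rC ger0_norm.
have i2 : mu.-integrable setT (fun x => (b x * cabs (g x) ^+ 2)%:E).
  have mg2 : cmeas (fun x => g x * g x) by exact: cmeasM.
  have gM2 x : cabs (g x * g x) <= M * M by rewrite cabsM ler_pM ?cabs_ge0.
  have := cintegrable_cabs (cintegrableM_bdd rbi mg2 gM2); congr (_.-integrable _ _).
  by apply/funext => x; rewrite !cabsM cabs_rC ger0_norm// expr2.
split => //; set a := \int[mu]_x (b x * cabs (g x)); set q := \int[mu]_x (b x * cabs (g x) ^+ 2).
set m := \int[mu]_x b x.
have m0 : 0 <= m by apply: Rintegral_ge0.
have ha : cabs (CI mu (fun x => rC (b x) * g x)) <= a.
  apply: cabs_CI_le => //; first by apply: cmeasM => //; case: rbi.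
  by move=> x; rewrite cabsM cabs_rC ger0_norm.
have q0 : 0 <= q by apply: Rintegral_ge0 => x _; rewrite mulr_ge0 ?sqr_ge0.
(* The integral of [b (|g| - l)^2], a nonnegative quadratic polynomial in [l]. *)
have key (l : R) : 0 <= q - 2 * l * a + l ^+ 2 * m.
  have -> : q - 2 * l * a + l ^+ 2 * m = \int[mu]_x (b x * (cabs (g x) - l) ^+ 2).
    transitivity (\int[mu]_x (b x * cabs (g x) ^+ 2 - 2 * l * (b x * cabs (g x)) + l ^+ 2 * b x)).
      have j1 : mu.-integrable setT (fun x => (2 * l * (b x * cabs (g x)))%:E).
        exact: integrableZl_EFin.
      have j2 : mu.-integrable setT (fun x => (l ^+ 2 * b x)%:E).
        exact: integrableZl_EFin.
      have j3 : mu.-integrable setT (fun x => (b x * cabs (g x) ^+ 2 - 2 * l * (b x * cabs (g x)))%:E).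
        by under eq_fun do rewrite EFinB; exact: integrableB.
      by rewrite RintegralD// RintegralB// !RintegralZl.
    by apply: eq_Rintegral => x _; ring.
  by apply: Rintegral_ge0 => x _; rewrite mulr_ge0 ?sqr_ge0.
have a2 : a ^+ 2 <= m * q.
  (* For [m = 0] the polynomial is affine in [l], so its slope vanishes: at [l = (q + 1) / (2 a)] it
     would be -1. Otherwise its minimum, at [l = a / m], gives the inequality. *)
  have [m00|mp] := eqVneq m 0.
    have a0 : a = 0.
      apply/eqP; apply: contraT => an0.
      have := key ((q + 1) / (2 * a)); rewrite m00 mulr0 addr0.
      have -> : 2 * ((q + 1) / (2 * a)) * a = q + 1 by field.
      lra.
    by rewrite a0 m00 mul0r expr0n.
  have mp' : 0 < m by rewrite lt_neqAle eq_sym mp.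
  have := key (a / m); have -> : q - 2 * (a / m) * a + (a / m) ^+ 2 * m = q - a ^+ 2 / m by field.
  by rewrite subr_ge0 ler_pdivrMr// mulrC.
by apply: le_trans a2; rewrite ler_pXn2r ?nnegrE ?cabs_ge0//; apply: le_trans ha; exact: cabs_ge0.
Qed.

(** The factor [conj K / max (|K|^2, c)] equals [1 / K] where [|K|^2 >= c] and stays continuous
    across the zeros of [K]: a division of [h] by [K]. *)
Lemma ccontinuous_quot (h K : Rn -> C) (c : R) : 0 < c -> Cc h -> ccontinuous K ->
  Cc (fun t => h t * (cconj (K t) * rC (Num.max (cabs (K t) ^+ 2) c)^-1)).
Proof.
move=> c0 ch cK; apply: Cc_mul => //; apply: seq_ccontinuous => u x ux.
apply: ccvgM; first by apply: ccvg_conj; exact: ccontinuous_seq.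
have := ccvg_cabs (ccontinuous_seq cK ux) => h1.
apply/ccvgP; split => /=; last exact: cvg_cst.
apply: cvgV; first by rewrite gt_eqF// lt_max c0 orbT.
have h2 : (fun k => cabs (K (u k)) ^+ 2) @ \oo --> cabs (K x) ^+ 2.
  by rewrite expr2; under eq_fun do rewrite expr2; exact: cvgM.
have h3 : (fun=> c) @ \oo --> c by exact: cvg_cst.
rewrite maxr_absE; under eq_fun do rewrite maxr_absE.
by apply: cvgM; [apply: cvgD; [exact: cvgD|apply: cvg_norm; exact: cvgB]|exact: cvg_cst].
Qed.

Lemma indic_reflect (rho : R) (S : T -> R) (z : Rn) :
  mu.-integrable setT (fun x : T => (\1_(cube 0 rho) (x : Rn) * S (z - (x : Rn)))%:E) ->
  mu.-integrable setT (fun x : T => (\1_(cube z rho) (x : Rn) * S x)%:E) /\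
  \int[mu]_x (\1_(cube z rho) (x : Rn) * S x) = \int[mu]_x (\1_(cube 0 rho) (x : Rn) * S (z - (x : Rn))).
Proof.
move=> fi.
have E (x : T) : \1_(cube 0 rho) (z - (x : Rn)) * S (z - (z - (x : Rn))) = \1_(cube z rho) (x : Rn) * S x.
  rewrite subKr; congr (_ * _); rewrite !indicE; congr (_%:R); congr nat_of_bool.
  by apply/idP/idP; rewrite !inE /cube /= subr0 distrC.
have [/cintegrableP[i1 _] i2] := CI_reflect z (cintegrable_rC fi).
split; first by move: i1; congr (_.-integrable _ _); apply/funext => x; rewrite /= E.
move: i2; rewrite !CI_rC => /rC_inj <-.
by apply: eq_Rintegral => x _; rewrite E.
Qed.

(* The transform [K] of the indicator [b] of a small cube has no zero on the support of
   [h]; writing [h = L K] makes [FT h] the convolution of [b] with [FT L]. *)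
Lemma check_dom (h : Rn -> C) : Cc h -> exists (rho : R) (S : T -> R),
  [/\ 0 < rho, mu.-integrable setT (fun x => (S x)%:E), forall x, 0 <= S x &
   forall z : Rn, mu.-integrable setT (fun w : T => (\1_(cube z rho) (w : Rn) * S w)%:E) /\
     cabs (FT h z) ^+ 2 <= \int[mu]_w (\1_(cube z rho) (w : Rn) * S w)].
Proof.
move=> ch; have [ch' [r [r0 hr]]] := CcP ch.
have [delta [d0 dP]] := FT_lower.
(* Small enough for [FT_lower] on the ball of radius [r] that supports [h]. *)
pose rho := delta / (n%:R * r + 1).
have nr1 : 0 < n%:R * r + 1 by rewrite ltr_wpDl// mulr_ge0// ltW.
have rho0 : 0 < rho by rewrite divr_gt0.
have nrho : n%:R * rho * r <= delta.
  rewrite (_ : _ * rho * r = rho * (n%:R * r)); last by ring.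
  by rewrite /rho mulrAC ler_pdivrMr// ler_pM2l// lerDl.
pose b : T -> R := \1_(cube 0 rho).
have bi : mu.-integrable setT (fun x => (b x)%:E).
  by apply: integrable_indic_lty; [exact: measurable_cube|exact: leb_cube].
have b0 x : 0 <= b x by rewrite /b indicE.
have bz (x : Rn) : rho < `|x| -> b x = 0.
  by move=> xr; rewrite /b indicE memNset// /cube /= subr0; apply/negP; rewrite -ltNge.
set m := \int[mu]_x b x.
have mE : m = fine (mu (cube 0 rho)).
  by rewrite /m /Rintegral integral_indic//; [rewrite setIT|exact: measurable_cube].
have m0 : 0 < m.
  rewrite mE fine_gt0// leb_cube_gt0//=; exact: leb_cube.
have rbi : cintegrable mu (fun x : T => rC (b x)) by exact: cintegrable_rC.
(* The sign makes the transform of [L K] at [z] an average of [FT L (z - y)] over [y] in the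
   cube. *)
pose K (t : Rn) := FT (fun x : T => rC (b x)) (- t).
have Klow (t : Rn) : `|t| <= r -> m <= 2 * cabs (K t).
  by move=> tr; apply: (dP r rho) => //; [exact: ltW|rewrite normrN].
have cK : ccontinuous K.
  apply: seq_ccontinuous => u x ux.
  exact: (ccontinuous_seq (FT_continuous rbi) (u := fun k => - u k) (cvgN ux)).
(* By [Klow], [|K|^2] is at least [c] on the support of [h], so the truncation in [L] has no effect
   there. *)
pose c := (m / 2) ^+ 2.
have c0 : 0 < c by rewrite exprn_gt0// divr_gt0.
pose L := fun t => h t * (cconj (K t) * rC (Num.max (cabs (K t) ^+ 2) c)^-1).
have cL : Cc L by exact: ccontinuous_quot.
have hLK t : h t = L t * K t.
  have [tr|tr] := leP `|t| r; last by rewrite /L hr// !mul0r.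
  have kc : c <= cabs (K t) ^+ 2.
    rewrite ler_pXn2r ?nnegrE ?cabs_ge0 ?divr_ge0// ?(ltW m0)// ler_pdivrMr// mulrC; exact: Klow.
  by rewrite /L max_l// -mulrA conj_over_sq ?mulr1//; apply: lt0r_neq0; exact: lt_le_trans kc.
have nL := Cc_nice cL; have Li := nice_leb nL.
have [c1 [_ /(_ L cL)[SLi _]]] := inversion R n.
pose ML := \int[mu]_x cabs (L x).
have FLM x : cabs (FT L x) <= ML by exact: FT_le.
have mFL := FT_cmeas Li.
(* Integrable by [inversion] applied to [L]. The factor [m], the mass of [b], comes from
   Cauchy-Schwarz in [FT h z = int b(y) FT L (z - y) dy]. *)
exists rho, (fun x => m * cabs (FT L x) ^+ 2); split => //.
- exact: integrableZl_EFin.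
- by move=> x; rewrite mulr_ge0 ?sqr_ge0// ltW.
move=> z.
have mFz : cmeas (fun y : T => FT L (z - (y : Rn))).
  by apply: (cmeas_comp mFL); apply: measurable_subrv; [exact: measurable_cst|exact: measurable_id].
have [wi wle] := weighted_cauchy_schwarz bi b0 mFz (fun y => FLM _).
have FTE : FT h z = CI mu (fun y : T => rC (b y) * FT L (z - (y : Rn))).
  pose F := fun y x : T => rC (b y) * (expi (dotp (x : Rn) (z - (y : Rn))) * L x).
  have mF : cmeas (fun w : T * T => F w.1 w.2).
    apply: cmeasM; first by apply: (cmeas_comp (f := fun x : T => rC (b x))); [case: rbi|exact: measurable_fst].
    apply: cmeasM; last by apply: (cmeas_comp (f := (L : T -> C))); [case: Li|exact: measurable_snd].
    apply: cmeas_expi; apply: measurable_dotp; first exact: measurable_snd.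
    by apply: measurable_subrv; [exact: measurable_cst|exact: measurable_fst].
  have [|_ _ FF] := @CI_fubini _ _ _ _ _ mu mu F mF.
    apply: (@iterated_lty _ _ _ _ _ mu mu F (fun x : T => b x * ML) mF).
      move=> y; rewrite /F; under eq_integral do rewrite cabsM cabsM cabs_expi mul1r cabs_rC ger0_norm//.
      rewrite ge0_integralZl_EFin//; [by rewrite cintegrable_EFin| |by move=> x; exact: cabs_ge0].
      by apply: measurable_cabs; case: Li.
    by under eq_fun do rewrite EFinM; exact: integrableZr.
  transitivity (CI mu (fun x => CI mu (F^~ x))); last first.
    by rewrite -FF; apply: eq_CI => y; rewrite /F (CIZ _ (FT_cint _ Li)).
  rewrite /FT; apply: eq_CI => x; rewrite hLK /K.
  have := CIZ (expi (dotp (x : Rn) z) * L x) (FT_cint (- (x : Rn)) rbi).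
  rewrite -/(FT _ _) mulrA => <-; apply: eq_CI => y.
  by rewrite /F dotpBr expiD dotpNr (dotpC y) mulr_regroup.
have [s1 s2] : mu.-integrable setT (fun x : T => (b x * (m * cabs (FT L (z - (x : Rn))) ^+ 2))%:E) /\
    \int[mu]_x (b x * (m * cabs (FT L (z - (x : Rn))) ^+ 2)) = m * \int[mu]_y (b y * cabs (FT L (z - (y : Rn))) ^+ 2).
  exact: (Rintegral_mulCZ m wi).
have [j1 j2] := @indic_reflect rho (fun x => m * cabs (FT L x) ^+ 2) z s1.
by split; [exact: j1|rewrite j2 s2 FTE].
Qed.

Definition cube_bounded (lam : {measure set T -> \bar R}) :=
  forall r, exists M : R, 0 <= M /\ forall x : Rn, (lam (cube x r) <= M%:E)%E.

Lemma cube_bounded_locfin lam : cube_bounded lam -> locfin lam.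
Proof. by move=> tb r; have [M [_ /(_ 0) h]] := tb r; apply: le_lt_trans h _; exact: ltry. Qed.

Lemma cube_sub (z v : Rn) (r s : R) : `|v - z| <= s -> cube v r `<=` cube z (r + s).
Proof.
move=> vz w; rewrite /cube /= => wv.
rewrite (_ : w - z = (w - v) + (v - z)); last by rewrite addrA subrK.
by apply: le_trans (ler_normD _ _) _; exact: lerD.
Qed.

(** What translations and reflections have in common, so that a single estimate serves integrands in
    [x + y] and in [u - x]. *)
Definition iso_map (e : Rn -> Rn) := measurable_fun setT (e : T -> T) /\
  forall w r, exists y, e @^-1` cube w r = cube y r.

(* The bound [D] does not depend on the measure, and its integrals are bounded uniformly
   over all translations and reflections [e]. *)
Definition dominated (F : Rn -> C) := exists D : T -> R, [/\ measurable_fun setT D, forall z, 0 <= D z,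
    forall z v : Rn, `|v| <= 1 -> cabs (F (z + v)) <= D z &
    forall lam : {measure set T -> \bar R}, cube_bounded lam -> exists M : R, 0 <= M /\ forall e, iso_map e ->
      lam.-integrable setT (fun x : T => (D (e x))%:E) /\ \int[lam]_x D (e x) <= M].

(** Take for [D z] the integral of the function [S] of [check_dom] over a cube around [z], enlarged
    by 1 to absorb the shift [v]. By Tonelli the integral of [D (e x)] is that of [S w] times the
    mass of the preimage under [e] of a cube around [w]; this preimage is a cube of the same radius,
    so its mass is bounded. *)
Lemma FT_sqr_dominated (h : Rn -> C) : Cc h -> dominated (fun x => rC (cabs (FT h x) ^+ 2)).
Proof.
move=> ch.
have [rho [S [rho0 Si S0 dom]]] := check_dom ch.
have mS : measurable_fun setT S by apply/measurable_EFinP; case/integrableP : Si.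
pose D := fun z : T => \int[mu]_w (\1_(cube (z : Rn) (rho + 1)) (w : Rn) * S w).
have mC : measurable_fun setT (fun p : T * T => \1_(cube (p.1 : Rn) (rho + 1)) (p.2 : Rn) * S p.2).
  apply: measurable_funM; last by apply: measurableT_comp => //; exact: measurable_snd.
  rewrite (_ : (fun _ => _) = \1_[set p : T * T | `|(p.2 : Rn) - (p.1 : Rn)| <= rho + 1]).
    have mN : measurable_fun setT (fun p : T * T => `|(p.2 : Rn) - (p.1 : Rn)|).
      by apply: measurable_normv; apply: measurable_subrv; [exact: measurable_snd|exact: measurable_fst].
    apply: measurable_indic; rewrite -[X in measurable X]setTI.
    have := mN measurableT _ (measurable_itv (Interval -oo%O (BRight (rho + 1)))); congr (measurable (_ `&` _)).
  by apply/funext => p; rewrite !indicE.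
have Di z : mu.-integrable setT (fun w : T => (\1_(cube z (rho + 1)) (w : Rn) * S w)%:E).
  apply: le_integrable Si => //.
    apply/measurable_EFinP; apply: measurable_funM => //.
    by apply: measurable_indic; exact: measurable_cube.
  move=> w _; rewrite !abse_EFin lee_fin normrM ler_piMl// ger0_norm.
    by rewrite indicE; case: (_ \in _).
  by rewrite indicE.
have D0 z : 0 <= D z.
  by apply: Rintegral_ge0 => w _; rewrite mulr_ge0// indicE.
have mD : measurable_fun setT D.
  have := @measurable_CI2 _ _ _ _ _ mu (fun z w : T => rC (\1_(cube (z : Rn) (rho + 1)) (w : Rn) * S w)).
  case=> [|x|]; [exact: cmeas_rC|by apply: cintegrable_rC; exact: Di|].
  by under eq_fun do rewrite CI_rC /=.
exists D; split => //.
  move=> z v v1; have [d1 d2] := dom (z + v); rewrite cabs_rC ger0_norm ?sqr_ge0//.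
  apply: le_trans d2 _; apply: le_Rintegral => //; first exact: Di.
  move=> w _; apply: ler_wpM2r => //; rewrite !indicE.
  have := @cube_sub z (z + v) rho 1; rewrite addrAC subrr add0r => /(_ v1) sub.
  case: (boolP (w \in cube (z + v) rho)) => // /set_mem/sub wz.
  by rewrite mem_set.
move=> lam tb.
have sf := locfin_sigma_finite (cube_bounded_locfin tb); pose lam' := to_sigma_finite sf.
have [M [M0 lamM]] := tb (rho + 1).
exists (M * \int[mu]_w S w); split; first by rewrite mulr_ge0//; exact: Rintegral_ge0.
move=> e [me ecube].
have meas2 : measurable_fun setT (fun p : T * T => \1_(cube (e p.1) (rho + 1)) (p.2 : Rn) * S p.2).
  apply: (measurableT_comp (f := fun p : T * T => \1_(cube (p.1 : Rn) (rho + 1)) (p.2 : Rn) * S p.2) mC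
     (g := fun p : T * T => (e p.1 : T, p.2))).
  by apply: measurable_fun_pair; [exact: (measurableT_comp me measurable_fst)|exact: measurable_snd].
have bound : (\int[lam]_x (D (e x))%:E <= (M * \int[mu]_w S w)%:E)%E.
  have -> : (\int[lam]_x (D (e x))%:E = \int[lam']_x \int[mu]_w (\1_(cube (e x) (rho + 1)) (w : Rn) * S w)%:E)%E.
    by apply: eq_integral => x _; rewrite /D /Rintegral fineK//; exact: integrable_fin_num.
  rewrite (@tonelli _ _ _ _ _ lam' mu (fun x w : T => \1_(cube (e x) (rho + 1)) (w : Rn) * S w) meas2); last first.
    by move=> x w; rewrite mulr_ge0// indicE.
  have -> : ((M * \int[mu]_w S w)%:E = \int[mu]_w (M * S w)%:E)%E.
    by rewrite ge0_integralZl_EFin// EFinM; congr (_ * _)%E; rewrite /Rintegral fineK//; exact: integrable_fin_num.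
  apply: ge0_le_integral => //.
  - by move=> w _; apply: integral_ge0 => x _; rewrite lee_fin mulr_ge0// indicE.
  - apply: (@measurable_fun_fubini_tonelli_G _ _ _ _ _ lam' (fun p : T * T => (\1_(cube (e p.1) (rho + 1)) (p.2 : Rn) * S p.2)%:E)).
      exact/measurable_EFinP.
    by move=> p; rewrite lee_fin mulr_ge0// indicE.
  - by apply/measurable_EFinP; apply: measurable_funM => //; exact: measurable_cst.
  move=> w _; have [y yE] := ecube w (rho + 1).
  have E x : \1_(cube (e x) (rho + 1)) w * S w = S w * \1_(cube y (rho + 1)) x.
    rewrite mulrC -yE !indicE; congr (_ * _%:R); congr nat_of_bool.
    by apply/idP/idP; rewrite !inE /cube /= distrC.
  under eq_integral do rewrite E.
  rewrite ge0_integralZl_EFin//; last by apply: measurable_indic; exact: measurable_cube.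
  rewrite integral_indic//; last exact: measurable_cube.
  by rewrite setIT mulrC EFinM; apply: lee_wpmul2l; [rewrite lee_fin|exact: lamM].
have mDe : measurable_fun setT (fun x : T => D (e x)) by exact: (measurableT_comp mD me).
have Dei : lam.-integrable setT (fun x : T => (D (e x))%:E).
  apply/integrableP; split; first exact/measurable_EFinP.
  under eq_integral do rewrite abse_EFin ger0_norm//.
  by apply: le_lt_trans bound _; exact: ltry.
split => //; rewrite -lee_fin; apply: le_trans bound.
by rewrite /Rintegral fineK//; exact: integrable_fin_num.
Qed.

Lemma iso_map_reflect (s : Rn) : iso_map (fun x => s - x).
Proof.
split; first by apply: measurable_subrv; [exact: measurable_cst|exact: measurable_id].
by move=> w r; exists (s - w); apply/seteqP; split => x; rewrite /cube /= (distrC x) [s - w - x]addrAC.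
Qed.

Lemma iso_map_translate (s : Rn) : iso_map (fun x => x + s).
Proof.
split; first by apply: measurable_addrv; [exact: measurable_id|exact: measurable_cst].
by move=> w r; exists (w - s); apply/seteqP; split => x; rewrite /cube /= opprB addrA => h.
Qed.

Lemma nice_dominated (G : Rn -> C) : nice G -> dominated G.
Proof.
move=> [mG [M [M0 GM]] [r [r0 Gr]]].
exists (fun x : T => M * \1_(cube 0 (r + 1)) (x : Rn)); split.
- by apply: measurable_funM => //; apply: measurable_indic; exact: measurable_cube.
- by move=> z; rewrite mulr_ge0 ?(ltW M0)// indicE.
- move=> z v v1; rewrite indicE; have [|] := boolP (_ \in _); first by rewrite mulr1.
  move=> /negP zr; rewrite Gr ?cabs0 ?mulr0// ltNge; apply/negP => zv; apply: zr.
  rewrite inE /cube /= subr0; have := ler_normB (z + v) v; rewrite addrK; lra.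
move=> lam tb; have [B [B0 lamB]] := tb (r + 1).
exists (M * B); split; first by rewrite mulr_ge0// ltW.
move=> e [me ec]; have [y yE] := ec 0 (r + 1).
have E x : M * \1_(cube 0 (r + 1)) (e x) = M * \1_(cube y (r + 1)) x by rewrite -yE !indicE.
have yB := lamB y.
have ylt : (lam (cube y (r + 1)) < +oo)%E by apply: le_lt_trans yB _; exact: ltry.
have i1 : lam.-integrable setT (fun x : T => (\1_(cube y (r + 1)) (x : Rn))%:E).
  by apply: integrable_indic_lty => //; exact: measurable_cube.
split; first by under eq_fun do rewrite E; exact: integrableZl_EFin.
under eq_Rintegral do rewrite E.
rewrite RintegralZl_T// ler_wpM2l ?(ltW M0)// /Rintegral integral_indic//; last exact: measurable_cube.
by rewrite setIT -lee_fin fineK// ge0_fin_numE.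
Qed.
End transform_bounds.

(** * Gliding hump *)

Lemma fchoice (A B : Type) (P : A -> B -> Prop) : (forall x, exists y, P x y) -> exists f, forall x, P x (f x).
Proof. by move/boolp.choice => [f fP]; exists f. Qed.

Lemma geometric_half (R : realType) (N : nat) : \sum_(l < N) (2^-1 : R) ^+ l = 2 - 2 * 2^-1 ^+ N.
Proof.
elim: N => [|N IH]; first by rewrite big_ord0 expr0; ring.
by rewrite big_ord_recr /= IH exprS; lra.
Qed.

Lemma small_half_pow (R : realType) (c : R) : 0 < c -> exists N : nat, 2^-1 ^+ N <= c.
Proof.
move=> c0; have h : (fun N => (2^-1 : R) ^+ N) @ \oo --> (0 : R).
  by apply: cvg_expr; rewrite ger0_norm ?invr_ge0// invf_lt1// ltr1n.
have [N _ /(_ N (leqnn N)) hN] := cvgr_le _ h _ c0; by exists N.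
Qed.

Lemma real_series_half (R : realType) (a : nat -> R) : (forall l, `|a l| <= 2^-1 ^+ l) ->
  exists s : R, (fun N => \sum_(l < N) a l) @ \oo --> s.
Proof.
move=> ah; have : cvgn (series a).
  apply: normed_cvg; apply: (series_le_cvg (v_ := geometric 1 2^-1)).
  - by move=> l /=.
  - by move=> l; rewrite /geometric /= mul1r exprn_ge0// invr_ge0.
  - by move=> l; rewrite /geometric /= mul1r.
  - by apply: is_cvg_geometric_series; rewrite ger0_norm ?invr_ge0// invf_lt1// ltr1n.
move=> h; exists (limn (series a)); move: h; rewrite /series /=.
by under [in X in _ -> X]eq_fun do rewrite -(big_mkord xpredT a).
Qed.

Lemma series_half (R : realType) (a : nat -> R[i]) : (forall l, cabs (a l) <= 2^-1 ^+ l) ->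
  exists s : R[i], forall N, cabs (s - \sum_(l < N) a l) <= 2 * 2^-1 ^+ N.
Proof.
move=> ah.
have [s1 h1] := real_series_half (fun l => le_trans (ler_cre_cabs (a l)) (ah l)).
have [s2 h2] := real_series_half (fun l => le_trans (ler_cim_cabs (a l)) (ah l)).
have creS N : cre (\sum_(l < N) a l) = \sum_(l < N) cre (a l).
  by elim: N => [|N IH]; rewrite ?big_ord0// !big_ord_recr /= creD IH.
have cimS N : cim (\sum_(l < N) a l) = \sum_(l < N) cim (a l).
  by elim: N => [|N IH]; rewrite ?big_ord0// !big_ord_recr /= cimD IH.
exists (Complex s1 s2) => N.
have lim : ccvg (fun M => \sum_(l < M) a l) (Complex s1 s2).
  apply/ccvgP; split => /=; first by under eq_fun do rewrite creS.
  by under eq_fun do rewrite cimS.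
have := ccvg_cabs (ccvgD lim (ccvg_cst (- \sum_(l < N) a l))).
(* The bound holds for the distance to every later partial sum and passes to the limit. *)
move=> h; rewrite -(cvg_lim _ h)//; apply: limr_le; first by apply/cvg_ex; exists (cabs (Complex s1 s2 - \sum_(l < N) a l)).
near=> M.
have NM : (N <= M)%N by near: M; exact: nbhs_infty_ge.
rewrite -(subnKC NM) big_split_ord /= addrAC subrr add0r.
apply: le_trans (cabs_sum _ _ _) _.
apply: (@le_trans _ _ (\sum_(i < M - N) (2^-1 ^+ N * 2^-1 ^+ i))).
  by apply: ler_sum => i _; rewrite -exprD.
rewrite -mulr_sumr geometric_half mulrC ler_wpM2r ?exprn_ge0 ?invr_ge0//.
by rewrite gerBl mulr_ge0// exprn_ge0// invr_ge0.
Unshelve. all: by end_near.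
Qed.

Section gliding_hump.
Variables (R : realType) (n : nat).
Local Notation Rn := 'rV[R]_n.
Local Notation T := (BorelRd R n).
Local Notation C := R[i].
Local Notation mu := (@leb R n).

Lemma uniform_ccontinuous (f : nat -> Rn -> C) (g : Rn -> C) : (forall N, ccontinuous (f N)) ->
  (forall e : R, 0 < e -> exists N, forall t, cabs (g t - f N t) <= e) -> ccontinuous g.
Proof.
move=> cf fg; apply: seq_ccontinuous => u x ux; apply/cvgrPdist_le => e e0.
have e3 : 0 < e / 3 by rewrite divr_gt0.
have [N hN] := fg _ e3.
have /cvgrPdist_le /(_ _ e3) := ccontinuous_seq (cf N) ux.
apply: filterS => k; rewrite !sub0r !normrN !ger0_norm ?cabs_ge0// => hk.
have -> : g (u k) - g x = (g (u k) - f N (u k)) + ((f N (u k) - f N x) + (f N x - g x)).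
  by rewrite (addrA (f N (u k) - f N x)) subrK addrA subrK.
apply: le_trans (cabsD _ _) _; apply: le_trans (lerD (hN _) (cabsD _ _)) _.
by rewrite (cabsB (f N x)); have := hN x; lra.
Qed.

(** [check_dom] bounds [|FT h z|^2] by the integral of the integrable [S] over a cube of fixed size
    around [z], which leaves every bounded set as [z] grows. *)
Lemma riemann_lebesgue (h : Rn -> C) (e : R) : Cc h -> 0 < e ->
  exists A : R, 0 < A /\ forall z : Rn, A <= `|z| -> cabs (FT h z) <= e.
Proof.
move=> ch e0; have [rho [S [rho0 Si S0 dom]]] := check_dom ch.
have mS : measurable_fun setT S by apply/measurable_EFinP; case/integrableP : Si.
pose ind (N : nat) (w : T) : R := 1 - \1_(cube 0 N%:R) (w : Rn).
have ind01 N w : 0 <= ind N w <= 1.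
  by rewrite /ind indicE; case: (_ \in _); rewrite ?subrr ?subr0 lexx ler01.
have mi N : measurable_fun setT (ind N).
  by apply: measurable_funB => //; apply: measurable_indic; exact: measurable_cube.
have lim : (fun N => \int[mu]_w (ind N w * S w)) @ \oo --> (0 : R).
  have <- : \int[mu]_w (0 : R) = 0 by rewrite /Rintegral integral0.
  apply: (Rintegral_dct (g := S)) => //.
  - by move=> N; exact: measurable_funM.
  - move=> w; apply: cvg_near_cst; near=> N.
    have : `|w : Rn| <= N%:R by near: N; exact: nbhs_infty_ger.
    by move=> wN; rewrite /ind indicE mem_set ?subrr ?mul0r// /cube /= subr0.
  - move=> N w; have /andP[a b] := ind01 N w.
    by rewrite ger0_norm ?mulr_ge0// ler_piMl.
have e20 : 0 < e ^+ 2 by rewrite exprn_gt0.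
have [N _ /(_ N (leqnn N)) hN] := cvgr_le _ lim _ e20.
(* From this distance on, the cube of radius [rho] around [z] misses the cube of radius [N] around
   0, outside of which [S] has integral at most [e^2]. *)
exists (N%:R + rho + 1); split; first by rewrite ltr_wpDl// addr_ge0// ltW.
move=> z zA; rewrite -(@ler_pXn2r _ 2%N) ?nnegrE ?cabs_ge0 ?(ltW e0)//.
have [d1 d2] := dom z; apply: le_trans d2 _; apply: le_trans hN.
apply: le_Rintegral => //.
  apply: le_integrable Si => //; first by apply/measurable_EFinP; exact: measurable_funM.
  move=> w _; rewrite !abse_EFin lee_fin; have /andP[a b] := ind01 N w.
  by rewrite normrM ler_piMl// ger0_norm.
move=> w _; apply: ler_wpM2r => //; rewrite /ind !indicE.
have [wz|wz] := boolP ((w : Rn) \in cube z rho); last by case: (_ \in _); rewrite ?subrr ?subr0.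
rewrite memNset ?subr0//; move: wz; rewrite inE /cube /= => wz.
apply/negP; rewrite subr0 -ltNge.
have := ler_normB (w : Rn) ((w : Rn) - z); rewrite subKr; lra.
Unshelve. all: by end_near.
Qed.

(** A continuous tent, so narrow that [FT_lower] applies on the whole ball of radius [r]; its mass
    is positive because it exceeds half its height on the half-size cube. *)
Lemma ex_bump (r : R) : 0 < r -> exists (k : Rn -> C) (c : R),
  [/\ Cc k, 0 < c & forall x : Rn, `|x| <= r -> c <= cabs (FT k x)].
Proof.
move=> r0; have [delta [d0 dP]] := @FT_lower R n.
pose rho := delta / (n%:R * r + 1).
have nr1 : 0 < n%:R * r + 1 by rewrite ltr_wpDl// mulr_ge0// ltW.
have rho0 : 0 < rho by rewrite divr_gt0.
have nrho : n%:R * rho * r <= delta.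
  rewrite (_ : _ * rho * r = rho * (n%:R * r)); last by ring.
  by rewrite /rho mulrAC ler_pdivrMr// ler_pM2l// lerDl.
pose k (t : T) : R := Num.max (rho - `|t : Rn|) 0.
have k0 t : 0 <= k t by rewrite /k le_max lexx orbT.
have kz (t : Rn) : rho < `|t| -> k t = 0.
  by move=> h; apply: max_r; rewrite subr_le0 ltW.
have ck : Cc (fun t : Rn => rC (k t)).
  apply: Cc_cube; last by exists rho => t h; rewrite kz.
  apply: seq_ccontinuous => u x ux; apply/ccvgP; split => /=; last exact: cvg_cst.
  rewrite /k maxr_absE; under eq_fun do rewrite maxr_absE.
  have h : (fun m => rho - `|u m|) @ \oo --> rho - `|x| by apply: cvgB; [exact: cvg_cst|exact: cvg_norm].
  by apply: cvgM; [apply: cvgD; [by apply: cvgD h _; exact: cvg_cst|apply: cvg_norm; apply: cvgB h _; exact: cvg_cst]|exact: cvg_cst].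
have ki : mu.-integrable setT (fun x => (k x)%:E).
  by have /cintegrableP[] := nice_leb (Cc_nice ck).
have kp : 0 < \int[mu]_x k x.
  have i1 : mu.-integrable setT (fun x : T => (rho / 2 * \1_(cube 0 (rho / 2)) (x : Rn))%:E).
    by apply: integrable_cube; exact: leb_locfin.
  apply: (@lt_le_trans _ _ (\int[mu]_x (rho / 2 * \1_(cube 0 (rho / 2)) (x : Rn)))); last first.
    apply: le_Rintegral => // x _; rewrite indicE.
    have [|_] := boolP (_ \in _); last by rewrite mulr0.
    rewrite inE /cube /= subr0 mulr1 /k le_max => xr; apply/orP; left; lra.
  have r2 : 0 < rho / 2 by rewrite divr_gt0.
  rewrite RintegralZl_T; last by apply: integrable_indic_lty; [exact: measurable_cube|exact: leb_cube].
  rewrite mulr_gt0// /Rintegral integral_indic//; last exact: measurable_cube.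
  rewrite setIT fine_gt0// leb_cube_gt0//=; exact: leb_cube.
exists (fun t : Rn => rC (k t)), (2^-1 * \int[mu]_x k x); split => //.
  by rewrite mulr_gt0// invr_gt0.
move=> x xr; have := dP r rho k nrho (ltW rho0) ki k0 kz x xr.
by move: (cabs _) (\int[mu]_x k x) => a b; lra.
Qed.

Lemma FT_hump_sum (k : Rn -> C) (x : nat -> Rn) (z : Rn) (N : nat) : Cc k ->
  FT (fun t : T => k t * \sum_(l < N) rC (2^-1 ^+ l) * expi (- dotp (t : Rn) (x l))) z =
  \sum_(l < N) rC (2^-1 ^+ l) * FT k (z - x l).
Proof.
move=> ck; have ki := nice_leb (Cc_nice ck).
have <- : CI mu (fun t : T => \sum_(l < N) (rC (2^-1 ^+ l) * (expi (dotp (t : Rn) (z - x l)) * k t))) =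
    \sum_(l < N) rC (2^-1 ^+ l) * FT k (z - x l).
  have [|_ i2] := @CI_sum _ _ _ mu _ (index_enum 'I_N) (fun (l : 'I_N) (t : T) => rC (2^-1 ^+ l) * (expi (dotp (t : Rn) (z - x l)) * k t)).
    by move=> l; apply: cintegrableZ; exact: FT_cint.
  by rewrite i2; apply: eq_bigr => l _; rewrite (CIZ _ (FT_cint _ ki)).
apply: eq_CI => t; rewrite mulr_sumr mulr_sumr; apply: eq_bigr => l _.
by rewrite dotpBr expiD; ring.
Qed.

(** Cubes centred within distance [N] of 0 lie in one fixed cube of finite mass, so a cube heavier
    than that one has its centre farther out. *)
Lemma far_heavy_cube (lam : {measure set T -> \bar R}) (r : R) : 0 < r -> locfin lam ->
  (forall M : R, 0 <= M -> exists x : Rn, (M%:E < lam (cube x r))%E) ->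
  forall M N : R, exists x : Rn, N <= `|x| /\ (M%:E < lam (cube x r))%E.
Proof.
move=> r0 lf hv M N.
have lN := lf (r + N); pose M' := Num.max (Num.max M 0) (fine (lam (cube 0 (r + N)))).
have [|x xM] := hv M'; first by rewrite !le_max lexx orbT.
exists x; split; last by apply: le_lt_trans xM; rewrite lee_fin !le_max lexx.
rewrite leNgt; apply/negP => xN.
have sub : cube x r `<=` cube 0 (r + N) by apply: cube_sub; rewrite subr0 ltW.
have := le_measure lam; move=> /(_ (cube x r) (cube 0 (r + N))).
rewrite !inE => /(_ (measurable_cube _ _) (measurable_cube _ _) sub) le1.
have le2 : (lam (cube x r) <= (fine (lam (cube 0 (r + N))))%:E)%E by rewrite fineK// ge0_fin_numE.
have := lt_le_trans xM le2.
by rewrite lte_fin ltNge /M' !le_max lexx orbT.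
Qed.

(* The frequencies [x l] are so far apart that near [x j] all the terms but the [j]-th
   of [FT (k s) z = sum_l 2^-l FT k (z - x l)] are negligible. *)
Lemma hump_lower (k : Rn -> C) (x : nat -> Rn) (s : Rn -> C) (c r : R) (j : nat) (z : Rn) : Cc k -> 0 < c ->
  ccontinuous s ->
  (forall y : Rn, `|y| <= r -> c <= cabs (FT k y)) ->
  (forall t N, cabs (s t - \sum_(l < N) rC (2^-1 ^+ l) * expi (- dotp t (x l))) <= 2 * 2^-1 ^+ N) ->
  (forall l, l != j -> cabs (FT k (z - x l)) <= c * 2^-1 ^+ j / 8) -> `|z - x j| <= r ->
  c * 2^-1 ^+ j / 2 <= cabs (FT (fun t => k t * s t) z).
Proof.
move=> ck c0 cs kr sN far near_j.
set q : R := 2^-1 ^+ j; have q0 : 0 < q by rewrite exprn_gt0// invr_gt0.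
set K := \int[mu]_t cabs (k t).
have K0 : 0 <= K by apply: Rintegral_ge0 => t _; exact: cabs_ge0.
(* The budget near [x j]: the [j]-th hump contributes at least [c q], the other humps of the partial
   sum at most [c q / 4], and the truncated tail at most [2 * 2^-N * K <= c q / 8]. This leaves more
   than [c q / 2]. *)
have [N' hN'] : exists N : nat, 2^-1 ^+ N <= c * q / (16 * (K + 1)).
  by apply: small_half_pow; rewrite divr_gt0 ?mulr_gt0// ltr_wpDl.
pose N := (N' + j.+1)%N.
have jN : (j < N)%N by rewrite /N addnS ltnS leq_addl.
have hN : 2^-1 ^+ N <= c * q / (16 * (K + 1)).
  by apply: le_trans hN'; rewrite /N exprD ler_piMr ?exprn_ge0 ?invr_ge0// exprn_ile1 ?invr_ge0// invf_le1// ler1n.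
set p := fun t : Rn => \sum_(l < N) rC (2^-1 ^+ l) * expi (- dotp t (x l)).
have mp : cmeas (p : T -> C).
  apply: cmeas_sum => l; apply: cmeasM; first exact: cmeas_cst.
  by apply: cmeas_expi; apply: measurable_funN; apply: measurable_dotp => //; exact: measurable_cst.
have mk : cmeas (k : T -> C) by apply: ccontinuous_cmeas; case: ck.
have ms : cmeas (s : T -> C) by exact: ccontinuous_cmeas.
have nks : nice (fun t => k t * s t) by apply: Cc_nice; exact: Cc_mul.
have dmeas : cmeas (fun t : T => k t * (s t - p t)) by apply: cmeasM => //; exact: cmeasB.
have ki := nice_leb (Cc_nice ck).
have kai : mu.-integrable setT (fun t : T => (cabs (k t))%:E) by exact: cintegrable_cabs.
have kai2 : mu.-integrable setT (fun t : T => (2 * 2^-1 ^+ N * cabs (k t))%:E) by exact: integrableZl_EFin.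
have dle t : cabs (k t * (s t - p t)) <= 2 * 2^-1 ^+ N * cabs (k t).
  by rewrite cabsM mulrC ler_wpM2r ?cabs_ge0//; exact: sN.
have di : cintegrable mu (fun t : T => k t * (s t - p t)) by exact: (cintegrable_le dmeas kai2 dle).
have pi' : cintegrable mu (fun t : T => k t * p t).
  have := cintegrableB (nice_leb nks) di; congr cintegrable; apply/funext => t; ring.
have FE : FT (fun t => k t * s t) z = FT (fun t : T => k t * p t) z + FT (fun t : T => k t * (s t - p t)) z.
  rewrite /FT -(CID (FT_cint z pi') (FT_cint z di)); apply: eq_CI => t; ring.
have d1 : cabs (FT (fun t : T => k t * (s t - p t)) z) <= c * q / 8.
  apply: le_trans (FT_le z di) _.
  apply: (@le_trans _ _ (2 * 2^-1 ^+ N * K)).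
    rewrite /K -RintegralZl_T//; apply: le_Rintegral => //; exact: cintegrable_cabs.
  apply: (@le_trans _ _ (2 * (c * q / (16 * (K + 1))) * (K + 1))).
    by apply: ler_pM; rewrite ?mulr_ge0 ?exprn_ge0 ?invr_ge0// ?lerDl// ler_wpM2l.
  have K1 : K + 1 != 0 by rewrite gt_eqF// ltr_wpDl.
  by rewrite (_ : 2 * _ * _ = c * q / 8)//; field.
have d2 : c * q - c * q / 4 <= cabs (FT (fun t : T => k t * p t) z).
  rewrite FT_hump_sum// (bigD1 (Ordinal jN))//=.
  set A := rC _ * FT k (z - x j); set B := \sum_(_ < _ | _) _.
  have AB : cabs A <= cabs (A + B) + cabs B.
    by rewrite -{1}(addrK B A); apply: le_trans (cabsD _ _) _; rewrite cabsN.
  have A1 : c * q <= cabs A.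
    by rewrite /A cabsM cabs_rC ger0_norm ?(ltW q0)// -/q mulrC ler_wpM2l ?kr// ltW.
  have B1 : cabs B <= c * q / 4.
    (* Each other hump is at most [2^-l (c q / 8)], and the weights sum to less than 2. *)
    apply: le_trans (cabs_sum _ _ _) _.
    apply: (@le_trans _ _ (\sum_(l < N) (2^-1 ^+ l * (c * q / 8)))).
      rewrite [X in _ <= X](bigD1 (Ordinal jN))//=; apply: ler_wpDl.
        by rewrite !mulr_ge0 ?exprn_ge0 ?invr_ge0// ltW.
      apply: ler_sum => l lj; rewrite cabsM cabs_rC ger0_norm ?exprn_ge0 ?invr_ge0//.
      by rewrite ler_wpM2l ?exprn_ge0 ?invr_ge0// far.
    rewrite -mulr_suml geometric_half (_ : c * q / 4 = 2 * (c * q / 8)); last by field.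
    apply: ler_wpM2r; first by rewrite !mulr_ge0 ?invr_ge0// ltW.
    by rewrite gerBl mulr_ge0// exprn_ge0// invr_ge0.
  by move: AB A1 B1; move: (cabs A) (cabs B) (cabs (A + B)) (c * q) => a b e f; lra.
rewrite FE; set A := FT _ z; set B := FT _ z.
have AB : cabs A <= cabs (A + B) + cabs B.
  by rewrite -{1}(addrK B A); apply: le_trans (cabsD _ _) _; rewrite cabsN.
have cq : 0 < c * q by rewrite mulr_gt0.
move: cq AB d1 d2; rewrite -/A -/B; move: (cabs A) (cabs B) (cabs (A + B)) (c * q) => a b e f; lra.
Qed.

Lemma cube_bounded_gt0 (lam : {measure set T -> \bar R}) (r : R) : locfin lam -> 0 < r ->
  (forall h : Rn -> C, Cc h -> (\int[lam]_x (cabs (FT h x) ^+ 2)%:E < +oo)%E) ->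
  exists M : R, 0 <= M /\ forall x : Rn, (lam (cube x r) <= M%:E)%E.
Proof.
move=> lf r0 hyp; apply: contrapT => nM.
have hv (M : R) : 0 <= M -> exists x : Rn, (M%:E < lam (cube x r))%E.
  move=> M0; apply: contrapT => nx; apply: nM; exists M; split => // x.
  by rewrite leNgt; apply/negP => lt; apply: nx; exists x.
have [k [c [ck c0 kr]]] := ex_bump r0.
have [A AP] : exists A : nat -> R, forall j, 0 < A j /\ forall z : Rn, A j <= `|z| -> cabs (FT k z) <= c * 2^-1 ^+ j / 8.
  apply: (@fchoice _ _ (fun j A => 0 < A /\ forall z : Rn, A <= `|z| -> cabs (FT k z) <= c * 2^-1 ^+ j / 8)) => j.
  by apply: riemann_lebesgue => //; rewrite divr_gt0 ?mulr_gt0// exprn_gt0// invr_gt0.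
(* The [j]-th cube is to have mass above [8^j]: the square of the lower bound [c 2^-j / 2] loses
   only [4^j], so its contribution still grows like [2^j]. *)
have [G GP] : exists G : nat * R -> Rn, forall p, p.2 <= `|G p| /\ (((2^-1 ^+ p.1) ^- 3)%:E < lam (cube (G p) r))%E.
  apply: (@fchoice _ _ (fun p x => p.2 <= `|x| /\ (((2^-1 ^+ p.1) ^- 3)%:E < lam (cube x r))%E)) => p.
  exact: far_heavy_cube.
(* Each centre lies beyond the previous one by the Riemann-Lebesgue distance [A] of its own index
   plus the radius of the cubes. *)
pose x := fix x j := match j with 0%N => G (0%N, 0) | j'.+1 => G (j'.+1, `|x j'| + A j'.+1 + r) end.
have heavy j : (((2^-1 ^+ j) ^- 3)%:E < lam (cube (x j) r))%E by case: j => [|j] /=; apply: (GP (_, _)).2.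
have dist j l : (j < l)%N -> `|x j| + A l + r <= `|x l|.
  elim: l => // l IH; rewrite ltnS leq_eqVlt => /orP[/eqP->|jl].
    by have [+ _] := GP (l.+1, `|x l| + A l.+1 + r).
  have [h1 _] := GP (l.+1, `|x l| + A l.+1 + r); apply: le_trans h1 => /=.
  by have := IH jl; have [+ _] := AP l; lra.
(* For [l < j] the distance from [z] to [x l] is at least [A j]. For [l > j] it is at least [A l],
   which gives the stronger bound with [2^-l]. *)
have sep z j l : `|z - x j| <= r -> l != j -> cabs (FT k (z - x l)) <= c * 2^-1 ^+ j / 8.
  move=> zj; rewrite neq_ltn => /orP[lj|jl].
    have [_ +] := AP j; apply; have := dist _ _ lj.
    have h1 := ler_normB (z - x l) (z - x j); rewrite opprB addrC addrA subrK in h1.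
    have h2 := ler_normB (x j - x l) (- x l); rewrite opprK subrK in h2; rewrite normrN in h2.
    lra.
  have [_ /(_ (z - x l)) h] := AP l; apply: le_trans (h _) _.
    have := dist _ _ jl.
    have h1 := ler_normB (z - x j) (z - x l); rewrite opprB addrC addrA subrK in h1.
    have h2 := ler_normD (x l - x j) (x j); rewrite subrK in h2.
    lra.
  rewrite ler_pM2r ?invr_gt0// ler_pM2l// ler_wiXn2l ?invr_ge0//; last exact: ltnW.
  by rewrite invf_le1// ler1n.
have [s sP] : exists s : Rn -> C, forall t N, cabs (s t - \sum_(l < N) rC (2^-1 ^+ l) * expi (- dotp t (x l))) <= 2 * 2^-1 ^+ N.
  apply: (@fchoice _ _ (fun t s => forall N, cabs (s - \sum_(l < N) rC (2^-1 ^+ l) * expi (- dotp t (x l))) <= 2 * 2^-1 ^+ N)) => t.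
  apply: (@series_half _ (fun l => rC (2^-1 ^+ l) * expi (- dotp t (x l)))) => l.
  by rewrite cabsM cabs_expi mulr1 cabs_rC ger0_norm// exprn_ge0// invr_ge0.
have cs : ccontinuous s.
  apply: (uniform_ccontinuous (f := fun N t => \sum_(l < N) rC (2^-1 ^+ l) * expi (- dotp t (x l)))).
    move=> N; apply: seq_ccontinuous => u y uy.
    elim: N => [|N IH].
      by apply: (ccvg_ext (u := fun=> 0)); [move=> m; rewrite big_ord0|rewrite big_ord0; exact: ccvg_cst].
    rewrite big_ord_recr /=.
    apply: (ccvg_ext (u := fun m => \sum_(l < N) rC (2^-1 ^+ l) * expi (- dotp (u m) (x l)) + rC (2^-1 ^+ N) * expi (- dotp (u m) (x N)))).
      by move=> m; rewrite big_ord_recr.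
    apply: ccvgD => //; apply: ccvgM; first exact: ccvg_cst.
    by apply: cvg_expi; apply: cvgN; exact: cvg_dotp.
  move=> e e0; have [N hN] : exists N : nat, 2^-1 ^+ N <= e / 2 by apply: small_half_pow; rewrite divr_gt0.
  exists N => t; apply: le_trans (sP t N) _; lra.
pose h := fun t => k t * s t.
have ch : Cc h by exact: Cc_mul.
have low j z : `|z - x j| <= r -> c * 2^-1 ^+ j / 2 <= cabs (FT h z).
  by move=> zj; apply: (hump_lower ck c0 cs kr sP _ zj) => l lj; exact: sep.
have hV := hyp h ch.
set I := (\int[lam]_y (cabs (FT h y) ^+ 2)%:E)%E in hV.
have I0 : (0 <= I)%E by apply: integral_ge0 => y _; rewrite lee_fin sqr_ge0.
have mF : measurable_fun setT (fun y : T => cabs (FT h y) ^+ 2).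
  by apply: measurable_funX; apply: measurable_cabs; apply: FT_cmeas; apply: nice_leb; exact: Cc_nice.
have lowI j : (((c / 2) ^+ 2 * (2^-1 ^+ j)^-1)%:E <= I)%E.
  set q : R := 2^-1 ^+ j; have q0 : 0 < q by rewrite exprn_gt0// invr_gt0.
  have qn : q != 0 by rewrite gt_eqF.
  apply: (@le_trans _ _ (((c * q / 2) ^+ 2)%:E * lam (cube (x j) r))%E).
    have -> : (c / 2) ^+ 2 * q^-1 = (c * q / 2) ^+ 2 * q ^- 3 by field.
    by rewrite EFinM; apply: lee_wpmul2l; [rewrite lee_fin sqr_ge0|apply/ltW; exact: heavy].
  have mC := measurable_cube (x j) r.
  have -> : (((c * q / 2) ^+ 2)%:E * lam (cube (x j) r) = \int[lam]_y ((c * q / 2) ^+ 2 * \1_(cube (x j) r) (y : Rn))%:E)%E.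
    have mi : measurable_fun setT (fun y : T => \1_(cube (x j) r) (y : Rn) : R) by exact: measurable_indic.
    have i0 (y : T) : 0 <= \1_(cube (x j) r) (y : Rn) :> R by rewrite indicE.
    by rewrite (ge0_integralZl_EFin lam mi i0 (sqr_ge0 _)) integral_indic// setIT.
  apply: ge0_le_integral => //.
  - by move=> y _; rewrite lee_fin mulr_ge0// sqr_ge0.
  - by apply/measurable_EFinP; apply: measurable_funM => //; exact: measurable_indic.
  - exact/measurable_EFinP.
  move=> y _; rewrite lee_fin indicE; have [|_] := boolP (_ \in _); last by rewrite mulr0 sqr_ge0.
  rewrite inE /cube /= => yj; rewrite mulr1 ler_pXn2r ?nnegrE ?cabs_ge0 ?low//.
  by rewrite !mulr_ge0 ?invr_ge0// ltW.
move: I0 hV lowI; case: I => // v; rewrite lee_fin => v0 _ lowI.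
have v1 : 0 < v + 1 by rewrite ltr_wpDl.
have c2 : 0 < (c / 2) ^+ 2 by rewrite exprn_gt0// divr_gt0.
(* For this [j] the lower bound [(c / 2)^2 2^j] is at least [v + 1], above the finite value [v] of
   the integral. *)
have [j hj] := small_half_pow (divr_gt0 c2 v1).
have := lowI j; rewrite lee_fin.
have q0 : 0 < 2^-1 ^+ j :> R by rewrite exprn_gt0// invr_gt0.
rewrite ler_pdivrMr// => h1; move: hj; rewrite ler_pdivlMr// mulrC => h2.
by have := le_trans h2 h1; rewrite ler_pM2r//; lra.
Qed.

Lemma cube_bounded_of_transform (lam : {measure set T -> \bar R}) : locfin lam ->
  (forall h : Rn -> C, Cc h -> (\int[lam]_x (cabs (FT h x) ^+ 2)%:E < +oo)%E) -> cube_bounded lam.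
Proof.
move=> lf hyp r.
have r1 : 0 < Num.max r 1 by rewrite lt_max ltr01 orbT.
have [M [M0 MP]] := cube_bounded_gt0 lf r1 hyp; exists M; split => // x; apply: le_trans (MP x).
apply: le_measure; rewrite ?inE; try exact: measurable_cube.
by move=> y; rewrite /cube /= => h; rewrite le_max h.
Qed.
End gliding_hump.

(** * Complex measures as four components *)

Section components.
Variables (R : realType) (n : nat).
Local Notation Rn := 'rV[R]_n.
Local Notation T := (BorelRd R n).
Local Notation C := R[i].
Local Notation mu := (@leb R n).

(* The complex measure [m 0 - m 1 + i (m 2 - m 3)] is handled through its four positive
   components, with the coefficients [cf]; the same coefficients serve for polarization. *)
Definition cf (j : nat) : C :=
  match j with 0%N => 1 | 1%N => -1 | 2%N => Complex 0 1 | _ => - Complex 0 1 end.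

Lemma cabs_cf j : cabs (cf j) = 1.
Proof.
by case: j => [|[|[|j]]] /=; rewrite ?cabsN ?cabs1// /cabs /= expr0n expr1n add0r sqrtr1.
Qed.

Definition cpI (m : nat -> {measure set T -> \bar R}) (g : T -> C) : C := \sum_(j < 4) cf j * CI (m j) g.

Lemma eq_cpI m f g : f =1 g -> cpI m f = cpI m g.
Proof. by move=> fg; apply: eq_bigr => j _; rewrite (eq_CI _ fg). Qed.

Lemma cpIZ m (c : C) g : (forall j, cintegrable (m j) g) -> cpI m (fun x => c * g x) = c * cpI m g.
Proof. by move=> gi; rewrite /cpI mulr_sumr; apply: eq_bigr => j _; rewrite (CIZ _ (gi j)) mulrCA. Qed.

Definition cp (nu : cRadon R n) (j : nat) : {measure set T -> \bar R} :=
  match j with 0%N => rm1 nu | 1%N => rm2 nu | 2%N => rm3 nu | _ => rm4 nu end.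

Lemma cmintE nu g : (forall j, cintegrable (cp nu j) g) -> cmint nu g = cpI (cp nu) g.
Proof.
move=> gi; rewrite /cmint /cpI !big_ord_recr big_ord0 /= add0r.
rewrite (mintE (gi 0%N)) (mintE (gi 1%N)) (mintE (gi 2%N)) (mintE (gi 3%N)).
by rewrite mul1r mulN1r mulrBr mulNr addrA.
Qed.

Lemma cp_locfin nu j : locfin (cp nu j).
Proof.
by move=> r; have [h0 h1 h2 h3] := rm_locfin nu (@compact_cube R n (0 : Rn) r); case: j => [|[|[|j]]].
Qed.

Lemma dominated_bound (lam : {measure set T -> \bar R}) (F : T -> C) : cube_bounded lam -> cmeas F -> dominated F ->
  exists M : R, 0 <= M /\ forall e, iso_map e -> cintegrable lam (fun x : T => F (e x)) /\
    (\int[lam]_x (cabs (F (e x)))%:E <= M%:E)%E.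
Proof.
move=> tb mF [D [mD D0 FD]] /(_ lam tb) [M [M0 MP]]; exists M; split => // e ie.
have [Di DM] := MP e ie; have [me _] := ie.
have mFe : cmeas (fun x : T => F (e x)) by exact: (cmeas_comp mF me).
have le x : cabs (F (e x)) <= D (e x) by have := FD (e x) 0; rewrite addr0 normr0; apply.
have Fi := cintegrable_le mFe Di le; split => //.
rewrite (cintegrable_EFin Fi) lee_fin; apply: le_trans DM; apply: le_Rintegral => //.
exact: cintegrable_cabs.
Qed.

(** Domination bounds the inner integral of [|G (e y x)|] uniformly in [y], so integrability of [F]
    alone makes the double integral converge absolutely. *)
Lemma half_swap (lam : {measure set T -> \bar R}) (F G : T -> C) (e : Rn -> Rn -> Rn) : cube_bounded lam ->
  cintegrable mu F -> cmeas G -> dominated G ->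
  measurable_fun setT (fun z : T * T => e z.1 z.2 : T) -> (forall y, iso_map (e y)) ->
  cintegrable mu (fun y : T => F y * CI lam (fun x : T => G (e y x))) /\
  CI mu (fun y : T => F y * CI lam (fun x : T => G (e y x))) =
  CI lam (fun x : T => CI mu (fun y : T => F y * G (e y x))).
Proof.
move=> tb Fi mG dG me ie.
have sf := locfin_sigma_finite (cube_bounded_locfin tb); pose lam' := to_sigma_finite sf.
have [M [M0 b]] := dominated_bound tb mG dG.
pose H := fun y x : T => F y * G (e y x).
have mH : cmeas (fun z : T * T => H z.1 z.2).
  apply: cmeasM; first by apply: (cmeas_comp Fi.1); exact: measurable_fst.
  exact: (cmeas_comp mG me).
have A y : (\int[lam']_x (cabs (H y x))%:E <= (cabs (F y) * M)%:E)%E.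
  have [Gi GM] := b _ (ie y).
  under eq_integral do rewrite cabsM.
  rewrite (@ge0_integralZl_EFin _ _ _ lam (cabs (F y)) (fun x => cabs (G (e y x)))).
  - by rewrite EFinM; apply: lee_wpmul2l => //; rewrite lee_fin cabs_ge0.
  - by apply: measurable_cabs; case: Gi.
  - by move=> x; exact: cabs_ge0.
  - exact: cabs_ge0.
have Ai : mu.-integrable setT (fun y : T => (cabs (F y) * M)%:E).
  by under eq_fun do rewrite mulrC; apply: integrableZl_EFin; exact: cintegrable_cabs.
have [|i _ E] := @CI_fubini _ _ _ _ _ mu lam' H mH.
  exact: (@iterated_lty _ _ _ _ _ mu lam' H _ mH A Ai).
have X : (fun y => CI lam' (H y)) = (fun y : T => F y * CI lam (fun x : T => G (e y x))).
  by apply/funext => y; have [j1 _] := b _ (ie y); exact: (CIZ (F y) j1).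
by rewrite X in i E; split; [exact: i|exact: E].
Qed.

Lemma measurable_add2 : measurable_fun setT (fun z : T * T => (z.2 : Rn) + (z.1 : Rn) : T).
Proof. by apply: measurable_addrv; [exact: measurable_snd|exact: measurable_fst]. Qed.

Lemma measurable_sub2 : measurable_fun setT (fun z : T * T => (z.1 : Rn) - (z.2 : Rn) : T).
Proof. by apply: measurable_subrv; [exact: measurable_fst|exact: measurable_snd]. Qed.

(** The substitution [u = x + y] is possible only in the Lebesgue variable, since [lam] need not be
    invariant. Both sides are therefore brought by Fubini to the form with [lam] outside. *)
Lemma conv_swap1 (lam : {measure set T -> \bar R}) (F1 F2 : T -> C) (B : R) : cube_bounded lam ->
  cintegrable mu F1 -> cintegrable mu F2 -> dominated F1 -> dominated F2 -> (forall x, cabs (F1 x) <= B) ->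
  [/\ cintegrable mu (fun y : T => F1 y * CI lam (fun x : T => F2 ((x : Rn) + (y : Rn)))),
      cintegrable mu (fun u : T => F2 u * CI lam (fun x : T => F1 ((u : Rn) - (x : Rn)))) &
   CI mu (fun y : T => F1 y * CI lam (fun x : T => F2 ((x : Rn) + (y : Rn)))) =
   CI mu (fun u : T => F2 u * CI lam (fun x : T => F1 ((u : Rn) - (x : Rn))))].
Proof.
move=> tb F1i F2i d1 d2 FB; have mF1 := F1i.1; have mF2 := F2i.1.
have [i1 e1] := half_swap (e := fun y x => x + y) tb F1i mF2 d2 measurable_add2 (@iso_map_translate R n).
have [i2 e2] := half_swap (e := fun u x => u - x) tb F2i mF1 d1 measurable_sub2 (@iso_map_reflect R n).
split; [exact: i1|exact: i2|].
apply: eq_trans e1 _; apply: eq_trans _ (esym e2); apply: eq_CI => x.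
have gi : cintegrable mu (fun u : T => F2 u * F1 ((u : Rn) - (x : Rn))).
  apply: (cintegrableM_bdd (M := B)) => //.
  by apply: (cmeas_comp mF1); apply: measurable_subrv; [exact: measurable_id|exact: measurable_cst].
have [_ E] := CI_translate x gi; apply: eq_trans E.
by apply: eq_CI => y; rewrite addrK mulrC addrC.
Qed.

Lemma conv_swap (m : nat -> {measure set T -> \bar R}) (F1 F2 : T -> C) (B : R) : (forall j, cube_bounded (m j)) ->
  cintegrable mu F1 -> cintegrable mu F2 -> dominated F1 -> dominated F2 -> (forall x, cabs (F1 x) <= B) ->
  CI mu (fun y : T => F1 y * cpI m (fun x : T => F2 ((x : Rn) + (y : Rn)))) =
  CI mu (fun u : T => F2 u * cpI m (fun x : T => F1 ((u : Rn) - (x : Rn)))).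
Proof.
move=> tb F1i F2i d1 d2 FB.
have sw j := conv_swap1 (tb j) F1i F2i d1 d2 FB.
transitivity (CI mu (fun y : T => \sum_(j < 4) cf j * (F1 y * CI (m j) (fun x : T => F2 ((x : Rn) + (y : Rn)))))).
  by apply: eq_CI => y; rewrite mulr_sumr; apply: eq_bigr => j _; rewrite mulrCA.
transitivity (CI mu (fun u : T => \sum_(j < 4) cf j * (F2 u * CI (m j) (fun x : T => F1 ((u : Rn) - (x : Rn)))))); last first.
  by apply: eq_CI => y; rewrite mulr_sumr; apply: eq_bigr => j _; rewrite mulrCA.
have [|_ ->] := @CI_sum _ _ _ mu _ (index_enum 'I_4) (fun (j : 'I_4) (y : T) => cf j * (F1 y * CI (m j) (fun x : T => F2 ((x : Rn) + (y : Rn))))).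
  by move=> j; case: (sw j) => h _ _; apply: cintegrableZ; exact h.
have [|_ ->] := @CI_sum _ _ _ mu _ (index_enum 'I_4) (fun (j : 'I_4) (u : T) => cf j * (F2 u * CI (m j) (fun x : T => F1 ((u : Rn) - (x : Rn))))).
  by move=> j; case: (sw j) => _ h _; apply: cintegrableZ; exact h.
by apply: eq_bigr => j _; have [j1 j2 j3] := sw j; rewrite (CIZ _ j1) (CIZ _ j2) j3.
Qed.

Lemma ccvg_sum (I : Type) (s : seq I) (u : I -> nat -> C) (l : I -> C) : (forall i, ccvg (u i) (l i)) ->
  ccvg (fun k => \sum_(i <- s) u i k) (\sum_(i <- s) l i).
Proof.
move=> h; elim: s => [|a s IH].
  by rewrite big_nil; apply: (ccvg_ext (u := fun=> 0)) => [k|]; [rewrite big_nil|exact: ccvg_cst].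
rewrite big_cons; apply: (ccvg_ext (u := fun k => u a k + \sum_(i <- s) u i k)).
  by move=> k; rewrite big_cons.
exact: ccvgD.
Qed.

Lemma ccvg_shift (u : nat -> C) l N : ccvg (fun k => u (k + N)%N) l -> ccvg u l.
Proof. by rewrite /ccvg => h; rewrite -(cvg_shiftn N). Qed.

Lemma cp_fubini (m : nat -> {measure set T -> \bar R}) (F1 F2 : T -> C) : (forall j, cube_bounded (m j)) ->
  cmeas F1 -> cintegrable mu F2 -> dominated F1 ->
  CI mu (fun u : T => F2 u * cpI m (fun x : T => F1 ((u : Rn) - (x : Rn)))) =
  cpI m (fun x : T => CI mu (fun u : T => F2 u * F1 ((u : Rn) - (x : Rn)))).
Proof.
move=> tb mF1 F2i d1.
have sw j := half_swap (e := fun u x => u - x) (tb j) F2i mF1 d1 measurable_sub2 (@iso_map_reflect R n).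
transitivity (CI mu (fun u : T => \sum_(j < 4) cf j * (F2 u * CI (m j) (fun x : T => F1 ((u : Rn) - (x : Rn)))))).
  by apply: eq_CI => y; rewrite mulr_sumr; apply: eq_bigr => j _; rewrite mulrCA.
have [|_ ->] := @CI_sum _ _ _ mu _ (index_enum 'I_4) (fun (j : 'I_4) (u : T) => cf j * (F2 u * CI (m j) (fun x : T => F1 ((u : Rn) - (x : Rn))))).
  by move=> j; case: (sw j) => h _; apply: cintegrableZ; exact h.
by apply: eq_bigr => j _; have [h E] := sw j; rewrite (CIZ _ h) E.
Qed.

Lemma translate_bounded (m : nat -> {measure set T -> \bar R}) (F : Rn -> C) : (forall j, cube_bounded (m j)) ->
  cmeas (F : T -> C) -> dominated F ->
  cmeas (fun u : T => cpI m (fun x : T => F ((u : Rn) - (x : Rn)))) /\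
  exists M : R, forall u : T, cabs (cpI m (fun x : T => F ((u : Rn) - (x : Rn)))) <= M.
Proof.
move=> tb mF dF.
have db j := dominated_bound (tb j) mF dF.
split.
- apply: cmeas_sum => j; apply: cmeasM; first exact: cmeas_cst.
  have sf := locfin_sigma_finite (cube_bounded_locfin (tb j)); pose lam' := to_sigma_finite sf.
  apply: (@measurable_CI2 _ _ _ _ _ lam' (fun u x : T => F ((u : Rn) - (x : Rn)))).
    by apply: (cmeas_comp mF); exact: measurable_sub2.
  by move=> u; have [M [_ MP]] := db j; have [] := MP _ (iso_map_reflect u).
have [M MP] := fchoice db.
exists (\sum_(j < 4) M j) => u; apply: le_trans (cabs_sum _ _ _) _; apply: ler_sum => j _.
have [_ h] := MP j; have [i1 i2] := h _ (iso_map_reflect u).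
rewrite cabsM cabs_cf mul1r; apply: le_trans (cabs_CI i1) _.
by rewrite -lee_fin -(cintegrable_EFin i1).
Qed.

Lemma translate_props (m : nat -> {measure set T -> \bar R}) (F : Rn -> C) : (forall j, cube_bounded (m j)) ->
  ccontinuous F -> dominated F ->
  [/\ cmeas (fun u : T => cpI m (fun x : T => F ((u : Rn) - (x : Rn)))),
      exists M : R, forall u : T, cabs (cpI m (fun x : T => F ((u : Rn) - (x : Rn)))) <= M &
      forall u : Rn, ccvg (fun k => cpI m (fun x : T => F (k.+1%:R^-1 *: u - (x : Rn)))) (cpI m (fun x : T => F (0 - (x : Rn))))].
Proof.
move=> tb cF dF; have mF := ccontinuous_cmeas cF.
have [h1 h2] := translate_bounded tb mF dF; split; [exact: h1|exact: h2|].
move=> u; apply: ccvg_sum => j; apply: ccvgM; first exact: ccvg_cst.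
have [D [mD D0 FD Dl]] := dF; have [M [M0 MP]] := Dl _ (tb j).
have [i1 _] := MP _ (iso_map_reflect 0).
(* From the index [N] on the shift [u / (k + 1)] has norm at most 1, the slack built into
   [dominated], so one function [D] dominates the whole sequence. *)
pose N := Num.bound `|u|.
apply: (@ccvg_shift _ _ N).
apply: (CI_dct (F := fun k (x : T) => F ((k + N).+1%:R^-1 *: u - (x : Rn))) (f := fun x : T => F (0 - (x : Rn))) (g := fun x : T => D (0 - (x : Rn)))) => //.
- by move=> k; apply: (cmeas_comp mF); apply: measurable_subrv; [exact: measurable_cst|exact: measurable_id].
- move=> x; apply: ccontinuous_seq => //; apply: cvgB; last exact: cvg_cst.
  by have := cvg_scale0 u; rewrite -(cvg_shiftn N).
move=> k x; rewrite sub0r (addrC _ (- _)); apply: FD.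
rewrite normrZ normfV normr_nat mulrC ler_pdivrMr// mul1r.
apply: le_trans (ltW (archi_boundP (normr_ge0 u))) _; rewrite ler_nat -/N.
by rewrite -addSn leq_addl.
Qed.

Lemma translate_limit (m : nat -> {measure set T -> \bar R}) (F : Rn -> C) (Phi : T -> C) : (forall j, cube_bounded (m j)) ->
  ccontinuous F -> dominated F -> cintegrable mu Phi ->
  ccvg (fun k => CI mu (fun u : T => Phi u * cpI m (fun x : T => F (k.+1%:R^-1 *: (u : Rn) - (x : Rn)))))
    (CI mu Phi * cpI m (fun x : T => F (- (x : Rn)))).
Proof.
move=> tb cF dF Pi; have [mJ [M JM] Jlim] := translate_props tb cF dF.
have := approx_identity Pi mJ JM Jlim.
by congr (ccvg _ (_ * _)); apply: eq_cpI => x; rewrite sub0r.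
Qed.

Lemma conv_modul (k : Rn -> C) (y t : Rn) : Cc k ->
  conv (fun s => expi (dotp s y) * k s) (invol (fun s => expi (dotp s y) * k s)) t =
  expi (dotp t y) * conv k (invol k) t.
Proof.
move=> ck; have nk := Cc_nice ck; have nik := nice_invol nk.
have nm : nice (fun s : T => expi (dotp (s : Rn) y) * k s).
  have e1 (x : T) : cabs (expi (dotp (x : Rn) y)) <= 1 by rewrite cabs_expi.
  have := niceM_bdd nk (cmeas_expi_dotp y) e1.
  by congr nice; apply/funext => s; rewrite mulrC.
rewrite (convE _ nm (nice_invol nm)) (convE _ nk nik) -(CIZ _ (conv_cint t nk nik)).
apply: eq_CI => s; rewrite /invol cconjM conj_expi opprB dotpBl mulrACA -expiD.
by rewrite subKr.
Qed.

Lemma conv_dilate (k : Rn -> C) (a : R) (t : Rn) : 0 < a -> Cc k ->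
  conv (fun s => k (a *: s)) (invol (fun s => k (a *: s))) t = rC (a ^- n) * conv k (invol k) (a *: t).
Proof.
move=> a0 ck; have an0 : a != 0 by rewrite gt_eqF.
have nk := Cc_nice ck; have nik := nice_invol nk.
have cka : Cc (fun s => k (a *: s)).
  by have := Cc_affine 0 an0 ck; congr Cc; apply/funext => s; rewrite addr0.
have nka := Cc_nice cka.
rewrite (convE _ nka (nice_invol nka)) (convE _ nk nik).
have [_ ->] := CI_affine 0 an0 (conv_cint (a *: t) nk nik).
rewrite gtr0_norm// mulrA -rCM mulVf ?expf_neq0// rC1 mul1r; apply: eq_CI => s.
by rewrite addr0 /invol -!scalerBr -scalerN.
Qed.

Lemma FT_swap (f g : T -> C) : cintegrable mu f -> cintegrable mu g ->
  CI mu (fun t => f t * FT g t) = CI mu (fun y => g y * FT f y).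
Proof.
move=> fi gi.
pose F := fun t y : T => f t * (expi (dotp (y : Rn) (t : Rn)) * g y).
have mF : cmeas (fun z : T * T => F z.1 z.2).
  apply: cmeasM; first by apply: (cmeas_comp fi.1); exact: measurable_fst.
  apply: cmeasM; last by apply: (cmeas_comp gi.1); exact: measurable_snd.
  by apply: cmeas_expi; apply: measurable_dotp; [exact: measurable_snd|exact: measurable_fst].
have [|_ _ FF] := @CI_fubini _ _ _ _ _ mu mu F mF.
  apply: (@iterated_lty _ _ _ _ _ mu mu F (fun t : T => cabs (f t) * \int[mu]_y cabs (g y)) mF).
    move=> t; rewrite /F; under eq_integral do rewrite cabsM cabsM cabs_expi mul1r.
    rewrite (@ge0_integralZl_EFin _ _ _ mu (cabs (f t)) (fun x => cabs (g x))).
    - by rewrite (cintegrable_EFin gi).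
    - by apply: measurable_cabs; case: gi.
    - by move=> x; exact: cabs_ge0.
    - exact: cabs_ge0.
  by under eq_fun do rewrite mulrC; apply: integrableZl_EFin; exact: cintegrable_cabs.
transitivity (CI mu (fun t => CI mu (F t))); first by apply: eq_CI => t; rewrite /F (CIZ _ (FT_cint _ gi)).
rewrite FF; apply: eq_CI => y; rewrite /FT -(CIZ _ (FT_cint _ fi)); apply: eq_CI => t.
by rewrite /F (dotpC y) mulrA mulrC (mulrC (f t)).
Qed.
End components.

(** * From a transformable density to its associated measure *)

Section identity.
Variables (R : realType) (n : nat).
Local Notation Rn := 'rV[R]_n.
Local Notation T := (BorelRd R n).
Local Notation C := R[i].
Local Notation mu := (@leb R n).
Local Notation c2 := (twopid R n).

(** The power spectrum of [h]: the transform of its autocorrelation, by [FT_conv_invol]. *)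
Definition specF (h : Rn -> C) (x : Rn) : C := rC (cabs (FT h x) ^+ 2).

Lemma specF_checkF h x : cintegrable mu h -> rC (cabs (checkF h x) ^+ 2) = rC (c2 ^+ 2) * specF h x.
Proof.
by move=> hi; rewrite (checkF_FT _ hi) cabsM cabs_rC (gtr0_norm (@twopid_gt0 R n)) exprMn rCM.
Qed.

Lemma specF_dilate h (a : R) x : 0 < a -> cintegrable mu h ->
  specF (fun t => h (a *: t)) x = rC (a ^- n) ^+ 2 * specF h (a^-1 *: x).
Proof.
move=> a0 hi; rewrite /specF (FT_dilate _ a0 hi) cabsM cabs_rC ger0_norm ?exprMn ?rCM ?rCX//.
by rewrite invr_ge0 exprn_ge0// ltW.
Qed.

Lemma specF_dominated h : Cc h -> dominated (specF h).
Proof. exact: FT_sqr_dominated. Qed.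

Lemma specF_ccontinuous h : cintegrable mu h -> ccontinuous (specF h).
Proof.
move=> hi; apply: seq_ccontinuous => u x ux; apply/ccvgP; split => /=; last exact: cvg_cst.
have h1 := ccvg_cabs (ccontinuous_seq (FT_continuous hi) ux).
by rewrite expr2; under eq_fun do rewrite expr2; exact: cvgM.
Qed.

Lemma specF_bounded h : cintegrable mu h -> exists M : R, forall x, cabs (specF h x) <= M.
Proof.
move=> hi; exists ((\int[mu]_x cabs (h x)) ^+ 2) => x.
rewrite cabs_rC ger0_norm ?sqr_ge0// ler_pXn2r ?nnegrE ?cabs_ge0 ?FT_le//.
by apply: Rintegral_ge0 => y _; exact: cabs_ge0.
Qed.

Lemma specF_cintegrable h : Cc h -> cintegrable mu (specF h).
Proof. by move=> ch; have [c0 [_ /(_ h ch)[h2 _]]] := inversion R n; exact: cintegrable_rC. Qed.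

Lemma specF_modul h y x : specF (fun s => expi (dotp s y) * h s) x = specF h (x + y).
Proof. by rewrite /specF -FT_modul. Qed.

(** Were the autocorrelation of a bump 0 at the origin, [inversion] at [t = 0] would make [|FT k|^2]
    have integral 0, although it is bounded below on a cube. *)
Lemma ex_test : exists k : Rn -> C, Cc k /\ conv k (invol k) 0 != 0.
Proof.
have [k [c [ck c0 kr]]] := @ex_bump R n 1 ltr01.
exists k; split => //; apply/negP => /eqP Q0.
have [c1 [c10 /(_ k ck)[I /(_ 0)]]] := inversion R n.
rewrite Q0 mulr0 (_ : CI _ _ = rC (\int[mu]_x (cabs (FT k x) ^+ 2))); last first.
  by rewrite -CI_rC; apply: eq_CI => x; rewrite dotp0r oppr0 expi0 mul1r.
move=> /(@rC_inj R _ 0) I0.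
have i1 : mu.-integrable setT (fun x : T => (c ^+ 2 * \1_(cube 0 1) (x : Rn))%:E).
  by apply: integrable_cube; exact: leb_locfin.
have : \int[mu]_x (c ^+ 2 * \1_(cube 0 1) (x : Rn)) <= \int[mu]_x (cabs (FT k x) ^+ 2).
  apply: le_Rintegral => // x _; rewrite indicE.
  have [|_] := boolP (_ \in _); last by rewrite mulr0 sqr_ge0.
  by rewrite inE /cube /= subr0 mulr1 => xr; rewrite ler_pXn2r ?nnegrE ?cabs_ge0 ?(ltW c0) ?kr.
rewrite I0 RintegralZl_T; last by apply: integrable_indic_lty; [exact: measurable_cube|exact: leb_cube].
rewrite leNgt => /negP; apply; rewrite mulr_gt0 ?exprn_gt0// /Rintegral integral_indic//; last exact: measurable_cube.
rewrite setIT fine_gt0// leb_cube_gt0//=; exact: leb_cube.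
Qed.

Lemma spec_integral : exists c0 : R, 0 < c0 /\ forall h : Rn -> C, Cc h ->
  forall t, FT (specF h) (- t) = rC c0 * conv h (invol h) t.
Proof.
have [c0 [c00 h]] := inversion R n; exists c0; split => // k ck t.
by have [_ /(_ t) <-] := h k ck; apply: eq_CI => x; rewrite dotpNr.
Qed.

Lemma FT0 (h : T -> C) : FT h 0 = CI mu h.
Proof. by apply: eq_CI => x; rewrite dotp0r expi0 mul1r. Qed.

Lemma nice_auto (h : Rn -> C) : Cc h -> nice (conv h (invol h)).
Proof. by move=> ch; have nh := Cc_nice ch; apply: nice_conv => //; exact: nice_invol. Qed.

Lemma Cc_auto (h : Rn -> C) : Cc h -> Cc (conv h (invol h)).
Proof. by move=> ch; apply: conv_Cc => //; apply: nice_invol; exact: Cc_nice. Qed.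

Lemma Cc_dilate (h : Rn -> C) (a : R) : 0 < a -> Cc h -> Cc (fun t => h (a *: t)).
Proof.
move=> a0 ch; have an0 : a != 0 by rewrite gt_eqF.
by have := Cc_affine 0 an0 ch; congr Cc; apply/funext => s; rewrite addr0.
Qed.

Lemma Cb_cmeas (phi : Rn -> C) : Cb phi -> cmeas (phi : T -> C).
Proof. by case=> c _; exact: ccontinuous_cmeas. Qed.

Lemma niceM_Cb (f phi : Rn -> C) : nice f -> Cb phi -> nice (fun t => f t * phi t).
Proof. by move=> nf cb; have [_ [M h]] := cb; apply: niceM_bdd h => //; exact: Cb_cmeas. Qed.

(** * The identity for a transformable density *)

Section forward.
Variables (phi : Rn -> C) (m : nat -> {measure set T -> \bar R}) (c : R).
Hypotheses (bphi : Cb phi) (tb : forall j, cube_bounded (m j)).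
Hypothesis hyp : forall h : Rn -> C, Cc h ->
  CI mu (fun t : T => conv h (invol h) t * phi t) = rC c * cpI m (specF h).

Lemma forward_modul (k : Rn -> C) (y : Rn) : Cc k ->
  FT (fun t => conv k (invol k) t * phi t) y = rC c * cpI m (fun x : T => specF k ((x : Rn) + y)).
Proof.
move=> ck; have cm : Cc (fun s => expi (dotp s y) * k s).
  have := Cc_mul ck (ccontinuous_expi y 1); congr Cc.
  by apply/funext => s; rewrite mul1r mulrC.
transitivity (CI mu (fun t : T => conv (fun s => expi (dotp s y) * k s) (invol (fun s => expi (dotp s y) * k s)) t * phi t)).
  by apply: eq_CI => t; rewrite conv_modul// mulrA.
have -> : (fun x : T => specF k ((x : Rn) + y)) = specF (fun s => expi (dotp s y) * k s).
  by apply/funext => x; rewrite specF_modul.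
exact: (hyp cm).
Qed.

(** The identity with a cut-off. On the side of [phi] the dilated autocorrelation keeps the integral
    in a bounded region, and on the side of the measure it becomes an average of translates of [G]
    with weight [specF k]. *)
Lemma forward_scaled (k G : Rn -> C) (a : R) : 0 < a -> Cc k -> Cc G ->
  CI mu (fun t : T => (phi t * FT G t) * conv k (invol k) (a *: (t : Rn))) =
  rC c * CI mu (fun u : T => specF k u * cpI m (fun x : T => G (a *: (u : Rn) - (x : Rn)))).
Proof.
move=> a0 ck cG; have an0 : a != 0 by rewrite gt_eqF.
have cka := Cc_dilate a0 ck; have Gi := nice_leb (Cc_nice cG); have ki := nice_leb (Cc_nice ck).
set ka := fun t => k (a *: t) in cka.
(* Both sides are multiplied by the factor that [conv_dilate] produces. *)
have n0 : rC (a ^- n) != 0 by rewrite rC_eq0 invr_eq0 expf_neq0.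
apply: (mulfI n0).
have Qi := nice_leb (niceM_Cb (nice_auto cka) bphi).
transitivity (CI mu (fun t => (conv ka (invol ka) t * phi t) * FT G t)).
  have [_ [Mp phiM]] := bphi.
  have Pi : cintegrable mu (fun t : T => (phi t * FT G t) * conv k (invol k) (a *: (t : Rn))).
    have nQa := Cc_nice (Cc_dilate a0 (Cc_auto ck)).
    have := cintegrableM_bdd (nice_leb (niceM_Cb nQa bphi)) (FT_cmeas Gi) (fun x => FT_le x Gi).
    by congr cintegrable; apply/funext => t; rewrite -mulrA mulrC.
  rewrite -(CIZ _ Pi); apply: eq_CI => t; rewrite (conv_dilate _ a0 ck).
  by rewrite (mulrC (phi t * _)) mulrA mulrA.
rewrite (FT_swap Qi Gi).
transitivity (CI mu (fun y : T => rC c * (G y * cpI m (fun x : T => specF ka ((x : Rn) + (y : Rn)))))).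
  by apply: eq_CI => y; rewrite forward_modul// mulrCA.
have [B [B0 GB]] := Cc_bounded cG.
have dG := nice_dominated (Cc_nice cG); have dS := specF_dominated cka.
have cpi : cintegrable mu (fun y : T => G y * cpI m (fun x : T => specF ka ((x : Rn) + (y : Rn)))).
  have := @CI_sum _ _ _ mu _ (index_enum 'I_4) (fun (j : 'I_4) (y : T) => cf R j * (G y * CI (m j) (fun x : T => specF ka ((x : Rn) + (y : Rn))))).
  case=> [j|h _].
    by have [h _ _] := conv_swap1 (tb j) Gi (specF_cintegrable cka) dG dS GB; apply: cintegrableZ; exact h.
  move: h; congr cintegrable; apply/funext => y; rewrite mulr_sumr; apply: eq_bigr => j _; by rewrite mulrCA.
rewrite (CIZ _ cpi) (conv_swap tb Gi (specF_cintegrable cka) dG dS GB) mulrCA; congr (_ * _).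
have [mJ [M JM] _] := translate_props tb cG.1 dG.
have SJi := cintegrableM_bdd (specF_cintegrable cka) mJ JM.
have SJi' : cintegrable mu (fun u : T => specF k u * cpI m (fun x : T => G (a *: (u : Rn) - (x : Rn)))).
  apply: (cintegrableM_bdd (M := M) (specF_cintegrable ck)) => [|x]; last exact: JM.
  apply: (cmeas_comp mJ (g := fun u : T => a *: (u : Rn) : T)); exact: measurable_scalev.
have [_ ->] := CI_affine 0 an0 SJi.
rewrite (gtr0_norm a0) -(CIZ (rC (a ^- n)) SJi').
have [SJa _] := CI_affine 0 an0 SJi; rewrite -(CIZ (rC (a ^+ n)) SJa).
(* The spectrum of the dilated function carries [a^(-2n)] and the substitution [a^n], which leaves
   the factor [a^(-n)] of the left side. *)
apply: eq_CI => u; rewrite addr0 specF_dilate// scalerA (mulVf an0) scale1r.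
have e1 : rC (a ^+ n) * rC (a ^- n) = 1 by rewrite -rCM mulfV ?rC1 ?expf_neq0.
by rewrite expr2 !mulrA e1 mul1r.
Qed.

(** Let [a = 1 / (j + 1)] tend to 0 in [forward_scaled]. With [Q] the autocorrelation of [k], the
    left side tends to [Q 0] times the integral sought, and on the right the mass of [specF k] comes
    out, which is [c0 Q 0]; then [Q 0] cancels. *)
Lemma forward_identity : exists c0 : R, 0 < c0 /\ forall G : Rn -> C, Cc G -> cintegrable mu (FT G) ->
  CI mu (fun t : T => phi t * FT G t) = rC (c * c0) * cpI m (fun x : T => G (- (x : Rn))).
Proof.
have [c0 [c00 cP]] := spec_integral; exists c0; split => // G cG FGi.
have [k [ck k0]] := ex_test.
have dG := nice_dominated (Cc_nice cG).
have Si := specF_cintegrable ck.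
have lim2 := ccvgM (ccvg_cst (rC c)) (translate_limit tb cG.1 dG Si).
have nQ := nice_auto ck; have [mQ [M [_ QM]] _] := nQ.
have Pi : cintegrable mu (fun t : T => phi t * FT G t).
  have [_ [Mp phiM]] := bphi; have := cintegrableM_bdd FGi (Cb_cmeas bphi) phiM.
  by congr cintegrable; apply/funext => t; rewrite mulrC.
have lim1 := approx_identity Pi mQ QM.
have := lim1 (fun u => ccontinuous_seq (Cc_auto ck).1 (cvg_scale0 u)) => {}lim1.
have := ccvg_unique lim1 (ccvg_ext (fun j => esym (forward_scaled (k := k) (G := G) _ ck cG)) lim2).
have -> : CI mu (specF k) = rC c0 * conv k (invol k) 0 by rewrite -cP// oppr0 FT0.
move=> h; apply: (mulIf k0); rewrite h => [|j]; last by rewrite invr_gt0.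
rewrite rCM.
by rewrite -!mulrA; congr (_ * (_ * _)); rewrite mulrC.
Qed.
End forward.
End identity.

(** * From the associated measure back to the density *)

Lemma polarize (K : comPzRingType) (I a b p q : K) : I * I = -1 ->
  (a + b) * (p + q) - (a - b) * (p - q) + I * ((a + I * b) * (p - I * q)) - I * ((a - I * b) * (p + I * q)) = 4 * (a * q).
Proof.
move=> I2.
have -> : (a + b) * (p + q) - (a - b) * (p - q) + I * ((a + I * b) * (p - I * q)) - I * ((a - I * b) * (p + I * q)) =
  2 * (a * q + b * p) + (I * I) * (2 * (b * p) - 2 * (a * q)) by ring.
by rewrite I2; ring.
Qed.

Section backward.
Variables (R : realType) (n : nat).
Local Notation Rn := 'rV[R]_n.
Local Notation T := (BorelRd R n).
Local Notation C := R[i].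
Local Notation mu := (@leb R n).

(** [p] and [q] stand for the conjugates of [a] and [b], but are independent of them: in a
    convolution the conjugated factors are taken at another point. *)
Lemma polarize_cf (a b p q : C) :
  \sum_(j < 4) cf R j * ((a + cf R j * b) * (p + cconj (cf R j) * q)) = 4 * (a * q).
Proof.
have I2 : (Complex 0 1 : C) * Complex 0 1 = -1 by apply: cplx_eq; rewrite /cre /cim /=; ring.
have cI : cconj (Complex 0 1 : C) = - Complex 0 1 by apply: cplx_eq; rewrite /cre /cim /=; ring.
have cNI : cconj (- Complex 0 1 : C) = Complex 0 1 by apply: cplx_eq; rewrite /cre /cim /=; ring.
have c1 : cconj (1 : C) = 1 by apply: cplx_eq; rewrite /cre /cim /=; ring.
have cN1 : cconj (-1 : C) = -1 by apply: cplx_eq; rewrite /cre /cim /=; ring.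
rewrite !big_ord_recr big_ord0 /= add0r cI cNI c1 cN1 -(polarize a b p q I2).
by move: (Complex 0 1) => I; ring.
Qed.

Lemma cconj_cfD (j : nat) (a b : C) : cconj (a + cf R j * b) = cconj a + cconj (cf R j) * cconj b.
Proof. by rewrite cconjD cconjM. Qed.

Lemma Cc_lin (f g : Rn -> C) (w : C) : Cc f -> Cc g -> Cc (fun t => f t + w * g t).
Proof.
move=> cf' cg; have [c1 [r1 [_ z1]]] := CcP cf'; have [c2 [r2 [_ z2]]] := CcP cg.
apply: Cc_cube.
  apply: seq_ccontinuous => u x ux; apply: ccvgD; first exact: ccontinuous_seq.
  by apply: ccvgM; [exact: ccvg_cst|exact: ccontinuous_seq].
exists (Num.max r1 r2) => x; rewrite gt_max => /andP[h1 h2].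
by rewrite z1// z2// mulr0 addr0.
Qed.

Lemma natmulC4 : (4 : C) != 0.
Proof.
have -> : (4 : C) = rC (4 : R) by apply: cplx_eq; rewrite /cre /cim /=; ring.
by rewrite rC_eq0.
Qed.

Variables (phi : Rn -> C) (m : nat -> {measure set T -> \bar R}) (c : R).
Hypotheses (bphi : Cb phi) (tb : forall j, cube_bounded (m j)).
Hypothesis hyp : forall h : Rn -> C, Cc h ->
  cpI m (conv h (invol h)) = rC c * CI mu (fun t : T => specF h t * phi t).

Lemma cpI_sum (I : finType) (F : I -> T -> C) (w : I -> C) : (forall j i, cintegrable (m j) (F i)) ->
  cpI m (fun x => \sum_i w i * F i x) = \sum_i w i * cpI m (F i).
Proof.
move=> Fi; rewrite /cpI.
transitivity (\sum_(j < 4) \sum_i cf R j * (w i * CI (m j) (F i))).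
  apply: eq_bigr => j _; rewrite -mulr_sumr; congr (_ * _).
  have [|_ ->] := @CI_sum _ _ _ (m j) _ (index_enum I) (fun i x => w i * F i x).
    by move=> i; exact: cintegrableZ.
  by apply: eq_bigr => i _; rewrite (CIZ _ (Fi j i)).
rewrite exchange_big; apply: eq_bigr => i _; rewrite mulr_sumr; apply: eq_bigr => j _; exact: mulrCA.
Qed.

(** Both sides of [hyp] are quadratic in [h]; it is applied to the four functions [f + cf j g]. *)
Lemma polarized (f g : Rn -> C) : Cc f -> Cc g ->
  cpI m (conv f (invol g)) = rC c * CI mu (fun t : T => (FT f t * cconj (FT g t)) * phi t).
Proof.
move=> cf' cg; apply: (mulfI natmulC4).
have nf := Cc_nice cf'; have ng := Cc_nice cg.
pose h (j : 'I_4) := fun t => f t + cf R j * g t.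
have ch j : Cc (h j) by exact: Cc_lin.
have nQ j := nice_auto (ch j).
have E1 x : 4 * conv f (invol g) x = \sum_(j < 4) cf R j * conv (h j) (invol (h j)) x.
  rewrite (convE _ nf (nice_invol ng)) -(CIZ _ (conv_cint x nf (nice_invol ng))).
  have ci j := conv_cint x (Cc_nice (ch j)) (nice_invol (Cc_nice (ch j))).
  transitivity (CI mu (fun s : T => \sum_(j < 4) cf R j * (h j s * invol (h j) (x - (s : Rn))))).
    by apply: eq_CI => s; rewrite -(polarize_cf _ (g s) (cconj (f (- (x - (s : Rn)))))); apply: eq_bigr => j _; rewrite /h /invol cconj_cfD.
  have [|_ ->] := @CI_sum _ _ _ mu _ (index_enum 'I_4) (fun (j : 'I_4) (s : T) => cf R j * (h j s * invol (h j) (x - (s : Rn)))).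
    by move=> j; apply: cintegrableZ; exact: ci.
  by apply: eq_bigr => j _; rewrite (CIZ _ (ci j)) (convE _ (Cc_nice (ch j)) (nice_invol (Cc_nice (ch j)))).
have Qi j x : cintegrable (m j) (conv (h x) (invol (h x))).
  by apply: nice_cintegrable (nQ x); exact: cube_bounded_locfin.
have fgi j : cintegrable (m j) (conv f (invol g)).
  by apply: nice_cintegrable; [exact: cube_bounded_locfin|apply: nice_conv => //; exact: nice_invol].
rewrite -(cpIZ 4 fgi) (eq_cpI m E1) (cpI_sum _ Qi).
have fi := nice_leb nf; have gi := nice_leb ng.
have Fh j t : FT (h j) t = FT f t + cf R j * FT g t.
  have j1 := cintegrableZ (cf R j) gi.
  rewrite /FT -(CIZ _ (FT_cint t gi)) -(CID (FT_cint t fi) (cintegrableZ _ (FT_cint t gi))).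
  by apply: eq_CI => s; rewrite /h mulrDr mulrCA.
have [_ [M phiM]] := bphi.
have Si j : cintegrable mu (fun t : T => specF (h j) t * phi t).
  exact: (cintegrableM_bdd (specF_cintegrable (ch j)) (Cb_cmeas bphi) phiM).
transitivity (rC c * \sum_(j < 4) cf R j * CI mu (fun t : T => specF (h j) t * phi t)).
  by rewrite mulr_sumr; apply: eq_bigr => j _; rewrite (hyp (ch j)) mulrCA.
rewrite mulrCA; congr (_ * _).
have [|_] := @CI_sum _ _ _ mu _ (index_enum 'I_4) (fun (j : 'I_4) (t : T) => cf R j * (specF (h j) t * phi t)).
  by move=> j; apply: cintegrableZ; exact: Si.
have -> : \sum_(j < 4) CI mu (fun t : T => cf R j * (specF (h j) t * phi t)) =
  \sum_(j < 4) cf R j * CI mu (fun t : T => specF (h j) t * phi t).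
  by apply: eq_bigr => j _; rewrite (CIZ _ (Si j)).
move=> <-.
(* Integrability also comes from polarization, the mixed term being a quarter of a sum of integrable
   spectra times [phi]. *)
have FGi : cintegrable mu (fun t : T => FT f t * cconj (FT g t) * phi t).
  have n4 : rC (4^-1 : R) * 4 = 1 :> C.
    have -> : (4 : C) = rC (4 : R) by apply: cplx_eq; rewrite /cre /cim /=; ring.
    by rewrite -rCM mulVf ?rC1.
  have [|si _] := @CI_sum _ _ _ mu _ (index_enum 'I_4) (fun (j : 'I_4) (t : T) => cf R j * (specF (h j) t * phi t)).
    by move=> j; apply: cintegrableZ; exact: Si.
  have := cintegrableZ (rC 4^-1) si; congr cintegrable; apply/funext => t.
  transitivity (rC (4^-1 : R) * (4 * (FT f t * cconj (FT g t))) * phi t); last by rewrite mulrA n4 mul1r.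
  rewrite -(polarize_cf _ (FT g t) (cconj (FT f t))) -mulrA mulr_suml; congr (_ * _).
  by apply: eq_bigr => j _; rewrite /specF -mul_cconj Fh cconj_cfD mulrA.
rewrite -(CIZ _ FGi); apply: eq_CI => t.
rewrite mulrA -(polarize_cf _ (FT g t) (cconj (FT f t))) mulr_suml.
by apply: eq_bigr => j _; rewrite /specF -mul_cconj Fh cconj_cfD mulrA.
Qed.

(** Translating [h] in both factors leaves its autocorrelation unchanged, so only one factor is
    translated. The result is a mixed convolution, whence polarization, and its spectrum is that of
    [h] times a character. *)
Lemma backward_translate (h : Rn -> C) (y : Rn) : Cc h ->
  cpI m (fun x : T => conv h (invol h) ((x : Rn) + y)) = rC c * FT (fun t => specF h t * phi t) (- y).
Proof.
move=> ch; have chy : Cc (fun s => h (s + y)).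
  have := Cc_affine y (oner_neq0 R) ch; congr Cc; apply/funext => s; by rewrite scale1r.
have nh := Cc_nice ch; have nih := nice_invol nh; have nhy := Cc_nice chy.
have E x : conv (fun s => h (s + y)) (invol h) x = conv h (invol h) (x + y).
  rewrite (convE _ nhy nih) (convE _ nh nih).
  have [_ <-] := CI_translate y (conv_cint (x + y) nh nih).
  by apply: eq_CI => s; rewrite opprD addrACA subrr addr0.
rewrite -(eq_cpI m E) (polarized chy ch); congr (_ * _); apply: eq_CI => t.
rewrite (FT_translate _ _ (nice_leb nh)) /specF -mul_cconj dotpNr (dotpC t).
by rewrite -!mulrA.
Qed.

(** Here [k] stays fixed and [h] is dilated. For small [a] the left side averages over small
    translates of [specF k], while on the right the factor [specF h (a t)] tends to a constant on
    the support of the autocorrelation of [k]. *)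
Lemma backward_scaled (h k : Rn -> C) (a : R) : 0 < a -> Cc h -> Cc k ->
  forall c0 : R, (forall t, FT (specF k) (- t) = rC c0 * conv k (invol k) t) ->
  CI mu (fun u : T => conv h (invol h) u * cpI m (fun x : T => specF k (a *: (u : Rn) - (x : Rn)))) =
  rC (c * c0) * CI mu (fun t : T => (conv k (invol k) t * phi t) * specF h (a *: (t : Rn))).
Proof.
move=> a0 ch ck c0 c0P; have an0 : a != 0 by rewrite gt_eqF.
have b0 : 0 < a^-1 by rewrite invr_gt0.
have bn0 : a^-1 != 0 by rewrite gt_eqF.
have chb := Cc_dilate b0 ch; have hi := nice_leb (Cc_nice ch); have ki := nice_leb (Cc_nice ck).
set hb := fun t => h (a^-1 *: t) in chb.
(* On the left one [a^n] comes from dilating the autocorrelation and one from the substitution; on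
   the right both come from the dilated spectrum. *)
have n0 : rC (a ^+ n) ^+ 2 != 0 by rewrite expf_neq0// rC_eq0 expf_neq0.
have aV : a^-1 ^- n = a ^+ n by rewrite exprVn invrK.
apply: (mulfI n0).
have [_ [Mp phiM]] := bphi.
have SFi : cintegrable mu (fun t : T => specF hb t * phi t).
  exact: (cintegrableM_bdd (specF_cintegrable chb) (Cb_cmeas bphi) phiM).
have [B SB] := specF_bounded ki.
have dS := specF_dominated ck; have dQ := nice_dominated (nice_auto chb).
have Si := specF_cintegrable ck; have Qbi := nice_leb (nice_auto chb).
transitivity (CI mu (fun u : T => conv hb (invol hb) u * cpI m (fun x : T => specF k ((u : Rn) - (x : Rn))))).
  have [mJ [M JM] _] := translate_props tb (specF_ccontinuous ki) dS.
  have [J1 J1E] := CI_affine 0 an0 (cintegrableM_bdd Qbi mJ JM).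
  apply: eq_trans (esym J1E).
  have J2 : cintegrable mu (fun u : T => conv h (invol h) u * cpI m (fun x : T => specF k (a *: (u : Rn) - (x : Rn)))).
    apply: (cintegrableM_bdd (M := M) (nice_leb (nice_auto ch))) => [|x]; last exact: JM.
    apply: (cmeas_comp mJ (g := fun u : T => a *: (u : Rn) : T)); exact: measurable_scalev.
  rewrite (gtr0_norm a0) -(CIZ (rC (a ^+ n)) J1) -(CIZ (rC (a ^+ n) ^+ 2) J2).
  apply: eq_CI => u; rewrite addr0 (conv_dilate _ b0 ch) aV scalerA (mulVf an0) scale1r.
  by rewrite expr2 !mulrA.
rewrite -(conv_swap tb Si Qbi dS dQ SB).
transitivity (CI mu (fun y : T => rC c * (specF k y * FT (fun t => specF hb t * phi t) (- (y : Rn))))).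
  by apply: eq_CI => y; rewrite backward_translate// mulrCA.
have FSb x := FT_le x SFi.
have FSm : cmeas (fun y : T => FT (fun t => specF hb t * phi t) (- (y : Rn))).
  by apply: (cmeas_comp (FT_cmeas SFi)); apply: measurable_oppv; exact: measurable_id.
have Xi : cintegrable mu (fun y : T => specF k y * FT (fun t => specF hb t * phi t) (- (y : Rn))).
  by apply: (cintegrableM_bdd Si FSm) => y; exact: FSb.
rewrite (CIZ _ Xi).
have [_ <-] := CI_reflect 0 Xi.
have [Sri _] := CI_reflect 0 Si.
have -> : CI mu (fun y : T => specF k (0 - (y : Rn)) * FT (fun t => specF hb t * phi t) (- (0 - (y : Rn)))) =
  CI mu (fun y : T => specF k (0 - (y : Rn)) * FT (fun t => specF hb t * phi t) y).
  by apply: eq_CI => y; rewrite sub0r opprK.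
rewrite (FT_swap Sri SFi).
have FR t : FT (fun y : T => specF k (0 - (y : Rn))) t = rC c0 * conv k (invol k) t.
  rewrite -c0P; have [_ E] := CI_reflect 0 (FT_cint (- t) Si).
  apply: eq_trans E.
  by apply: eq_CI => y; rewrite sub0r dotpNl dotpNr opprK.
have Yi : cintegrable mu (fun t : T => (conv k (invol k) t * phi t) * specF h (a *: (t : Rn))).
  have [B' SB'] := specF_bounded hi.
  apply: (cintegrableM_bdd (M := B') (nice_leb (niceM_Cb (nice_auto ck) bphi))) => [|x]; last exact: SB'.
  apply: (cmeas_comp (specF_cintegrable ch).1 (g := fun u : T => a *: (u : Rn) : T)); exact: measurable_scalev.
rewrite rCM mulrCA -mulrA; congr (_ * _).
rewrite mulrA -(CIZ _ Yi); apply: eq_CI => t.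
rewrite FR (specF_dilate _ b0 hi) aV invrK; move: (rC (a ^+ n) ^+ 2) => A.
by move: (specF h _) (phi _) (conv _ _ _) (rC c0) => s p q c'; ring.
Qed.

(** In the limit of [backward_scaled] the left side acquires the mass of the autocorrelation of [h]
    and the right side the factor [specF h 0]. These are equal, and nonzero for a bump. *)
Lemma backward_identity : exists c0 : R, 0 < c0 /\ forall k : Rn -> C, Cc k ->
  cpI m (fun x : T => specF k (- (x : Rn))) = rC (c * c0) * CI mu (fun t : T => conv k (invol k) t * phi t).
Proof.
have [c0 [c00 cP]] := spec_integral R n; exists c0; split => // k ck.
have [h [e [ch e0 hr]]] := @ex_bump R n 1 ltr01.
have hi := nice_leb (Cc_nice ch); have ki := nice_leb (Cc_nice ck).
have h0 : specF h 0 != 0.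
  have h1 : 0 < cabs (FT h 0) by apply: lt_le_trans e0 _; apply: hr; rewrite normr0.
  by rewrite rC_eq0 expf_neq0// gt_eqF.
have lim1 := translate_limit tb (specF_ccontinuous ki) (specF_dominated ck) (nice_leb (nice_auto ch)).
have [B SB] := specF_bounded hi.
have lim2 := approx_identity (nice_leb (niceM_Cb (nice_auto ck) bphi)) (specF_cintegrable ch).1 SB
  (fun u => ccontinuous_seq (specF_ccontinuous hi) (cvg_scale0 u)).
have lim3 := ccvgM (ccvg_cst (rC (c * c0))) lim2.
have a0 (j : nat) : 0 < (j.+1%:R^-1 : R) by rewrite invr_gt0.
have := ccvg_unique lim1 (ccvg_ext (fun j => esym (backward_scaled (a0 j) ch ck (cP k ck))) lim3).
rewrite -FT0 (FT_conv_invol _ (Cc_nice ch)) -/(specF h 0) => E.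
by apply: (mulfI h0); rewrite E [RHS]mulrCA (mulrC (specF h 0)).
Qed.
End backward.

(** * Radon measures and the Jordan decomposition *)

Lemma parts_fin (R : realType) d (X : measurableType d) (m : {measure set X -> \bar R}) (f : X -> R) : m.-integrable setT (fun x => (f x)%:E) ->
  (\int[m]_x ppart (f x) \is a fin_num)%E /\ (\int[m]_x npart (f x) \is a fin_num)%E.
Proof.
move=> fi; have mf : measurable_fun setT f by apply/measurable_EFinP; case/integrableP : fi.
have pos (g : X -> R) : measurable_fun setT g -> (forall x, 0 <= g x) -> (forall x, g x <= `|f x|) ->
    (\int[m]_x (g x)%:E \is a fin_num)%E.
  move=> mg g0 gf; apply: integrable_fin_num => //; apply: le_integrable fi => //; first exact/measurable_EFinP.
  by move=> x _; rewrite !abse_EFin lee_fin ger0_norm.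
split; apply: pos.
- by apply: measurable_maxr => //; exact: measurable_cst.
- by move=> x; rewrite le_max lexx orbT.
- by move=> x; rewrite ge_max normr_ge0 ler_norm.
- by apply: measurable_maxr; [exact: measurableT_comp|exact: measurable_cst].
- by move=> x; rewrite le_max lexx orbT.
- by move=> x; rewrite ge_max normr_ge0 -normrN ler_norm.
Qed.

Section to_finite.
Context d (X : measurableType d) (R : realType) (m : {measure set X -> \bar R}).
Definition to_finite of fin_num_fun m : set X -> \bar R := m.
Variable h : fin_num_fun m.
HB.instance Definition _ := Measure.copy (to_finite h) m.
HB.instance Definition _ := @Measure_isFinite.Build _ _ _ (to_finite h) h.
End to_finite.

Section measures.
Context (R : realType) d (X : measurableType d).
Local Notation C := R[i].

Lemma measurable_ppart (f : X -> R) : measurable_fun setT f -> measurable_fun setT (fun x => ppart (f x)).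
Proof. by move=> mf; apply/measurable_EFinP; apply: measurable_maxr => //; exact: measurable_cst. Qed.

Lemma measurable_npart (f : X -> R) : measurable_fun setT f -> measurable_fun setT (fun x => npart (f x)).
Proof. by move=> mf; apply/measurable_EFinP; apply: measurable_maxr; [exact: measurableT_comp|exact: measurable_cst]. Qed.

Lemma ppart_ge0 (r : R) : (0 <= ppart r)%E.
Proof. by rewrite lee_fin le_max lexx orbT. Qed.

Lemma npart_ge0 (r : R) : (0 <= npart r)%E.
Proof. by rewrite lee_fin le_max lexx orbT. Qed.

Lemma CI_image d' (Y : measurableType d') (m1 : {measure set X -> \bar R}) (m2 : {measure set Y -> \bar R})
    (c : R) (e : Y -> X) (g : X -> C) : 0 <= c ->
  (forall f : X -> \bar R, measurable_fun setT f -> (forall x, 0 <= f x)%E ->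
    (\int[m1]_x f x = c%:E * \int[m2]_y f (e y))%E) ->
  cmeas g -> cintegrable m2 (fun y => g (e y)) ->
  cintegrable m1 g /\ CI m1 g = rC c * CI m2 (fun y => g (e y)).
Proof.
move=> c0 mm mg gi.
have gi1 : cintegrable m1 g.
  split => //; rewrite mm//; last by move=> x; rewrite lee_fin cabs_ge0.
    by rewrite (cintegrable_EFin gi) -EFinM ltry.
  exact: measurable_cabsE.
split => //; have [ri ii] := (cintegrableP _ _).1 gi1; have [ri2 ii2] := (cintegrableP _ _).1 gi.
have part (f : X -> R) : measurable_fun setT f -> m1.-integrable setT (fun x => (f x)%:E) ->
    m2.-integrable setT (fun y => (f (e y))%:E) -> \int[m1]_x f x = c * \int[m2]_y f (e y).
  move=> mf i1 i2; rewrite -(parts_integral i1) -(parts_integral i2).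
  have [f1 f2] := parts_fin i2.
  rewrite (mm _ (measurable_ppart mf) (fun x => ppart_ge0 _)) (mm _ (measurable_npart mf) (fun x => npart_ge0 _)).
  by rewrite !fineM//= mulrBr.
apply: cplx_eq; rewrite ?creM ?cimM ?cre_CI ?cim_CI /= ?mul0r ?subr0 ?addr0.
  by apply: part => //; exact: mg.1.
by apply: part => //; exact: mg.2.
Qed.

Lemma fine_sum_eq (u v w z : \bar R) : u \is a fin_num -> v \is a fin_num -> w \is a fin_num -> z \is a fin_num ->
  (u + v = w + z)%E -> fine u + fine v = fine w + fine z.
Proof. by case: u v w z => [u| |] [v| |] [w| |] [z| |] // _ _ _ _ []. Qed.

(** The relation [a - b = p - q] between measures is expressed with sums, which make sense also
    where the integrals are infinite. *)
Lemma CI_exchange (a b p q : {measure set X -> \bar R}) (g : X -> C) :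
  (forall f : X -> \bar R, measurable_fun setT f -> (forall x, 0 <= f x)%E ->
    (\int[p]_x f x + \int[b]_x f x = \int[q]_x f x + \int[a]_x f x)%E) ->
  cintegrable a g -> cintegrable b g -> cintegrable p g -> cintegrable q g ->
  CI a g - CI b g = CI p g - CI q g.
Proof.
move=> mm ai bi pi qi.
have part (f : X -> R) : measurable_fun setT f -> a.-integrable setT (fun x => (f x)%:E) ->
    b.-integrable setT (fun y => (f y)%:E) -> p.-integrable setT (fun y => (f y)%:E) ->
    q.-integrable setT (fun y => (f y)%:E) ->
    \int[a]_x f x - \int[b]_x f x = \int[p]_x f x - \int[q]_x f x.
  move=> mf ia ib ip iq.
  rewrite -(parts_integral ia) -(parts_integral ib) -(parts_integral ip) -(parts_integral iq).
  have [a1 a2] := parts_fin ia; have [b1 b2] := parts_fin ib.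
  have [p1 p2] := parts_fin ip; have [q1 q2] := parts_fin iq.
  have := fine_sum_eq p1 b1 q1 a1 (mm _ (measurable_ppart mf) (fun x => ppart_ge0 _)).
  have := fine_sum_eq p2 b2 q2 a2 (mm _ (measurable_npart mf) (fun x => npart_ge0 _)).
  have alg (a1' a2' b1' b2' p1' p2' q1' q2' : R) : p2' + b2' = q2' + a2' -> p1' + b1' = q1' + a1' ->
    a1' - a2' - (b1' - b2') = p1' - p2' - (q1' - q2') by lra.
  exact: alg.
have [ra ca] := (cintegrableP _ _).1 ai; have [rb cb] := (cintegrableP _ _).1 bi.
have [rp cp'] := (cintegrableP _ _).1 pi; have [rq cq] := (cintegrableP _ _).1 qi.
apply: cplx_eq; rewrite ?creB ?cimB ?cre_CI ?cim_CI.
  by apply: part => //; case: ai => -[].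
by apply: part => //; case: ai => -[].
Qed.

Lemma fin_sub_eq (a b p q : \bar R) : a \is a fin_num -> b \is a fin_num -> p \is a fin_num -> q \is a fin_num ->
  (a - b = p - q)%E -> (p + b = q + a)%E.
Proof.
case: a b p q => [a| |] [b| |] [p| |] [q| |] // _ _ _ _; rewrite -!EFinN -!EFinD => -[] h.
by congr EFin; lra.
Qed.

Lemma sum_eq_bound (p a b : \bar R) (M : R) : (a < +oo)%E -> (b < +oo)%E -> (0 <= a)%E -> (0 <= b)%E -> (0 <= p)%E ->
  (p + b = a)%E -> `|fine a - fine b| <= M -> (p <= M%:E)%E.
Proof.
case: a b p => [a| |] [b| |] [p| |] //= _ _ _ _ _ [] pE h.
by rewrite lee_fin; have := ler_norm (a - b); lra.
Qed.

(** Hahn decomposition of the charge [a - b]. The set [P] is kept in the statement because mutual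
    singularity is what later bounds [p] and [q] by [|a - b|]. *)
Lemma finite_jordan (a b : {measure set X -> \bar R}) : (a setT < +oo)%E -> (b setT < +oo)%E ->
  exists (P : set X) (p q : {measure set X -> \bar R}), [/\ measurable P, p (~` P) = 0%E, q P = 0%E &
    forall A, measurable A -> (p A + b A = q A + a A)%E].
Proof.
move=> af bf.
have fa : fin_num_fun a.
  move=> A mA; rewrite ge0_fin_numE//; apply: le_lt_trans af; apply: le_measure; rewrite ?inE//.
have fb : fin_num_fun b.
  move=> A mA; rewrite ge0_fin_numE//; apply: le_lt_trans bf; apply: le_measure; rewrite ?inE//.
pose nu := cadd (charge_of_finite_measure (to_finite fa)) (cscale (-1) (charge_of_finite_measure (to_finite fb))).
have [P [N PN]] := Hahn_decomposition nu.
have [[mP _] [mN _] PNT PN0] := PN.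
exists P, (jordan_pos PN), (jordan_neg PN); split => //.
- apply: eq_trans (jordan_posE PN (~` P)) _; rewrite cjordan_posE /crestr0 mem_set /crestr; last exact: measurableC.
  by rewrite setICl charge0.
- apply: eq_trans (jordan_negE PN P) _; rewrite cjordan_negE /crestr0 mem_set// /crestr PN0.
  by rewrite charge0 oppe0.
move=> A mA; have nuE : nu A = (a A - b A)%E.
  transitivity (charge_of_finite_measure (to_finite fa) A + cscale (-1) (charge_of_finite_measure (to_finite fb)) A)%E => //.
  by rewrite cscaleN1.
have jE : (a A - b A = jordan_pos PN A - jordan_neg PN A)%E.
  apply: eq_trans (esym nuE) _; apply: eq_trans (jordan_decomp PN mA) _.
  transitivity (jordan_pos PN A + (-1)%:E * jordan_neg PN A)%E => //.
  by rewrite EFinN mulN1e.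
exact: (fin_sub_eq (fa A mA) (fb A mA) (fin_num_measure _ _ mA) (fin_num_measure _ _ mA) jE).
Qed.
End measures.

Section radon.
Variables (R : realType) (n : nat).
Local Notation Rn := 'rV[R]_n.
Local Notation T := (BorelRd R n).
Local Notation C := R[i].
Local Notation mu := (@leb R n).

(* The Hahn decomposition is available for finite charges only, so it is applied on
   each piece of a partition into bounded sets. *)
Lemma locfin_jordan (a b : {measure set T -> \bar R}) : locfin a -> locfin b ->
  exists (P : set T) (p q : {measure set T -> \bar R}), [/\ measurable P, p (~` P) = 0%E, q P = 0%E &
    forall A, measurable A -> (p A + b A = q A + a A)%E].
Proof.
move=> la lb.
(* The disjoint shells between successive cubes. *)
pose D := seqDU (fun k => cube (0 : Rn) k%:R) : nat -> set T.
have mD k : measurable (D k).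
  apply: measurableD; first exact: measurable_cube.
  by apply: bigsetU_measurable => i _; exact: measurable_cube.
have tD : trivIset setT D by exact: trivIset_seqDU.
have UD : \bigcup_k D k = setT by rewrite -seqDU_bigcup_eq cube_exhausts.
have fin (m : {measure set T -> \bar R}) k : locfin m -> (mrestr m (mD k) setT < +oo)%E.
  move=> lm; rewrite /mrestr setTI; apply: le_lt_trans (lm k%:R).
  by apply: le_measure; rewrite ?inE; [exact: mD|exact: measurable_cube|exact: subset_seqDU].
have step k : exists t : set T * {measure set T -> \bar R} * {measure set T -> \bar R},
    [/\ measurable t.1.1, t.1.2 (~` t.1.1) = 0%E, t.2 t.1.1 = 0%E &
    forall A, measurable A -> (t.1.2 A + b (A `&` D k) = t.2 A + a (A `&` D k))%E].
  have [P [p [q h]]] := finite_jordan (fin a k la) (fin b k lb).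
  by exists (P, p, q).
have [t tP] := fchoice step.
pose Pk k := (t k).1.1; pose pk k := (t k).1.2; pose qk k := (t k).2.
have mP k : measurable (Pk k) by case: (tP k).
pose P := \bigcup_k (D k `&` Pk k).
have mPP : measurable P by apply: bigcup_measurable => k _; exact: measurableI.
have le0 (m : {measure set T -> \bar R}) A B : measurable A -> measurable B -> A `<=` B -> m B = 0%E -> m A = 0%E.
  by move=> mA mB AB mB0; apply/eqP; rewrite eq_le measure_ge0 andbT -mB0; apply: le_measure; rewrite ?inE.
(* Off the shell [D k] the measures [pk k] and [qk k] agree, and one vanishes on [Pk k], the other
   on its complement, so both vanish there. *)
have off k : pk k (~` D k) = 0%E /\ qk k (~` D k) = 0%E.
  have [_ p0 q0 E] := tP k.
  have mDC : measurable (~` D k) by exact: measurableC.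
  have e1 A : A `<=` ~` D k -> measurable A -> pk k A = qk k A.
    move=> AD mA; have := E A mA; have -> : A `&` D k = set0 by apply/disjoints_subset.
    by rewrite !measure0 !adde0.
  have q1 : qk k (~` D k `&` Pk k) = 0%E by apply: (le0 _ _ (Pk k)) => //; exact: measurableI.
  have p1 : pk k (~` D k `&` ~` Pk k) = 0%E.
    by apply: (le0 _ _ (~` Pk k)) => //; [apply: measurableI => //; exact: measurableC|exact: measurableC].
  have p2 : pk k (~` D k) = 0%E.
    have mPC : measurable (~` Pk k) by exact: measurableC.
    have m1 : measurable (~` D k `&` Pk k) by exact: measurableI.
    have m2 : measurable (~` D k `&` ~` Pk k) by exact: measurableI.
    apply/eqP; rewrite eq_le measure_ge0 andbT.
    rewrite (_ : ~` D k = (~` D k `&` Pk k) `|` (~` D k `&` ~` Pk k)); last by rewrite -setIUr setUCr setIT.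
    have u : (pk k (~` D k `&` Pk k) + pk k (~` D k `&` ~` Pk k) <= 0)%E.
      by rewrite p1 adde0 (e1 _ (@subIsetl _ _ _) m1) q1.
    exact: le_trans (measureU2 _ m1 m2) u.
  by split; rewrite ?p2// -e1.
exists P, (mseries pk 0), (mseries qk 0); split => //.
- rewrite /= /mseries eseries0// => k _ _.
  have [p0 _] := off k; have [_ p1 _ _] := tP k.
  have mDC : measurable (~` D k) by exact: measurableC.
  have mPC : measurable (~` Pk k) by exact: measurableC.
  have mC : measurable (~` P) by exact: measurableC.
  apply/eqP; rewrite eq_le measure_ge0 andbT.
  apply: (@le_trans _ _ (pk k (~` D k `|` ~` Pk k))).
    apply: le_measure; rewrite ?inE//; first exact: measurableU.
    by rewrite -setCI; apply: subsetC => x [Dx Px]; exists k.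
  have u : (pk k (~` D k) + pk k (~` Pk k) <= 0)%E by rewrite p0 (p1 : pk k (~` Pk k) = 0%E) adde0.
  exact: le_trans (measureU2 _ mDC mPC) u.
- rewrite /= /mseries eseries0// => k _ _.
  have [_ q0] := off k; have [_ _ q1 _] := tP k.
  have mDC : measurable (~` D k) by exact: measurableC.
  apply/eqP; rewrite eq_le measure_ge0 andbT.
  apply: (@le_trans _ _ (qk k (~` D k `|` Pk k))).
    apply: le_measure; rewrite ?inE//; first exact: measurableU.
    (* A point of [P] lying in another shell is outside [D k], where [qk k] vanishes. *)
    move=> x [j _ [Dj Pj]]; have [<-|jk] := eqVneq j k; first by right.
    left => Dk; have := tD j k I I; move=> h; move/eqP: jk; apply; apply: h.
    by exists x.
  have u : (qk k (~` D k) + qk k (Pk k) <= 0)%E by rewrite q0 (q1 : qk k (Pk k) = 0%E) adde0.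
  exact: le_trans (measureU2 _ mDC (mP k)) u.
move=> A mA.
have series (m : {measure set T -> \bar R}) : m A = (\sum_(0 <= k <oo) m (A `&` D k))%E.
  rewrite -{1}(setIT A) -UD setI_bigcupr measure_bigcup//.
  - by apply: eq_eseriesl => k; rewrite in_setT.
  - by move=> k _; exact: measurableI.
  - by apply: trivIset_setIl.
rewrite /= /mseries (series a) (series b) -!nneseriesD//.
by apply: eq_eseriesr => k _; have [_ _ _ E] := tP k; exact: E.
Qed.

Lemma jordan_integral (a b p q : {measure set T -> \bar R}) :
  (forall A, measurable A -> (p A + b A = q A + a A)%E) ->
  forall f : T -> \bar R, measurable_fun setT f -> (forall x, 0 <= f x)%E ->
    (\int[p]_x f x + \int[b]_x f x = \int[q]_x f x + \int[a]_x f x)%E.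
Proof.
move=> E f mf f0.
rewrite -ge0_integral_measure_add// -ge0_integral_measure_add//.
apply: eq_measure_integral => A mA _.
apply: eq_trans (measure_addE p b A) _; apply: eq_trans (E A mA) _.
exact: esym (measure_addE q a A).
Qed.

Lemma measurable_opp : measurable_fun setT (fun x : T => - (x : Rn) : T).
Proof. by apply: measurable_oppv; exact: measurable_id. Qed.

Definition refl (k : {nonneg R}) (lam : {measure set T -> \bar R}) : {measure set T -> \bar R} :=
  mscale k (pushforward_measure lam measurable_opp).

Lemma refl_integral k lam (f : T -> \bar R) : measurable_fun setT f -> (forall x, 0 <= f x)%E ->
  (\int[refl k lam]_x f x = k%:num%:E * \int[lam]_x f (- (x : Rn))%R)%E.
Proof.
move=> mf f0; rewrite ge0_integral_mscale//; congr (_ * _)%E.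
by rewrite ge0_integral_pushforward//; exact: measurable_opp.
Qed.

Lemma CI_refl k lam (g : T -> C) : cmeas g -> cintegrable lam (fun x : T => g (- (x : Rn))) ->
  cintegrable (refl k lam) g /\ CI (refl k lam) g = rC k%:num * CI lam (fun x : T => g (- (x : Rn))).
Proof. by move=> mg gi; apply: CI_image => //; exact: refl_integral. Qed.

Lemma refl_cube k lam (x : Rn) (r : R) : refl k lam (cube x r) = (k%:num%:E * lam (cube (- x) r))%E.
Proof.
rewrite /refl /= /mscale /= /pushforward; congr (_ * lam _)%E.
by apply/seteqP; split => y; rewrite /cube /= -normrN opprD !opprK.
Qed.

Lemma refl_cube_bounded k lam : cube_bounded lam -> cube_bounded (refl k lam).
Proof.
move=> tb r; have [M [M0 h]] := tb r; exists (k%:num * M); split; first by rewrite mulr_ge0.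
by move=> x; rewrite refl_cube EFinM; apply: lee_wpmul2l.
Qed.

Lemma locfin_compact_lty (lam : {measure set T -> \bar R}) (K : set Rn) : locfin lam -> compact K -> (lam K < +oo)%E.
Proof.
move=> lf cK; have [r [r0 Kr]] := compact_sub_cube cK.
apply: le_lt_trans (lf r); apply: le_measure; rewrite ?inE//; [exact: compact_BorelRd|exact: measurable_cube].
Qed.

Lemma ex_radon (m : nat -> {measure set T -> \bar R}) : (forall j, locfin (m j)) ->
  exists nu : cRadon R n, [/\ rm1 nu = m 0%N, rm2 nu = m 1%N, rm3 nu = m 2%N & rm4 nu = m 3%N].
Proof.
move=> lf.
have h (K : set Rn) : compact K -> [/\ (m 0%N K < +oo)%E, (m 1%N K < +oo)%E, (m 2%N K < +oo)%E & (m 3%N K < +oo)%E].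
  by move=> cK; split; apply: locfin_compact_lty.
by exists (CRadon h).
Qed.

(* [cp] repeats the fourth component beyond index 3. *)
Lemma ex_radon_cp (m : nat -> {measure set T -> \bar R}) : (forall j, locfin (m j)) ->
  exists nu : cRadon R n, forall j, cp nu j = m (minn j 3).
Proof.
move=> lf; have [nu [h0 h1 h2 h3]] := ex_radon lf; exists nu.
by case=> [|[|[|[|j]]]]//=; rewrite minnC.
Qed.

(** On each piece [|nu B|] is at most the sum of the four component masses, and these are additive
    over the partition; hence the factor 4. *)
Lemma variation_le (nu : cRadon R n) (A : set Rn) (M : R) : (forall j, cp nu j A <= M%:E)%E ->
  (variation nu A <= (4 * M)%:E)%E.
Proof.
move=> AM; apply: ge_ereal_sup => _ [s [ms [ds sA]] <-].
have msB B : B \in s -> measurable (B : set T).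
  by move=> Bs; rewrite -(nth_index set0 Bs); apply: ms; rewrite index_mem.
have mA : measurable (A : set T).
  by rewrite -sA big_seq; apply: bigsetU_measurable.
have BA B : B \in s -> B `<=` A.
  by move=> Bs; rewrite -sA => x Bx; rewrite -bigcup_seq; exists B.
have fin j B : B \in s -> (cp nu j B \is a fin_num)%E.
  move=> Bs; rewrite ge0_fin_numE//; apply: le_lt_trans (ltry M); apply: le_trans (AM j).
  by apply: le_measure; rewrite ?inE//; [exact: msB|exact: BA].
have sumA j : (\sum_(B <- s) cp nu j B = cp nu j A)%E.
  rewrite -sA; elim: s ms ds {msB mA BA fin sA} => [|B s IH] ms ds.
    by rewrite !big_nil measure0.
  rewrite !big_cons measureU.
  - congr (_ + _)%E; apply: IH; first by move=> i si; exact: (ms i.+1).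
    by move=> i k ik ks; exact: (ds i.+1 k.+1).
  - exact: (ms 0%N).
  - rewrite big_seq; apply: bigsetU_measurable => B' B's.
    rewrite -(nth_index set0 B's); apply: (ms (index B' s).+1).
    by rewrite /= ltnS index_mem.
  - apply/seteqP; split => x // [Bx]; rewrite -bigcup_seq => -[B' B's0 B'x].
    have B's : B' \in s by [].
    have /(nthP set0)[i si iE] := B's.
    by rewrite -(ds 0%N i.+1 isT si) /= iE.
have key : \sum_(B <- s) cabs (Defs.cmeas nu B) <= \sum_(j < 4) \sum_(B <- s) fine (cp nu j B).
  rewrite exchange_big /=; apply: ler_sum => B _.
  rewrite !big_ord_recr big_ord0 /= add0r; apply: le_trans (cabs_le _) _; rewrite /Defs.cmeas /cre /cim /=.
  have f0 (m : {measure set T -> \bar R}) : 0 <= fine (m B) by apply: fine_ge0.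
  have := f0 (rm1 nu); have := f0 (rm2 nu); have := f0 (rm3 nu); have := f0 (rm4 nu).
  move: (fine _) (fine _) (fine _) (fine _) => a b c e a0 b0 c0 e0.
  have h1 := ler_normB c e; have h2 := ler_normB a b.
  rewrite (ger0_norm a0) (ger0_norm b0) in h1; rewrite (ger0_norm c0) (ger0_norm e0) in h2.
  lra.
rewrite lee_fin; apply: le_trans key _.
have h j : \sum_(B <- s) fine (cp nu j B) <= M.
  rewrite -lee_fin; apply: le_trans (AM j); rewrite -(sumA j) -sumEFin.
  by rewrite big_seq [leRHS]big_seq; apply: lee_sum => B Bs; rewrite fineK// fin.
rewrite !big_ord_recr big_ord0 /= add0r.
by have := h 0%N; have := h 1%N; have := h 2%N; have := h 3%N; rewrite /=; lra.
Qed.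

Lemma cube_bounded_transl_bounded (nu : cRadon R n) : (forall j, cube_bounded (cp nu j)) -> transl_bounded nu.
Proof.
move=> tb K cK; have [r [r0 Kr]] := compact_sub_cube cK.
have [M MP] := fchoice (fun j => tb j r).
exists (4 * (\sum_(j < 4) M j)) => x; apply: variation_le => j.
have mKx : measurable ([set (k + x)%R | k in K] : set T).
  have mx : measurable_fun setT (fun y : T => (y : Rn) - x : T).
    by apply: measurable_subrv; [exact: measurable_id|exact: measurable_cst].
  have := mx measurableT _ (compact_BorelRd cK); rewrite setTI; congr measurable.
  apply/seteqP; split => y /=; first by move=> Ky; exists (y - x); rewrite ?subrK.
  by move=> [k Kk <-]; rewrite addrK.
apply: (@le_trans _ _ (cp nu j (cube x r))).
  apply: le_measure; rewrite ?inE; [exact: mKx|exact: measurable_cube|].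
  by move=> _ [k Kk <-]; rewrite /cube /= addrK -(subr0 k); exact: Kr.
have M0 i : 0 <= M i by have [] := MP i.
have jE : cp nu j = cp nu (minn j 3) by case: j => [|[|[|j]]]//=; rewrite minnC.
have [_ /(_ x) h] := MP (minn j 3); rewrite jE; apply: le_trans h _; rewrite lee_fin.
have j4 : (minn j 3 < 4)%N by rewrite ltnS geq_minr.
by rewrite (bigD1 (Ordinal j4))//= lerDl sumr_ge0.
Qed.

(* The components of a Radon measure may be much larger than its variation; the Jordan
   decomposition replaces them by components that the variation controls. *)
Lemma jordan_cube_bounded (nu : cRadon R n) (a b : {measure set T -> \bar R}) : locfin a -> locfin b -> transl_bounded nu ->
  (forall A, measurable A -> (a A < +oo)%E -> (b A < +oo)%E -> `|fine (a A) - fine (b A)| <= cabs (Defs.cmeas nu A)) ->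
  exists p q : {measure set T -> \bar R}, [/\ cube_bounded p, cube_bounded q &
    forall g, nice g -> CI a g - CI b g = CI p g - CI q g].
Proof.
move=> la lb tbnu abnu.
have [P [p [q [mP pP qP E]]]] := locfin_jordan la lb.
have mPC : measurable (~` P) by exact: measurableC.
have bound r : exists M : R, 0 <= M /\ forall x : Rn, (p (cube x r) <= M%:E)%E /\ (q (cube x r) <= M%:E)%E.
  have [M MP] := tbnu _ (@compact_cube R n (0 : Rn) r).
  exists `|M|; split => // x.
  have cubeE : [set (k + x)%R | k in cube 0 r] = cube x r.
    apply/seteqP; split => y; first by move=> [k]; rewrite /cube /= subr0 => kr <-; rewrite addrK.
    by rewrite /cube /= => yr; exists (y - x); rewrite ?subr0 ?subrK.
  have := MP x; rewrite cubeE => {}MP.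
  have mC := measurable_cube x r.
  have fin (m : {measure set T -> \bar R}) (B : set T) : locfin m -> measurable B -> B `<=` cube x r -> (m B < +oo)%E.
    move=> lm mB BC; apply: le_lt_trans (lm (r + `|x|)); apply: le_measure; rewrite ?inE//; first exact: measurable_cube.
    by apply: subset_trans BC _; apply: cube_sub; rewrite subr0.
  (* The two-piece partition of the cube is one of the competitors in the supremum defining the
     variation. *)
  have var (B B' : set T) : measurable B -> measurable B' -> B `&` B' = set0 -> B `|` B' = cube x r ->
      cabs (Defs.cmeas nu B) <= `|M|.
    move=> mB mB' d u.
    have : ((\sum_(B <- [:: B; B']) cabs (Defs.cmeas nu B))%:E <= M%:E)%E.
      apply: le_trans MP; apply: ereal_sup_ubound; exists [:: B; B'] => //; split; last split.
      - by case=> [|[|]].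
      - by case=> [|[|i]] [|[|j]].
      - by rewrite !big_cons big_nil setU0.
    rewrite lee_fin !big_cons big_nil addr0 => h; apply: le_trans (ler_norm M); apply: le_trans h.
    by rewrite lerDl cabs_ge0.
  have d1 : (cube x r `&` P) `&` (cube x r `\` P) = set0 by apply/seteqP; split => y // [[_ Py] [_ nPy]].
  have d2 : (cube x r `\` P) `&` (cube x r `&` P) = set0 by rewrite setIC.
  have u2 : (cube x r `\` P) `|` (cube x r `&` P) = cube x r by rewrite setUC setUIDK.
  have v1 := var _ _ (measurableI _ _ mC mP) (measurableD mC mP) d1 (setUIDK _ _).
  have v2 := var _ _ (measurableD mC mP) (measurableI _ _ mC mP) d2 u2.
  have E1 := E _ (measurableI _ _ mC mP); have E2 := E _ (measurableD mC mP).
  have z (m : {measure set T -> \bar R}) (A B : set T) : measurable A -> measurable B -> A `<=` B -> m B = 0%E -> m A = 0%E.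
    by move=> mA mB AB mB0; apply/eqP; rewrite eq_le measure_ge0 andbT -mB0; apply: le_measure; rewrite ?inE.
  (* On the part of the cube inside [P] the measure [p] is the difference [a - b], and outside [P]
     the measure [q] is its negative; both are bounded by the variation. *)
  have q0 : q (cube x r `&` P) = 0%E by exact: (z _ _ _ (measurableI _ _ mC mP) mP (@subIsetr _ _ _) qP).
  have p0 : p (cube x r `\` P) = 0%E.
    by apply: (z _ _ _ (measurableD mC mP) mPC _ pP) => y [].
  have pC : (p (cube x r) = p (cube x r `\` P) + p (cube x r `&` P))%E by exact: measureDI.
  have qC : (q (cube x r) = q (cube x r `\` P) + q (cube x r `&` P))%E by exact: measureDI.
  rewrite pC qC p0 q0 add0e adde0.
  have a1 := fin a _ la (measurableI _ _ mC mP) (@subIsetl _ _ _).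
  have b1 := fin b _ lb (measurableI _ _ mC mP) (@subIsetl _ _ _).
  have a2 := fin a _ la (measurableD mC mP) (@subDsetl _ _ _).
  have b2 := fin b _ lb (measurableD mC mP) (@subDsetl _ _ _).
  have w1 := le_trans (abnu _ (measurableI _ _ mC mP) a1 b1) v1.
  have w2 := le_trans (abnu _ (measurableD mC mP) a2 b2) v2.
  split; first by apply: (sum_eq_bound _ _ _ _ _ _ w1) => //; rewrite E1 q0 add0e.
  by rewrite distrC in w2; apply: (sum_eq_bound _ _ _ _ _ _ w2) => //; rewrite -E2 p0 add0e.
have tp : cube_bounded p by move=> r; have [M [M0 h]] := bound r; exists M; split => // x; have [] := h x.
have tq : cube_bounded q by move=> r; have [M [M0 h]] := bound r; exists M; split => // x; have [] := h x.
exists p, q; split => // g ng; apply: CI_exchange (jordan_integral E) _ _ _ _; apply: nice_cintegrable => //; exact: cube_bounded_locfin.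
Qed.
End radon.

(** * The norm of the restricted multipliers *)

Section Vnorm.
Variables (R : realType) (n : nat).
Local Notation Rn := 'rV[R]_n.
Local Notation T := (BorelRd R n).
Local Notation C := R[i].
Local Notation mu := (@leb R n).
Local Notation c2 := (twopid R n).

Definition pair_sum (p : seq (Rn * C)) (f : Rn -> C) : C := \sum_(q <- p) q.2 * f q.1.

(** The bound [Vnorm f <= B] without extended reals, see [VleP]. *)
Definition Vle (f : Rn -> C) (B : R) := forall s p, inVs s p -> (forall x, cabs (evalp p x) <= 1) ->
  cabs (pair_sum p f) <= B.

Lemma VleP f B : Vle f B <-> (Vnorm f <= B%:E)%E.
Proof.
split=> [h|h s p sp p1].
  apply: ge_ereal_sup => _ [s _ <-]; apply: ge_ereal_sup => _ [p [sp p1] <-].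
  by rewrite lee_fin; exact: h sp p1.
rewrite -lee_fin; apply: le_trans h.
apply: (@le_trans _ _ (Vnorm_s f s)); last by apply: ereal_sup_ubound; exists s.
by apply: ereal_sup_ubound; exists p.
Qed.

Lemma Vnorm_ge0 (f : Rn -> C) : (0 <= Vnorm f)%E.
Proof.
apply: (@le_trans _ _ (Vnorm_s f 0)); last by apply: ereal_sup_ubound; exists 0.
apply: ereal_sup_ubound; exists [::]; last by rewrite big_nil cabs0.
by split => // x; rewrite /evalp big_nil cabs0.
Qed.

Lemma Vnorm_cvg0 (f : nat -> Rn -> C) :
  (Vnorm (f k) @[k --> \oo] --> 0%E) <-> forall e : R, 0 < e -> exists N, forall k, (N <= k)%N -> Vle (f k) e.
Proof.
split=> [/fine_cvgP[fin lim] e e0|h].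
  have [N1 _ h1] := fin; have [N2 _ h2] := cvgr_le _ lim _ e0.
  exists (maxn N1 N2) => k; rewrite geq_max => /andP[k1 k2]; apply/VleP.
  by rewrite -(fineK (h1 k k1)) lee_fin; exact: h2.
apply/fine_cvgP; split.
  have [N hN] := h 1 ltr01; exists N => // k /hN/VleP k1.
  by rewrite ge0_fin_numE ?Vnorm_ge0//; apply: le_lt_trans k1 _; exact: ltry.
apply/cvgrPdist_le => e e0; have [N hN] := h e e0; exists N => // k /hN/VleP k1.
rewrite sub0r normrN ger0_norm ?fine_ge0 ?Vnorm_ge0// -lee_fin fineK//.
by rewrite ge0_fin_numE ?Vnorm_ge0//; apply: le_lt_trans k1 _; exact: ltry.
Qed.

Lemma pair_sumD p f g : pair_sum p (fun t => f t + g t) = pair_sum p f + pair_sum p g.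
Proof. by rewrite /pair_sum -big_split; apply: eq_bigr => q _; rewrite mulrDr. Qed.

Lemma VleD f g A B : Vle f A -> Vle g B -> Vle (fun t => f t + g t) (A + B).
Proof.
move=> fA gB s p sp p1; rewrite pair_sumD; apply: le_trans (cabsD _ _) _.
by apply: lerD; [exact: fA sp p1|exact: gB sp p1].
Qed.

Lemma VleN f A : Vle f A -> Vle (fun t => - f t) A.
Proof.
move=> fA s p sp p1; rewrite (_ : pair_sum p _ = - pair_sum p f) ?cabsN; first exact: fA sp p1.
by rewrite /pair_sum -sumrN; apply: eq_bigr => q _; rewrite mulrN.
Qed.

Lemma Vle_eq f g A : f =1 g -> Vle f A -> Vle g A.
Proof. by move=> /funext ->. Qed.

(** Shifting all frequencies multiplies the trigonometric sum by a character, which keeps its sup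
    norm and moves the window from [s] to [s + u]. *)
Lemma Vle_translate f A (u : Rn) : Vle f A -> Vle (fun t => f (t + u)) A.
Proof.
move=> fA s p sp p1.
pose p' := [seq (q.1 + u, q.2) | q <- p].
have -> : pair_sum p (fun t => f (t + u)) = pair_sum p' f by rewrite /pair_sum big_map.
apply: (fA (s + u)).
  by rewrite /inVs all_map; apply: sub_all sp => q /= qs; rewrite (_ : q.1 + u - (s + u) = q.1 - s)// opprD addrACA subrr addr0.
move=> x; have -> : evalp p' x = expi (dotp x u) * evalp p x.
  rewrite /evalp big_map mulr_sumr; apply: eq_bigr => q _ /=.
  by rewrite dotpDr expiD mulrA mulrC.
by rewrite cabsM cabs_expi mul1r.
Qed.

(** Pairing the coefficients of [p] with [hatF g] is integrating [p (- x) g x], up to [twopid], and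
    [|p| <= 1]. *)
Lemma Vle_hatF g : cintegrable mu g -> Vle (hatF g) (c2 * \int[mu]_x cabs (g x)).
Proof.
move=> gi s p sp p1.
have E : pair_sum p (hatF g) = rC c2 * CI mu (fun x : T => evalp p (- (x : Rn)) * g x).
  have [|_ e] := @CI_sum _ _ _ mu _ p (fun (q : Rn * C) (x : T) => q.2 * (expi (dotp (x : Rn) (- q.1)) * g x)).
    by move=> q; apply: cintegrableZ; exact: FT_cint.
  transitivity (rC c2 * \sum_(q <- p) q.2 * FT g (- q.1)).
    by rewrite mulr_sumr; apply: eq_bigr => q _; rewrite (hatF_FT _ gi) mulrCA.
  congr (_ * _); transitivity (\sum_(q <- p) CI mu (fun x : T => q.2 * (expi (dotp (x : Rn) (- q.1)) * g x))).
    by apply: eq_bigr => q _; rewrite (CIZ _ (FT_cint _ gi)).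
  rewrite -e; apply: eq_CI => x; rewrite /evalp mulr_suml; apply: eq_bigr => q _.
  by rewrite dotpNr dotpNl mulrA.
rewrite E cabsM cabs_rC (gtr0_norm (@twopid_gt0 R n)) ler_pM2l ?twopid_gt0//.
apply: cabs_CI_le; last by move=> x; rewrite cabsM ler_piMl ?cabs_ge0.
  apply: cmeasM; last by case: gi.
  apply: (@cmeas_sum _ _ _ _ p (fun (q : Rn * C) (x : T) => q.2 * expi (dotp (- (x : Rn)) q.1))) => q.
  apply: cmeasM; first exact: cmeas_cst.
  by apply: cmeas_expi; apply: measurable_dotp; [exact: measurable_opp|exact: measurable_cst].
exact: cintegrable_cabs.
Qed.

Lemma modul_continuity g (e : R) : cintegrable mu g -> 0 < e ->
  exists d : R, 0 < d /\ forall u : Rn, `|u| <= d -> \int[mu]_x cabs (expi (dotp (x : Rn) u) * g x - g x) <= e.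
Proof.
move=> gi e0.
pose w (u : Rn) := \int[mu]_x cabs (expi (dotp (x : Rn) u) * g x - g x).
have cw : continuous w.
  apply: seq_continuous => u x ux.
  apply: (Rintegral_dct (g := fun y => 2 * cabs (g y))).
  - move=> k; apply: measurable_cabs; apply: cmeasB; last by case: gi.
    by apply: cmeasM; [exact: cmeas_expi_dotp|case: gi].
  - move=> y; apply: ccvg_cabs; apply: ccvgD; last exact: ccvg_cst.
    apply: ccvgM; last exact: ccvg_cst.
    by apply: cvg_expi; rewrite dotpC; under eq_fun do rewrite dotpC; exact: cvg_dotp.
  - by apply: integrableZl_EFin; exact: cintegrable_cabs.
  - move=> k y; rewrite ger0_norm ?cabs_ge0//; apply: le_trans (cabsD _ _) _.
    by rewrite cabsN cabsM cabs_expi mul1r; lra.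
have w0 : w 0 = 0.
  rewrite /w; under eq_Rintegral do rewrite dotp0r expi0 mul1r subrr cabs0.
  by rewrite /Rintegral integral0.
have h : \forall u \near (0 : Rn), w u <= e by have cw0 := cw 0; apply: (cvgr_le _ cw0); rewrite w0.
have [d d0 hd] : exists2 d : R, 0 < d & forall u : Rn, `|u| < d -> w u <= e.
  move: h => /nbhs_ballP[d /= d0 hd]; exists d => // u ud; apply: hd.
  by rewrite -ball_normE /= sub0r normrN.
exists (d / 2); split; first by rewrite divr_gt0.
by move=> u ud; apply: hd; apply: le_lt_trans ud _; rewrite ltr_pdivrMr//; lra.
Qed.

Lemma A_bounded psi : inA psi -> exists V : R, 0 < V /\ Vle psi V.
Proof.
move=> [_ [f [fL /Vnorm_cvg0 /(_ 1 ltr01)[N hN]]]].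
have fi := (L1P _).1 (fL N).
have I0 : 0 <= \int[mu]_x cabs (f N x) by apply: Rintegral_ge0 => x _; exact: cabs_ge0.
exists (c2 * \int[mu]_x cabs (f N x) + 1); split.
  by rewrite ltr_wpDl// mulr_ge0// ltW// twopid_gt0.
have := VleD (Vle_hatF fi) (VleN (hN N (leqnn N))).
by apply: Vle_eq => t; rewrite opprB addrC subrK.
Qed.

(** For [hatF g] a translation is a modulation of [g], continuous in L^1. The general case follows
    by approximation, because translations preserve the bounds [Vle]; each of the three terms takes
    [e / 3]. *)
Lemma A_translation psi (e : R) : inA psi -> 0 < e ->
  exists d : R, 0 < d /\ forall u : Rn, `|u| <= d -> Vle (fun t => psi (t + u) - psi t) e.
Proof.
move=> [_ [f [fL /Vnorm_cvg0 h]]] e0.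
have e3 : 0 < e / 3 by rewrite divr_gt0.
have [N hN] := h _ e3; have Vf := hN N (leqnn N).
have fi := (L1P _).1 (fL N); set g := f N in Vf fi.
have c0 := @twopid_gt0 R n.
have [d [d0 hd]] := modul_continuity fi (divr_gt0 e3 c0).
exists d; split => // u ud.
have mgu : cintegrable mu (fun x : T => expi (dotp (x : Rn) (- u)) * g x) by exact: FT_cint.
have di := cintegrableB mgu fi.
have V1 : Vle (fun t => hatF g (t + u) - hatF g t) (e / 3).
  have := Vle_hatF di => V0 s p sp p1; apply: le_trans (_ : c2 * (e / 3 / c2) <= _); last first.
    by rewrite mulrC divfK// gt_eqF.
  apply: (@le_trans _ _ (c2 * \int[mu]_x cabs (expi (dotp (x : Rn) (- u)) * g x - g x))); last first.
    by rewrite ler_pM2l//; apply: hd; rewrite normrN.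
  have E t : hatF (fun x : T => expi (dotp (x : Rn) (- u)) * g x - g x) t = hatF g (t + u) - hatF g t.
    rewrite (hatF_FT _ di) !(hatF_FT _ fi) -mulrBr; congr (_ * _).
    rewrite /FT -(CIB (FT_cint _ fi) (FT_cint _ fi)); apply: eq_CI => x.
    by rewrite opprD dotpDr expiD mulrBr mulrA.
  by have := V0 s p sp p1; rewrite /pair_sum; under eq_bigr do rewrite E.
have V2 := VleD V1 (VleD (VleN (Vle_translate u Vf)) Vf).
move=> s p sp p1; have := Vle_eq _ V2 sp p1.
have -> : e / 3 + (e / 3 + e / 3) = e by field.
apply => t; rewrite opprB.
by rewrite addrACA (addrC (hatF g (t + u))) addrA subrK -addrA; congr (_ + _); rewrite addrA [- hatF _ _ + _]addrC subrr add0r.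
Qed.

(** Under the integral, shifts of norm at most [d] cost [e / 2] by [A_translation]. The remaining
    [v] cost at most [2 V] each, and their mass under [Phi] tends to 0. *)
Lemma V_approx psi (Phi : T -> R) (e : R) : inA psi -> (forall v, 0 <= Phi v) ->
  mu.-integrable setT (fun v => (Phi v)%:E) -> \int[mu]_v Phi v = 1 -> 0 < e ->
  exists N, forall k, (N <= k)%N ->
    Vle (fun t => CI mu (fun v : T => rC (Phi v) * (psi (t + k.+1%:R^-1 *: (v : Rn)) - psi t))) e.
Proof.
move=> Ap P0 Pi P1 e0.
have e2 : 0 < e / 2 by rewrite divr_gt0.
have [V [V0 VV]] := A_bounded Ap.
have [d [d0 hd]] := A_translation Ap e2.
have mPhi : measurable_fun setT Phi by apply/measurable_EFinP; case/integrableP : Pi.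
pose b (k : nat) (v : T) : R := 1 - \1_(cube 0 (d * k.+1%:R)) (v : Rn).
have b01 k v : 0 <= b k v <= 1.
  by rewrite /b indicE; case: (_ \in _); rewrite ?subrr ?subr0 lexx ler01.
have mb k : measurable_fun setT (b k).
  by apply: measurable_funB => //; apply: measurable_indic; exact: measurable_cube.
have lim : (fun k => \int[mu]_v (b k v * Phi v)) @ \oo --> (0 : R).
  have <- : \int[mu]_v (0 : R) = 0 by rewrite /Rintegral integral0.
  apply: (Rintegral_dct (g := Phi)) => //.
  - by move=> k; exact: measurable_funM.
  - move=> v; apply: cvg_near_cst; near=> k.
    have : `|v : Rn| / d <= k%:R by near: k; exact: nbhs_infty_ger.
    rewrite ler_pdivrMr// => vk; rewrite /b indicE mem_set ?subrr ?mul0r// /cube /= subr0.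
    by apply: le_trans vk _; rewrite mulrC ler_pM2l// ler_nat.
  - move=> k v; have /andP[x y] := b01 k v.
    by rewrite ger0_norm ?mulr_ge0// ler_piMl.
(* Chosen so that the far part contributes [2 V * (e / (4 V)) = e / 2]. *)
have e4 : 0 < e / (4 * V) by rewrite divr_gt0// mulr_gt0.
have [N _ hN] := cvgr_le _ lim _ e4.
exists N => k /hN {}hN s p sp p1.
have [cpsi [M psiM]] := Ap.1.
have mpsi := ccontinuous_cmeas cpsi.
have rPi := cintegrable_rC Pi.
have ti t : cintegrable mu (fun v : T => rC (Phi v) * (psi (t + k.+1%:R^-1 *: (v : Rn)) - psi t)).
  apply: (cintegrableM_bdd (M := M + M) rPi).
    apply: cmeasB; last exact: cmeas_cst.
    apply: (cmeas_comp mpsi); apply: measurable_addrv; first exact: measurable_cst.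
    by apply: measurable_scalev; exact: measurable_id.
  by move=> v; apply: le_trans (cabsD _ _) _; rewrite cabsN; exact: lerD.
have -> : pair_sum p (fun t => CI mu (fun v : T => rC (Phi v) * (psi (t + k.+1%:R^-1 *: (v : Rn)) - psi t))) =
    CI mu (fun v : T => rC (Phi v) * pair_sum p (fun t => psi (t + k.+1%:R^-1 *: (v : Rn)) - psi t)).
  have [|_ E] := @CI_sum _ _ _ mu _ p (fun (q : Rn * C) (v : T) => q.2 * (rC (Phi v) * (psi (q.1 + k.+1%:R^-1 *: (v : Rn)) - psi q.1))).
    by move=> q; exact: cintegrableZ.
  transitivity (\sum_(q <- p) CI mu (fun v : T => q.2 * (rC (Phi v) * (psi (q.1 + k.+1%:R^-1 *: (v : Rn)) - psi q.1)))).
    by apply: eq_bigr => q _; rewrite (CIZ _ (ti q.1)).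
  rewrite -E; apply: eq_CI => v; rewrite /pair_sum mulr_sumr; apply: eq_bigr => q _; exact: mulrCA.
have bPi : mu.-integrable setT (fun v : T => (b k v * Phi v)%:E).
  apply: le_integrable Pi => //; first by apply/measurable_EFinP; exact: measurable_funM.
  move=> v _; rewrite !abse_EFin lee_fin; have /andP[x y] := b01 k v.
  by rewrite normrM ler_piMl// ger0_norm.
have i1 := integrableZl_EFin (e / 2) Pi.
have i2 := integrableZl_EFin (2 * V) bPi.
apply: (@le_trans _ _ (\int[mu]_v (e / 2 * Phi v + 2 * V * (b k v * Phi v)))); last first.
  rewrite RintegralD// !RintegralZl_T// P1 mulr1.
  have h : 2 * V * (\int[mu]_v (b k v * Phi v)) <= 2 * V * (e / (4 * V)).
    by rewrite ler_wpM2l// mulr_ge0// ltW.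
  have Ve : 2 * V * (e / (4 * V)) = e / 2 by field; rewrite gt_eqF.
  by rewrite Ve in h; move: h; move: (2 * V * _) => z; lra.
apply: cabs_CI_le.
- apply: cmeasM; first by case: rPi.
  apply: (@cmeas_sum _ _ _ _ p (fun (q : Rn * C) (v : T) => q.2 * (psi (q.1 + k.+1%:R^-1 *: (v : Rn)) - psi q.1))) => q.
  apply: cmeasM; first exact: cmeas_cst.
  apply: cmeasB; last exact: cmeas_cst.
  apply: (cmeas_comp mpsi); apply: measurable_addrv; first exact: measurable_cst.
  by apply: measurable_scalev; exact: measurable_id.
- by under eq_fun do rewrite EFinD; exact: integrableD.
move=> v; rewrite cabsM cabs_rC ger0_norm// (mulrA (2 * V)) -mulrDl mulrC.
apply: ler_wpM2r => //.
have [vd|vd] := leP `|v : Rn| (d * k.+1%:R).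
  apply: (@le_trans _ _ (e / 2)).
    apply: (hd _ _ s p sp p1); rewrite normrZ normfV normr_nat mulrC ler_pdivrMr//.
  by rewrite lerDl !mulr_ge0// ?(ltW V0)//; case/andP : (b01 k v).
have -> : b k v = 1.
  by rewrite /b indicE memNset ?subr0// /cube /= subr0; apply/negP; rewrite -ltNge.
have h1 := VleD (Vle_translate (k.+1%:R^-1 *: (v : Rn)) VV) (VleN VV).
by have := h1 s p sp p1; rewrite mulr1; move: (cabs _) => z; lra.
Unshelve. all: by end_near.
Qed.
End Vnorm.

(** * Local boundedness *)

Lemma integrableD_EFin (R : realType) d (X : measurableType d) (m : {measure set X -> \bar R}) (f g : X -> R) :
  m.-integrable setT (fun x => (f x)%:E) -> m.-integrable setT (fun x => (g x)%:E) ->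
  m.-integrable setT (fun x => (f x + g x)%:E).
Proof. by move=> fi gi; under eq_fun do rewrite EFinD; exact: integrableD. Qed.

Lemma swap_scalars (K : comPzRingType) (A B c s p q : K) : A * B = 1 ->
  A * (c * (p * (B * s * q))) = s * (p * (c * q)).
Proof.
move=> AB; transitivity ((A * B) * (s * (p * (c * q)))); first by ring.
by rewrite AB mul1r.
Qed.

Section local.
Variables (R : realType) (n : nat).
Local Notation Rn := 'rV[R]_n.
Local Notation T := (BorelRd R n).
Local Notation C := R[i].
Local Notation mu := (@leb R n).
Local Notation c2 := (twopid R n).

Lemma nice_ballind : nice (@ballind R n).
Proof.
have sq (x : Rn) : enorm x <= 4^-1 -> forall i, `|x ord0 i| <= 4^-1.
  move=> xe i; apply: le_trans xe; rewrite -sqrtr_sqr ler_wsqrtr//.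
  rewrite /dotp (bigD1 i)//= -expr2 lerDl; apply: sumr_ge0 => j _; by rewrite -expr2 sqr_ge0.
split.
- have -> : @ballind R n = fun x => rC (\1_[set x : T | enorm (x : Rn) <= 4^-1] x).
    apply/funext => x; rewrite /ballind indicE; case: ifPn => h; first by rewrite mem_set.
    by rewrite memNset //; exact/negP.
  apply: cmeas_rC; apply: measurable_indic; rewrite -[X in measurable X]setTI.
  have mE : measurable_fun setT (fun x : T => enorm (x : Rn)).
    apply: (measurableT_comp (f := fun r : R => Num.sqrt r) (g := fun x : T => dotp (x : Rn) x)).
      by apply: continuous_measurable_fun; exact: sqrt_continuous.
    by apply: measurable_dotp; exact: measurable_id.
  by have := mE measurableT _ (measurable_itv (Interval -oo%O (BRight 4^-1))); congr (measurable (_ `&` _)).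
- exists 1; split => // x; rewrite /ballind; case: ifP => _; rewrite ?cabs1 ?cabs0//.
exists 1; split => // x x1; rewrite /ballind; case: ifPn => // /sq h.
have : cube 0 4^-1 x by apply/cubeP => [|i]; rewrite ?invr_ge0// mxE subr0.
rewrite /cube /= subr0 => h'.
have h4 : (4^-1 : R) <= 1 by rewrite invf_le1// ler1n.
by have := lt_le_trans x1 (le_trans h' h4); rewrite ltxx.
Qed.

Lemma nice_ind4 : nice (@ind4 R n).
Proof. by have b := nice_ballind; rewrite /ind4; do 3! apply: nice_conv => //. Qed.

Lemma niceZ (c : C) (f : T -> C) : nice f -> nice (fun x => c * f x).
Proof.
move=> nf; have := niceM_bdd (M := cabs c) nf (cmeas_cst T c) => /(_ (fun x => lexx _)).
by congr nice; apply/funext => x; rewrite mulrC.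
Qed.

Lemma nice_e0 : nice (@e0 R n).
Proof. by apply: niceZ; exact: nice_ind4. Qed.

Lemma nice_dilate (f : T -> C) (a : R) : a != 0 -> nice f -> nice (fun x : T => f (a *: (x : Rn))).
Proof.
by move=> a0 nf; have := nice_affine 0 a0 nf; congr nice; apply/funext => x; rewrite addr0.
Qed.

Lemma nice_en N : nice (@en R n N.+1).
Proof.
have N0 : (N.+1%:R : R) != 0 by rewrite pnatr_eq0.
by have := niceZ (rC (N.+1%:R ^+ n)) (nice_dilate N0 nice_e0).
Qed.

(** Uniformity in [N] rests on this: dilation by [N + 1] shrinks the support and, with its
    normalising factor, preserves the L^1 norm. *)
Lemma en_uniform : exists r I : R, [/\ 0 < r, 0 <= I, forall N (x : Rn), r < `|x| -> en N.+1 x = 0 &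
  forall N, \int[mu]_x cabs (en N.+1 x) = I].
Proof.
have [m0 b0 [r [r0 z0]]] := nice_e0.
have e0i := cintegrable_cabs (nice_leb nice_e0).
exists r, (\int[mu]_x cabs (e0 x)); split => //.
- by apply: Rintegral_ge0 => x _; exact: cabs_ge0.
- move=> N x xr; rewrite /en z0 ?mulr0//; apply: lt_le_trans xr _.
  by rewrite normrZ normr_nat ler_peMl// ler1n.
move=> N; have N0 : (N.+1%:R : R) != 0 by rewrite pnatr_eq0.
have [i1 ->] := integrable_affine 0 N0 e0i.
rewrite -RintegralZl_T//; apply: eq_Rintegral => x _.
by rewrite addr0 /en cabsM cabs_rC normrX.
Qed.

Lemma hatF_ccontinuous g : cintegrable mu g -> ccontinuous (hatF g).
Proof.
move=> gi; apply: seq_ccontinuous => u x ux; rewrite (hatF_FT _ gi).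
apply: (ccvg_ext (u := fun k => rC c2 * FT g (- u k))) => [k|]; first by rewrite (hatF_FT _ gi).
apply: ccvgM; first exact: ccvg_cst.
exact: (ccontinuous_seq (FT_continuous gi) (u := fun k => - u k) (cvgN ux)).
Qed.

Lemma inA_hatF g : cintegrable mu g -> inA (hatF g).
Proof.
move=> gi; split.
  split; first exact: hatF_ccontinuous.
  exists (c2 * \int[mu]_x cabs (g x)) => t.
  rewrite (hatF_FT _ gi) cabsM cabs_rC (gtr0_norm (@twopid_gt0 R n)) ler_pM2l ?twopid_gt0//.
  exact: FT_le.
exists (fun=> g); split; first by move=> k; apply/L1P.
apply/Vnorm_cvg0 => e e0; exists 0%N => k _ s p sp p1.
rewrite /pair_sum big1 ?cabs0 ?ltW// => q _; by rewrite subrr mulr0.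
Qed.

(** By dominated convergence [chi (x / (k + 1)) H] tends to [chi 0 H] in L^1, which gives the Cauchy
    property and the limit of the norms. *)
Lemma L1cauchy_dilate (chi H : Rn -> C) : Cc chi -> cintegrable mu (H : T -> C) ->
  L1cauchy (fun k x => chi (k.+1%:R^-1 *: x) * H x) /\
  forall B M : R, (forall x, cabs (chi x) <= B) -> B * \int[mu]_x cabs (H x) <= M ->
    limn (fun k => L1norm (fun x => chi (k.+1%:R^-1 *: x) * H x)) <= M.
Proof.
move=> cc Hi; have [B0 [B00 chiB]] := Cc_bounded cc.
have mchi : cmeas (chi : T -> C) by apply: ccontinuous_cmeas; case: cc.
have Ha := cintegrable_cabs Hi.
have mck k : cmeas (fun x : T => chi (k.+1%:R^-1 *: (x : Rn))).
  by apply: (cmeas_comp mchi); apply: measurable_scalev; exact: measurable_id.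
have gi k : cintegrable mu (fun x : T => chi (k.+1%:R^-1 *: (x : Rn)) * H x).
  have := cintegrableM_bdd Hi (mck k) (fun x => chiB _); congr cintegrable.
  by apply/funext => x; rewrite mulrC.
have cchi u : ccvg (fun k => chi (k.+1%:R^-1 *: u)) (chi 0).
  by apply: ccontinuous_seq; [case: cc|exact: cvg_scale0].
split.
  split; first by move=> k; apply/L1P; exact: gi.
  pose dk k := \int[mu]_x cabs ((chi (k.+1%:R^-1 *: (x : Rn)) - chi 0) * H x).
  have dlim : dk @ \oo --> (0 : R).
    have <- : \int[mu]_v (0 : R) = 0 by rewrite /Rintegral integral0.
    apply: (@Rintegral_dct _ _ _ mu (fun k (x : T) => cabs ((chi (k.+1%:R^-1 *: (x : Rn)) - chi 0) * H x)) (fun=> 0) (fun x => 2 * B0 * cabs (H x))).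
    - move=> k; apply: measurable_cabs; apply: cmeasM; last by case: Hi.
      by apply: cmeasB; [exact: mck|exact: cmeas_cst].
    - move=> x; have := ccvg_cabs (ccvgM (ccvgD (cchi x) (ccvg_cst (- chi 0))) (ccvg_cst (H x))).
      by rewrite subrr mul0r cabs0.
    - exact: integrableZl_EFin.
    - move=> k x; rewrite ger0_norm ?cabs_ge0// cabsM ler_wpM2r ?cabs_ge0//.
      by apply: le_trans (cabsD _ _) _; rewrite cabsN; have := chiB (k.+1%:R^-1 *: (x : Rn)); have := chiB 0; lra.
  move=> e e0; have e2 : 0 < e / 2 by rewrite divr_gt0.
  have [N _ hN] := cvgr_le _ dlim _ e2.
  exists N => k m kN mN.
  have di k' : cintegrable mu (fun x : T => (chi (k'.+1%:R^-1 *: (x : Rn)) - chi 0) * H x).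
    have := cintegrableB (gi k') (cintegrableZ (chi 0) Hi); congr cintegrable.
    by apply/funext => x; rewrite mulrBl.
  have dii := cintegrableB (gi k) (gi m).
  rewrite L1normE; last by case: dii.
  apply: (@le_trans _ _ (dk k + dk m)); last by have := hN k kN; have := hN m mN; rewrite /=; lra.
  rewrite /dk -RintegralD//; try exact: cintegrable_cabs.
  apply: le_Rintegral => //; first exact: cintegrable_cabs.
    by apply: integrableD_EFin; exact: cintegrable_cabs.
  move=> x _; set a := chi (k.+1%:R^-1 *: _); set b := chi (m.+1%:R^-1 *: _).
  have -> : a * H x - b * H x = (a - chi 0) * H x + - ((b - chi 0) * H x) by ring.
  by apply: le_trans (cabsD _ _) _; rewrite cabsN.
move=> B M cB BM.
have B_ge0 : 0 <= B by apply: le_trans (cB 0); exact: cabs_ge0.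
have LE k : L1norm (fun x => chi (k.+1%:R^-1 *: x) * H x) = \int[mu]_x cabs (chi (k.+1%:R^-1 *: (x : Rn)) * H x).
  by rewrite L1normE//; case: (gi k).
have lim : (fun k => L1norm (fun x => chi (k.+1%:R^-1 *: x) * H x)) @ \oo --> \int[mu]_x cabs (chi 0 * H x).
  under eq_fun do rewrite LE.
  apply: (@Rintegral_dct _ _ _ mu (fun k (x : T) => cabs (chi (k.+1%:R^-1 *: (x : Rn)) * H x)) (fun x => cabs (chi 0 * H x)) (fun x => B * cabs (H x))).
  - by move=> k; apply: measurable_cabs; case: (gi k).
  - by move=> x; apply: ccvg_cabs; apply: ccvgM; [exact: cchi|exact: ccvg_cst].
  - exact: integrableZl_EFin.
  - by move=> k x; rewrite ger0_norm ?cabs_ge0// cabsM ler_wpM2r ?cabs_ge0.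
rewrite (cvg_lim _ lim)//; apply: le_trans BM.
rewrite -RintegralZl_T//; apply: le_Rintegral => //.
- by apply: cintegrable_cabs; exact: cintegrableZ.
- exact: integrableZl_EFin.
by move=> x _; rewrite cabsM ler_wpM2r ?cabs_ge0.
Qed.

(** After Tonelli only [y] in the cube of radius [rh + re] contribute, since [x] lies in the support
    of [h] and [x - y] in that of [e]; for each such [y] the integral in [x] is at most [Bh Ie].
    Only the support radius and the L^1 norm of [e] enter. *)
Lemma local_bound (lam : {measure set T -> \bar R}) (h e : T -> C) (Bh Ie rh re : R) : cube_bounded lam ->
  cintegrable mu h -> nice e -> (forall x, cabs (h x) <= Bh) -> 
  (forall x : Rn, rh < `|x| -> h x = 0) -> (forall x : Rn, re < `|x| -> e x = 0) ->
  \int[mu]_x cabs (e x) = Ie ->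
  \int[mu]_x (cabs (h x) * cabs (CI lam (fun y : T => e ((x : Rn) - (y : Rn))))) <=
    Bh * Ie * fine (lam (cube 0 (rh + re))).
Proof.
move=> tb hi ne hB hz ez eI.
have Bh0 : 0 <= Bh by apply: le_trans (hB 0); exact: cabs_ge0.
have lf := cube_bounded_locfin tb; have sf := locfin_sigma_finite lf; pose lam' := to_sigma_finite sf.
have me : cmeas e by case: ne.
have mh : cmeas h by case: hi.
have de := nice_dominated ne.
have [M [M0 b]] := dominated_bound tb me de.
have ei := nice_leb ne.
have Ie0 : 0 <= Ie by rewrite -eI; apply: Rintegral_ge0 => x _; exact: cabs_ge0.
have mJ : cmeas (fun x : T => CI lam (fun y : T => e ((x : Rn) - (y : Rn)))).
  apply: (@measurable_CI2 _ _ _ _ _ lam' (fun u x : T => e ((u : Rn) - (x : Rn)))).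
    by apply: (cmeas_comp me); exact: measurable_sub2.
  by move=> u; have [] := b _ (iso_map_reflect u).
have Jb x : cabs (CI lam (fun y : T => e ((x : Rn) - (y : Rn)))) <= \int[lam]_y cabs (e ((x : Rn) - (y : Rn))).
  by have [i1 _] := b _ (iso_map_reflect x); exact: cabs_CI.
have JM x : cabs (CI lam (fun y : T => e ((x : Rn) - (y : Rn)))) <= M.
  by have [i1 i2] := b _ (iso_map_reflect x); apply: le_trans (cabs_CI i1) _; rewrite -lee_fin -(cintegrable_EFin i1).
have hJi : mu.-integrable setT (fun x : T => (cabs (h x) * cabs (CI lam (fun y : T => e ((x : Rn) - (y : Rn)))))%:E).
  have := cintegrable_cabs (cintegrableM_bdd hi mJ JM); congr (_.-integrable _ _).
  by apply/funext => x; rewrite cabsM.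
have mcut : measurable_fun setT (fun z : T * T => cabs (h z.1) * cabs (e ((z.1 : Rn) - (z.2 : Rn)))).
  apply: measurable_funM; apply: measurable_cabs.
    by apply: (cmeas_comp mh); exact: measurable_fst.
  by apply: (cmeas_comp me); exact: measurable_sub2.
have lfin := lf (rh + re).
have lamE : ((fine (lam (cube 0 (rh + re))))%:E = lam (cube 0 (rh + re)))%E by rewrite fineK// ge0_fin_numE.
have hJE : ((\int[mu]_x (cabs (h x) * cabs (CI lam (fun y : T => e ((x : Rn) - (y : Rn))))))%:E =
    \int[mu]_x (cabs (h x) * cabs (CI lam (fun y : T => e ((x : Rn) - (y : Rn)))))%:E)%E.
  by rewrite /Rintegral fineK//; exact: integrable_fin_num.
rewrite -lee_fin hJE EFinM lamE.
apply: (@le_trans _ _ (\int[mu]_x \int[lam']_y (cabs (h x) * cabs (e ((x : Rn) - (y : Rn))))%:E)%E).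
  apply: ge0_le_integral => //.
  - by move=> x _; rewrite lee_fin mulr_ge0// cabs_ge0.
  - by case/integrableP : hJi.
  - apply: (@measurable_fun_fubini_tonelli_F _ _ _ _ _ lam' (fun z : T * T => (cabs (h z.1) * cabs (e ((z.1 : Rn) - (z.2 : Rn))))%:E)).
      exact/measurable_EFinP.
    by move=> z; rewrite lee_fin mulr_ge0// cabs_ge0.
  move=> x _; have [i1 _] := b _ (iso_map_reflect x).
  rewrite (@ge0_integralZl_EFin _ _ _ lam' (cabs (h x)) (fun y => cabs (e ((x : Rn) - (y : Rn))))).
  - rewrite (cintegrable_EFin i1) -EFinM lee_fin; apply: ler_wpM2l; first exact: cabs_ge0.
    exact: Jb.
  - by apply: measurable_cabs; case: i1.
  - by move=> y; exact: cabs_ge0.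
  - exact: cabs_ge0.
rewrite (@tonelli _ _ _ _ _ mu lam' (fun x y : T => cabs (h x) * cabs (e ((x : Rn) - (y : Rn)))) mcut); last first.
  by move=> x y; rewrite mulr_ge0// cabs_ge0.
have mcub := @measurable_cube R n 0 (rh + re).
have -> : ((Bh * Ie)%:E * lam (cube 0 (rh + re)) = \int[lam']_y (Bh * Ie * \1_(cube 0 (rh + re)) (y : Rn))%:E)%E.
  have mi : measurable_fun setT (fun y : T => \1_(cube 0 (rh + re)) (y : Rn) : R) by exact: measurable_indic.
  have i0 (y : T) : 0 <= \1_(cube 0 (rh + re)) (y : Rn) :> R by rewrite indicE.
  by rewrite (ge0_integralZl_EFin lam mi i0 (mulr_ge0 Bh0 Ie0)) integral_indic// setIT.
apply: ge0_le_integral => //.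
- by move=> y _; apply: integral_ge0 => x _; rewrite lee_fin mulr_ge0// cabs_ge0.
- apply: (@measurable_fun_fubini_tonelli_G _ _ _ _ _ mu (fun z : T * T => (cabs (h z.1) * cabs (e ((z.1 : Rn) - (z.2 : Rn))))%:E)).
    exact/measurable_EFinP.
  by move=> z; rewrite lee_fin mulr_ge0// cabs_ge0.
- by apply/measurable_EFinP; apply: measurable_funM => //; exact: measurable_indic.
move=> y _; have me_y : measurable_fun setT (fun x : T => cabs (e ((x : Rn) - (y : Rn)))).
  apply: measurable_cabs; apply: (cmeas_comp me); apply: measurable_subrv; [exact: measurable_id|exact: measurable_cst].
rewrite indicE; have [yc|yc] := boolP ((y : Rn) \in cube 0 (rh + re)).
  rewrite mulr1; apply: (@le_trans _ _ (\int[mu]_x (Bh * cabs (e ((x : Rn) - (y : Rn))))%:E)%E).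
    apply: ge0_le_integral => //.
    - by move=> x _; rewrite lee_fin mulr_ge0// cabs_ge0.
    - by apply/measurable_EFinP; apply: measurable_funM => //; exact: measurable_cabs.
    - by apply/measurable_EFinP; apply: measurable_funM.
    - by move=> x _; rewrite lee_fin ler_wpM2r ?cabs_ge0.
  rewrite (@ge0_integralZl_EFin _ _ _ mu Bh (fun x : T => cabs (e ((x : Rn) - (y : Rn))))) //; last by move=> x; exact: cabs_ge0.
  by rewrite (cintegrable_translate_EFin y ei) eI EFinM.
rewrite mulr0 integral0_eq// => x _.
have [xr|xr] := leP `|x : Rn| rh; last by rewrite hz ?cabs0 ?mul0r.
rewrite ez ?cabs0 ?mulr0// ltNge; apply/negP => xy; move/negP: yc; apply; rewrite inE /cube /= subr0.
by have := ler_normB (x : Rn) ((x : Rn) - y); rewrite subKr; lra.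
Qed.

(** * The witness for local boundedness *)

Section locbdd.
Variables (phi : Rn -> C) (m : nat -> {measure set T -> \bar R}).
Hypotheses (Mphi : MA phi) (tb : forall j, cube_bounded (m j)).
Hypothesis idE : forall G : Rn -> C, Cc G -> cintegrable mu (FT G) ->
  cpI m G = rC (c2 ^+ 2) * CI mu (fun t : T => phi t * FT G t).

Lemma nice_local (chi : Rn -> C) (e : T -> C) : Cc chi -> nice e ->
  nice (fun x : T => chi x * cpI m (fun y : T => e ((x : Rn) - (y : Rn)))).
Proof.
move=> cc ne; have [h1 [M h2]] := translate_bounded tb (let: And3 h _ _ := ne in h) (nice_dominated ne).
exact: (niceM_bdd (Cc_nice cc) h1 h2).
Qed.

(** The transform of the truncated convolution is the integral over the measure of a single function
    [G] in [Cc], so [idE] applies. [FT G] is the product of the spectrum of [j], concentrated near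
    [t] at scale [a], and [hatF e]. *)
Lemma hatF_local (j : Rn -> C) (e : T -> C) (a : R) (t : Rn) : Cc j -> nice e -> 0 < a ->
  hatF (fun x => conv j (invol j) (a *: x) * cpI m (fun y : T => e (x - (y : Rn)))) t =
  rC (c2 ^+ 2) * CI mu (fun v : T => specF j v * (phi (t + a *: (v : Rn)) * hatF e (t + a *: (v : Rn)))).
Proof.
move=> cj ne a0; have an0 : a != 0 by rewrite gt_eqF.
have b0 : 0 < a^-1 by rewrite invr_gt0.
set chi := conv j (invol j); have cchi : Cc chi := Cc_auto cj.
have cca := Cc_dilate a0 cchi.
have nF := nice_local cca ne; have Fi := nice_leb nF.
have ei := nice_leb ne; have me := ei.1.
rewrite (hatF_FT _ Fi).
(* The cut-off together with the character at [- t]; [G] is its convolution with the reflection of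
   [e]. *)
pose F2 := fun x : Rn => expi (dotp x (- t)) * chi (a *: x).
have cF2 : Cc F2.
  have := Cc_mul cca (ccontinuous_expi (- t) 1); congr Cc; apply/funext => x.
  by rewrite mul1r mulrC.
have F2i := nice_leb (Cc_nice cF2).
pose e' := fun x : T => e (0 - (x : Rn)).
have ne' : nice e' by exact: nice_reflect.
have ei' := nice_leb ne'.
pose G := conv F2 e'.
have cG : Cc G by exact: conv_Cc.
have ci := nice_leb (Cc_nice cchi).
have FTF2 s : FT F2 s = rC (a ^- n) * specF j (a^-1 *: s + - (a^-1 *: t)).
  rewrite (FT_modul (fun x : T => chi (a *: (x : Rn))) (- t) s) (FT_dilate _ a0 ci).
  by rewrite (FT_conv_invol _ (Cc_nice cj)) scalerBr.
have FTe' s : rC c2 * FT e' s = hatF e s.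
  rewrite (hatF_FT _ ei); congr (_ * _).
  have [_ E] := CI_reflect 0 (FT_cint (- s) ei); apply: eq_trans E.
  by apply: eq_CI => y; rewrite /e' sub0r dotpNl dotpNr opprK.
have FTG s : FT G s = FT F2 s * FT e' s by apply: FT_conv => //; exact: Cc_nice.
have mFe : cmeas (FT e' : T -> C) by exact: FT_cmeas.
have an0' : a^-1 != 0 by rewrite gt_eqF.
have [Sai _] := CI_affine (- (a^-1 *: t)) an0' (specF_cintegrable cj).
have FGi : cintegrable mu (FT G).
  have := cintegrableM_bdd (cintegrableZ (rC (a ^- n)) Sai) mFe (fun x => FT_le x ei').
  by congr cintegrable; apply/funext => s; rewrite FTG FTF2.
have step1 : FT (fun x : T => chi (a *: (x : Rn)) * cpI m (fun y : T => e ((x : Rn) - (y : Rn)))) (- t) = cpI m G.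
  transitivity (CI mu (fun x : T => F2 x * cpI m (fun y : T => e ((x : Rn) - (y : Rn))))).
    by apply: eq_CI => x; rewrite /F2 mulrA.
  rewrite (cp_fubini tb me F2i (nice_dominated ne)); apply: eq_cpI => y.
  rewrite /G (convE _ (Cc_nice cF2) ne'); apply: eq_CI => u.
  by rewrite /e' sub0r opprB.
rewrite step1 (idE cG FGi) mulrCA; congr (_ * _).
have [cphi [Mp phiM]] := Mphi.1.
have mphi := ccontinuous_cmeas cphi.
have Pi : cintegrable mu (fun s : T => phi s * FT G s).
  have := cintegrableM_bdd FGi mphi phiM; congr cintegrable; apply/funext => s; exact: mulrC.
rewrite -(CIZ _ Pi).
(* The substitution [s = a v + t] brings the spectrum to unit scale and leaves a shift by [a v] in
   [phi] and [hatF e]. *)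
have [Pa PE] := CI_affine t an0 (cintegrableZ (rC c2) Pi).
apply: eq_trans PE _; rewrite (gtr0_norm a0) -(CIZ _ Pa); apply: eq_CI => v.
rewrite FTG FTF2 scalerDr scalerA (mulVf an0) scale1r addrK (addrC t) -FTe'.
have e1 : rC (a ^+ n) * rC (a ^- n) = 1 :> C by rewrite -rCM mulfV ?rC1 ?expf_neq0.
exact: (swap_scalars _ _ _ _ e1).
Qed.

Lemma LocBdd_of_identity : LocBdd phi.
Proof.
have [j [cj j0]] := ex_test R n.
set chi := conv j (invol j) in j0; have cchi : Cc chi := Cc_auto cj.
have Si := specF_cintegrable cj.
have [I1 _] := (cintegrableP _ _).1 Si.
pose I0 := \int[mu]_v (cabs (FT j v) ^+ 2).
have I00 : 0 < I0.
  (* [I0] is [c0] times the autocorrelation of [j] at 0, both nonzero. *)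
  have I0n : I0 != 0.
    apply/eqP => I0z; have [c0 [c00 cP]] := spec_integral R n.
    have := cP j cj 0; rewrite oppr0 FT0 (_ : CI _ _ = rC I0); last by rewrite -CI_rC.
    rewrite I0z rC0 => /esym/eqP; rewrite mulf_eq0 rC_eq0 (negbTE j0) orbF => /eqP c0z.
    by rewrite c0z ltxx in c00.
  by rewrite lt_neqAle eq_sym I0n; apply: Rintegral_ge0 => v _; exact: sqr_ge0.
have c20 := @twopid_gt0 R n.
(* Cancels the constant of [hatF_local] and makes the weight [Phi] a probability density, as
   [V_approx] requires. *)
pose kap := (c2 ^+ 2 * I0)^-1.
have kap0 : 0 < kap by rewrite invr_gt0 mulr_gt0// exprn_gt0.
pose Phi (v : T) : R := I0^-1 * cabs (FT j v) ^+ 2.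
have Pi : mu.-integrable setT (fun v => (Phi v)%:E) by exact: integrableZl_EFin.
have Phi0 v : 0 <= Phi v by rewrite mulr_ge0 ?sqr_ge0// invr_ge0 ltW.
have Phi1 : \int[mu]_v Phi v = 1 by rewrite RintegralZl_T// mulVf// gt_eqF.
pose E N (x : Rn) := cpI m (fun y : T => en N.+1 (x - (y : Rn))).
pose F N k x := rC kap * (chi (k.+1%:R^-1 *: x) * E N x).
have a0 k : 0 < (k.+1%:R^-1 : R) by rewrite invr_gt0.
have nF N k : nice (fun x : T => chi (k.+1%:R^-1 *: (x : Rn)) * E N x).
  exact: (nice_local (Cc_dilate (a0 k) cchi) (nice_en N)).
have mE N : cmeas (E N : T -> C) /\ exists M : R, forall u : T, cabs (E N u) <= M.
  have ne := nice_en N.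
  exact: (translate_bounded tb (let: And3 h _ _ := ne in h) (nice_dominated ne)).
exists F; split; last split; last split.
- by move=> N k; apply/L1P; apply: cintegrableZ; exact: nice_leb.
- move=> N; pose psi t := phi t * hatF (en N.+1) t.
  (* The multiplier property of [phi]: translation continuity in [A] becomes available for
     [phi hat(e_N)]. *)
  have Apsi : inA psi by apply: Mphi.2; apply: inA_hatF; apply: nice_leb; exact: nice_en.
  apply/Vnorm_cvg0 => eps eps0.
  have [K hK] := V_approx Apsi Phi0 Pi Phi1 eps0.
  exists K => k /hK; apply: Vle_eq => t.
  have [cpsi [Mp psiM]] := Apsi.1.
  have mpsi := ccontinuous_cmeas cpsi.
  have rPi := cintegrable_rC Pi.
  have Ti : cintegrable mu (fun v : T => rC (Phi v) * psi (t + k.+1%:R^-1 *: (v : Rn))).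
    apply: (cintegrableM_bdd (M := Mp) rPi) => [|v]; last exact: psiM.
    apply: (cmeas_comp mpsi); apply: measurable_addrv; first exact: measurable_cst.
    by apply: measurable_scalev; exact: measurable_id.
  have Ui : cintegrable mu (fun v : T => psi t * rC (Phi v)) by exact: cintegrableZ.
  transitivity (CI mu (fun v : T => rC (Phi v) * psi (t + k.+1%:R^-1 *: (v : Rn))) - psi t); last first.
    congr (_ - _); rewrite (hatF_FT _ (cintegrableZ _ (nice_leb (nF N k)))).
    have -> : FT (F N k) (- t) = rC kap * FT (fun x : T => chi (k.+1%:R^-1 *: (x : Rn)) * E N x) (- t).
      rewrite /FT -(CIZ _ (FT_cint _ (nice_leb (nF N k)))); apply: eq_CI => x.
      by rewrite /F mulrCA.
    rewrite mulrCA -(hatF_FT _ (nice_leb (nF N k))) (hatF_local _ cj (nice_en N) (a0 k)).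
    have SPi : cintegrable mu (fun v : T => specF j v * psi (t + k.+1%:R^-1 *: (v : Rn))).
      apply: (cintegrableM_bdd (M := Mp) Si) => [|v]; last exact: psiM.
      apply: (cmeas_comp mpsi); apply: measurable_addrv; first exact: measurable_cst.
      by apply: measurable_scalev; exact: measurable_id.
    rewrite mulrA -rCM -/psi.
    have -> : kap * c2 ^+ 2 = I0^-1 by rewrite /kap invfM mulrAC mulVf ?mul1r// expf_neq0// gt_eqF.
    apply: eq_trans (CIZ (rC I0^-1) SPi) => //.
    by apply: eq_CI => v; rewrite /Phi rCM mulrA.
  have psiE : psi t = CI mu (fun v : T => psi t * rC (Phi v)) by rewrite (CIZ _ rPi) CI_rC Phi1 rC1 mulr1.
  have E2 := congr1 (fun z => CI mu (fun v : T => rC (Phi v) * psi (t + k.+1%:R^-1 *: (v : Rn))) - z) psiE.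
  apply: eq_trans (esym E2); rewrite -(CIB Ti Ui).
  by apply: eq_CI => v; rewrite mulrBr (mulrC (psi t)).
- move=> h ch N.
  have Hi : cintegrable mu (fun x : T => h x * (rC kap * E N x)).
    have [h1 [M h2]] := mE N.
    apply: (cintegrableM_bdd (M := kap * M) (nice_leb (Cc_nice ch))).
      by apply: cmeasM => //; exact: cmeas_cst.
    by move=> x; rewrite cabsM cabs_rC (gtr0_norm kap0) ler_pM2l.
  have [h1 _] := L1cauchy_dilate cchi Hi; move: h1; congr L1cauchy.
  by apply/funext => k; apply/funext => x; rewrite /F mulrCA; congr (_ * _); rewrite mulrCA.
move=> h ch; have [ch' [rh [rh0 hz]]] := CcP ch; have [Bh [Bh0 hB]] := Cc_bounded ch.
have [B [B0 chiB]] := Cc_bounded cchi.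
have [re [Ie [re0 Ie0 ez eI]]] := en_uniform.
(* Free of [N], because [en_uniform] supplies a common support radius and L^1 norm. *)
pose S := \sum_(i < 4) (Bh * Ie * fine (m i (cube 0 (rh + re)))).
exists (B * (kap * S)) => N.
have [h1 [M h2]] := mE N.
have hi := nice_leb (Cc_nice ch).
have Hi : cintegrable mu (fun x : T => h x * (rC kap * E N x)).
  apply: (cintegrableM_bdd (M := kap * M) hi); first by apply: cmeasM => //; exact: cmeas_cst.
  by move=> x; rewrite cabsM cabs_rC (gtr0_norm kap0) ler_pM2l.
have [_ lim] := L1cauchy_dilate cchi Hi.
have FE : (fun k => L1norm (fun x => h x * F N k x)) =
  (fun k => L1norm (fun x => chi (k.+1%:R^-1 *: x) * (h x * (rC kap * E N x)))).
  by apply/funext => k; congr L1norm; apply/funext => x; rewrite /F (mulrCA (rC kap)) (mulrCA (h x)).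
rewrite FE; apply: lim => //; rewrite ler_pM2l//.
have ne := nice_en N; have me := (nice_leb ne).1.
have bi i := dominated_bound (tb i) me (nice_dominated ne).
have hJ (i : nat) : mu.-integrable setT (fun x : T => (cabs (h x) * cabs (CI (m i) (fun y : T => en N.+1 ((x : Rn) - (y : Rn)))))%:E).
  have [Mi [_ MP]] := bi i.
  have sf := locfin_sigma_finite (cube_bounded_locfin (tb i)); pose lam' := to_sigma_finite sf.
  have mJ : cmeas (fun x : T => CI (m i) (fun y : T => en N.+1 ((x : Rn) - (y : Rn)))).
    apply: (@measurable_CI2 _ _ _ _ _ lam' (fun u x : T => en N.+1 ((u : Rn) - (x : Rn)))).
      by apply: (cmeas_comp me); exact: measurable_sub2.
    by move=> u; have [] := MP _ (iso_map_reflect u).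
  have JM (x : T) : cabs (CI (m i) (fun y : T => en N.+1 ((x : Rn) - (y : Rn)))) <= Mi.
    by have [i1 i2] := MP _ (iso_map_reflect x); apply: le_trans (cabs_CI i1) _; rewrite -lee_fin -(cintegrable_EFin i1).
  have := cintegrable_cabs (cintegrableM_bdd hi mJ JM); congr (_.-integrable _ _).
  by apply/funext => x; rewrite cabsM.
have sumi : mu.-integrable setT (fun x : T => (\sum_(i < 4) (cabs (h x) * cabs (CI (m i) (fun y : T => en N.+1 ((x : Rn) - (y : Rn))))))%:E).
  under eq_fun do rewrite -sumEFin.
  by apply: integrable_sum => // i _; exact: hJ.
apply: (@le_trans _ _ (\int[mu]_x (kap * \sum_(i < 4) (cabs (h x) * cabs (CI (m i) (fun y : T => en N.+1 ((x : Rn) - (y : Rn)))))))).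
  apply: le_Rintegral => //; [exact: cintegrable_cabs|exact: integrableZl_EFin|].
  move=> x _; rewrite !cabsM cabs_rC (gtr0_norm kap0) mulrCA ler_pM2l//.
  rewrite -mulr_sumr ler_wpM2l ?cabs_ge0//; apply: le_trans (cabs_sum _ _ _) _.
  by apply: ler_sum => i _; rewrite cabsM cabs_cf mul1r.
rewrite RintegralZl_T// ler_pM2l// /S.
have -> : \int[mu]_x (\sum_(i < 4) (cabs (h x) * cabs (CI (m i) (fun y : T => en N.+1 ((x : Rn) - (y : Rn)))))) =
   \sum_(i < 4) \int[mu]_x (cabs (h x) * cabs (CI (m i) (fun y : T => en N.+1 ((x : Rn) - (y : Rn))))).
  rewrite !big_ord_recr !big_ord0 /= !add0r; under eq_Rintegral do rewrite !big_ord_recr big_ord0 /= add0r.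
  have i01 := integrableD_EFin (hJ 0%N) (hJ 1%N); have i02 := integrableD_EFin i01 (hJ 2%N).
  by rewrite (RintegralD _ i02 (hJ 3%N))// (RintegralD _ i01 (hJ 2%N))// (RintegralD _ (hJ 0%N) (hJ 1%N)).
by apply: ler_sum => i _; exact: (local_bound (tb i) hi ne hB hz (ez N) (eI N)).
Qed.
End locbdd.
End local.

(** * The equivalence *)

Section equivalence.
Variables (R : realType) (n : nat).
Local Notation Rn := 'rV[R]_n.
Local Notation T := (BorelRd R n).
Local Notation C := R[i].
Local Notation mu := (@leb R n).
Local Notation c2 := (twopid R n).

Lemma eq_cpI_measures (m m' : nat -> {measure set T -> \bar R}) (g : T -> C) :
  (forall j : nat, (j < 4)%N -> m j = m' j) -> cpI m g = cpI m' g.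
Proof. by move=> mm; apply: eq_bigr => j _; rewrite mm. Qed.

Lemma cpI_refl (k : {nonneg R}) (m : nat -> {measure set T -> \bar R}) (g : T -> C) : cmeas g ->
  (forall j, cintegrable (m j) (fun x : T => g (- (x : Rn)))) ->
  cpI (fun j => refl k (m j)) g = rC k%:num * cpI m (fun x : T => g (- (x : Rn))).
Proof.
move=> mg gi; rewrite /cpI mulr_sumr; apply: eq_bigr => j _.
by have [_ ->] := CI_refl k mg (gi j); rewrite mulrCA.
Qed.

Lemma checkF_integrable (lam : {measure set T -> \bar R}) (h : Rn -> C) : cintegrable mu (h : T -> C) ->
  lam.-integrable setT (fun x : T => (cabs (checkF h x) ^+ 2)%:E) <-> cintegrable lam (specF h).
Proof.
move=> hi; have c0 := @twopid_gt0 R n.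
have E x : cabs (checkF h x) ^+ 2 = c2 ^+ 2 * cabs (FT h x) ^+ 2.
  by rewrite (checkF_FT _ hi) cabsM cabs_rC (gtr0_norm c0) exprMn.
split=> [ci|si].
  apply: cintegrable_rC; have := integrableZl_EFin (c2 ^- 2) ci; congr (_.-integrable _ _).
  by apply/funext => x; rewrite E mulrA mulVf ?mul1r// expf_neq0// gt_eqF.
have [ri _] := (cintegrableP _ _).1 si; have := integrableZl_EFin (c2 ^+ 2) ri; congr (_.-integrable _ _).
by apply/funext => x; rewrite E.
Qed.

Lemma cpI_checkF (m : nat -> {measure set T -> \bar R}) (h : Rn -> C) : cintegrable mu (h : T -> C) ->
  (forall j, cintegrable (m j) (specF h)) ->
  (forall j, cintegrable (m j) (fun x : T => rC (cabs (checkF h x) ^+ 2))) /\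
  cpI m (fun x : T => rC (cabs (checkF h x) ^+ 2)) = rC (c2 ^+ 2) * cpI m (specF h).
Proof.
move=> hi si; split; first by move=> j; apply: cintegrable_rC; exact: (checkF_integrable (m j) hi).2.
by rewrite -(cpIZ _ si); apply: eq_cpI => x; exact: specF_checkF.
Qed.

Lemma transform_rhs (phi h : Rn -> C) : Cb phi -> Cc h ->
  (iint (fun t : Rn => (cabs (checkF h t) ^+ 2 * cabs (phi t))%:E) < +oo)%E /\
  cint (fun t => rC (cabs (checkF h t) ^+ 2) * phi t) = rC (c2 ^+ 2) * CI mu (fun t : T => specF h t * phi t).
Proof.
move=> bphi ch; have hi := nice_leb (Cc_nice ch); have [_ [M phiM]] := bphi.
have si := cintegrableM_bdd (specF_cintegrable ch) (Cb_cmeas bphi) phiM.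
have E : (fun t : T => rC (cabs (checkF h t) ^+ 2) * phi t) = (fun t => rC (c2 ^+ 2) * (specF h t * phi t)).
  by apply/funext => t; rewrite (specF_checkF _ hi) mulrA.
have ci : cintegrable mu (fun t : T => rC (cabs (checkF h t) ^+ 2) * phi t) by rewrite E; exact: cintegrableZ.
split; last by rewrite (cintE ci) E (CIZ _ si).
have [[m1 m2] lt] := ci.
have Ea (t : T) : cabs (checkF h t) ^+ 2 * cabs (phi t) = cabs (rC (cabs (checkF h t) ^+ 2) * phi t).
  by rewrite cabsM cabs_rC ger0_norm ?sqr_ge0.
rewrite (@ge0_fine_iint R n (fun t => cabs (checkF h t) ^+ 2 * cabs (phi t))).
- by under eq_integral do rewrite Ea.
- by under eq_fun do rewrite Ea; apply: measurable_cabs.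
- by move=> t; rewrite mulr_ge0 ?sqr_ge0 ?cabs_ge0.
Qed.

Lemma LocBdd_of_dt_transformable (phi : Rn -> C) : MA phi -> dt_transformable phi ->
  LocBdd phi /\ exists mu' : cRadon R n, has_transform_dt mu' phi /\ transl_bounded mu'.
Proof.
move=> Mphi [nu hnu]; have bphi := Mphi.1; have c20 := @twopid_gt0 R n.
have si h : Cc h -> forall j, cintegrable (cp nu j) (specF h).
  move=> ch j; apply/(checkF_integrable _ (nice_leb (Cc_nice ch))).
  by have [[i0 i1 i2 i3] _] := hnu h ch; case: j => [|[|[|j]]].
(* [rintegrable] gives integrability against each positive component, so the gliding hump applies to
   each one. *)
have tb j : cube_bounded (cp nu j).
  apply: cube_bounded_of_transform; first exact: cp_locfin.
  move=> h ch; have [_ lt] := si h ch j; apply: le_lt_trans lt; rewrite le_eqVlt; apply/orP; left; apply/eqP.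
  by apply: eq_integral => x _; rewrite cabs_rC ger0_norm ?sqr_ge0.
have hyp h : Cc h -> CI mu (fun t : T => conv h (invol h) t * phi t) = rC (c2 ^+ 2) * cpI (cp nu) (specF h).
  move=> ch; have [_ E] := hnu h ch; have hi := nice_leb (Cc_nice ch).
  have [ci cE] := cpI_checkF hi (si h ch).
  by rewrite -cE -(cmintE ci) -E (cintE (nice_leb (niceM_Cb (nice_auto ch) bphi))).
have [c0 [c00 id0]] := forward_identity bphi tb hyp.
(* The integral of [phi FT G] is [c2^2 c0] times that of [G (- x)] against [nu], and the new measure
   must integrate [G] to [c2^2] times the former; this product is the scale of the reflected
   measure. *)
have kap0 : 0 <= c2 ^+ 2 * (c2 ^+ 2 * c0) by rewrite !mulr_ge0// ?sqr_ge0// ltW.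
pose k := NngNum kap0.
pose m j := refl k (cp nu j).
have tbm j : cube_bounded (m j) by exact: refl_cube_bounded.
have idE G : Cc G -> cintegrable mu (FT G) -> cpI m G = rC (c2 ^+ 2) * CI mu (fun t : T => phi t * FT G t).
  move=> cG FGi; rewrite id0// mulrA -rCM.
  have nG := Cc_nice cG.
  apply: cpI_refl; first by case: nG.
  move=> j; have := nice_reflect 0 nG => nG'.
  have := nice_cintegrable (cube_bounded_locfin (tb j)) nG'; congr cintegrable.
  by apply/funext => x; rewrite sub0r.
split; first exact: LocBdd_of_identity tbm idE.
have [mu' mu'E] := ex_radon_cp (fun j => cube_bounded_locfin (tbm j)).
have tb' j : cube_bounded (cp mu' j) by rewrite mu'E.
exists mu'; split; last exact: cube_bounded_transl_bounded.
move=> h ch; have [fin E] := transform_rhs bphi ch; split; first exact: fin.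
have hi := nice_leb (Cc_nice ch).
have nQ := nice_auto ch.
rewrite E (cmintE (fun j => nice_cintegrable (cube_bounded_locfin (tb' j)) nQ)).
rewrite (eq_cpI_measures (m' := m)); last by move=> j j4; rewrite mu'E; congr m; apply/minn_idPl.
have FQ : FT (conv h (invol h)) = specF h by apply/funext => t; exact: (FT_conv_invol t (Cc_nice ch)).
rewrite idE ?FQ; [|exact: Cc_auto|exact: specF_cintegrable].
by congr (_ * _); apply: eq_CI => t; rewrite mulrC.
Qed.

Lemma dt_transformable_of_transl_bounded (phi : Rn -> C) (mu' : cRadon R n) : MA phi -> has_transform_dt mu' phi -> transl_bounded mu' ->
  dt_transformable phi.
Proof.
move=> Mphi hmu tbmu; have bphi := Mphi.1; have c20 := @twopid_gt0 R n.
(* Real and imaginary parts are decomposed separately, each being bounded in modulus by the complex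
   measure. *)
have [p [q [tp tq pq]]] : exists p q : {measure set T -> \bar R}, [/\ cube_bounded p, cube_bounded q &
    forall g, nice g -> CI (rm1 mu') g - CI (rm2 mu') g = CI p g - CI q g].
  apply: (jordan_cube_bounded (cp_locfin mu' 0) (cp_locfin mu' 1) tbmu) => A _ _ _.
  exact: (ler_cre_cabs (Defs.cmeas mu' A)).
have [p' [q' [tp' tq' pq']]] : exists p q : {measure set T -> \bar R}, [/\ cube_bounded p, cube_bounded q &
    forall g, nice g -> CI (rm3 mu') g - CI (rm4 mu') g = CI p g - CI q g].
  apply: (jordan_cube_bounded (cp_locfin mu' 2) (cp_locfin mu' 3) tbmu) => A _ _ _.
  exact: (ler_cim_cabs (Defs.cmeas mu' A)).
pose m j : {measure set T -> \bar R} := match j with 0%N => p | 1%N => q | 2%N => p' | _ => q' end.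
have tb j : cube_bounded (m j) by case: j => [|[|[|j]]].
have mE g : nice g -> cpI m g = cpI (cp mu') g.
  move=> ng; rewrite /cpI !big_ord_recr !big_ord0 /= !add0r.
  by rewrite !mul1r !mulN1r -pq// !mulNr -!addrA -!mulrBr -pq'.
have hyp h : Cc h -> cpI m (conv h (invol h)) = rC (c2 ^+ 2) * CI mu (fun t : T => specF h t * phi t).
  move=> ch; have nQ := nice_auto ch; have [_ E] := hmu h ch; have [_ E'] := transform_rhs bphi ch.
  by rewrite mE// -E' -E (cmintE (fun j => nice_cintegrable (cp_locfin mu' j) nQ)).
have [c0 [c00 id0]] := backward_identity bphi tb hyp.
(* One [c2^2] comes from [checkF], the rest is the constant of [backward_identity]; the inverse of
   the product is the scale of the reflected measure. *)
have kp : 0 < c2 ^+ 2 * (c2 ^+ 2 * c0) by rewrite !mulr_gt0// exprn_gt0.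
have kap0 : 0 <= (c2 ^+ 2 * (c2 ^+ 2 * c0))^-1 by rewrite invr_ge0 ltW.
pose k := NngNum kap0.
pose mk j := refl k (m j).
have tbm j : cube_bounded (mk j) by exact: refl_cube_bounded.
have [nu nuE] := ex_radon_cp (fun j => cube_bounded_locfin (tbm j)).
have tb' j : cube_bounded (cp nu j) by rewrite nuE.
exists nu => h ch; have hi := nice_leb (Cc_nice ch).
have mS := (specF_cintegrable ch).1.
have dS := specF_dominated ch.
have si j : cintegrable (cp nu j) (specF h).
  have [M [_ MP]] := dominated_bound (tb' j) mS dS.
  by have [+ _] := MP _ (iso_map_translate 0); congr cintegrable; apply/funext => x; rewrite addr0.
have ri j : cintegrable (m j) (fun x : T => specF h (- (x : Rn))).
  have [M [_ MP]] := dominated_bound (tb j) mS dS.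
  by have [+ _] := MP _ (iso_map_reflect 0); congr cintegrable; apply/funext => x; rewrite sub0r.
have [ci cE] := cpI_checkF hi si.
split.
  have ki j := (checkF_integrable (cp nu j) hi).2 (si j).
  by split; [exact: (ki 0%N)|exact: (ki 1%N)|exact: (ki 2%N)|exact: (ki 3%N)].
rewrite (cintE (nice_leb (niceM_Cb (nice_auto ch) bphi))) (cmintE ci) cE.
rewrite (eq_cpI_measures (m' := mk)); last by move=> j j4; rewrite nuE; congr mk; apply/minn_idPl.
rewrite (cpI_refl k mS ri) (id0 h ch) !mulrA -!rCM.
by rewrite -[X in rC X]mulrA mulrCA mulVf ?mulr1 ?rC1 ?mul1r// gt_eqF.
Qed.
End equivalence.

Theorem theorem8p7 (R : realType) (d : nat) (phi : 'rV[R]_d -> R[i]) :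
  (0 < d)%N ->
  MA phi ->
  (dt_transformable phi <->
   (LocBdd phi /\ exists mu : cRadon R d, has_transform_dt mu phi /\ transl_bounded mu)).
Proof.
move=> _ Mphi; split; first exact: LocBdd_of_dt_transformable.
by move=> [_ [mu [h1 h2]]]; exact: dt_transformable_of_transl_bounded h1 h2.
Qed.
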